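(* Let $\Gamma$ be a (discrete) torsion free abelian group that contains a subgroup isomorphic to $\mathbb{Z}^3$, let $G$ be the connected compact abelian group whose character group is $\Gamma$, let $\preceq$ be a linear order making $\Gamma$ an ordered group, and let $\mathcal{B}\subseteq C(G)$ be an admissible algebra. Let $\mathcal{T}(\mathcal{B}^{n\times n})$ denote the minimal closed subgroup of $GL(\mathcal{B}^{n\times n})$ that contains the set $GLT(\mathcal{B}^{n\times n})$ of $\mathcal{B}$-triangularizable matrix functions. Then for every natural $n\ge 2$ there exist infinitely many pathwise connected components of $GL(\mathcal{B}^{n\times n})$ with the property that each one of these components does not intersect $\mathcal{T}(\mathcal{B}^{n\times n})$. In particular, $\mathcal{T}(\mathcal{B}^{n\times n})$ is not dense in $GL(\mathcal{B}^{n\times n})$.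
   Context: $G$ is a connected compact abelian group (written multiplicatively) with (discrete, torsion free, additively written) character group $\Gamma$; $\langle j,g\rangle\in\mathbb{T}$ is the value of the character $j\in\Gamma$ at $g\in G$. A linear order $\preceq$ on $\Gamma$ making it an ordered group is fixed; $\Gamma_+=\{x\in\Gamma: x\succeq 0\}$, $\Gamma_-=\{x\in\Gamma: x\preceq 0\}$. $C(G)$ is the algebra of continuous complex functions on $G$ with the sup norm, and $P(G)$ is its subalgebra of finite linear combinations of the functions $\langle j,\cdot\rangle$, $j\in\Gamma$. The Bohr-Fourier spectrum of $a\in C(G)$ is the set $\sigma(a)$ of $j\in\Gamma$ for which the Bohr-Fourier coefficient $\int_G a(g)\overline{\langle j,g\rangle}\,dg$ (normalized Haar measure) is nonzero. For a unital ring $U$, $U^{n\times n}$ is the ring of $n\times n$ matrices over $U$, and $GL(U^{n\times n})$ is its group of invertible elements. Admissible algebra: a unital Banach algebra $\mathcal{B}\subseteq C(G)$ (a subalgebra containing the constants, with its own Banach algebra norm) such that (1) $P(G)$ is contained and dense in $\mathcal{B}$ (in the norm of $\mathcal{B}$), and (2) $\mathcal{B}$ is inverse closed: $X\in\mathcal{B}\cap GL(C(G))$ implies $X\in GL(\mathcal{B})$. $\mathcal{B}^{n\times n}$ and $GL(\mathcal{B}^{n\times n})$ carry the topology induced by the norm of $\mathcal{B}$; closedness of a subgroup is relative to $GL(\mathcal{B}^{n\times n})$. $\mathcal{B}_\pm$ is the closed unital subalgebra of $a\in\mathcal{B}$ with $\sigma(a)\subseteq\Gamma_\pm$. Triangularizability: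 $A\in\mathcal{B}^{n\times n}$ is $\mathcal{B}$-triangularizable if $A(g)=A_-(g)\,T(g)\,A_+(g)$ for all $g\in G$, for some $A_\pm$ with $A_\pm,A_\pm^{-1}\in\mathcal{B}_\pm^{n\times n}$ and some $T=[t_{ij}]_{i,j=1}^n$ with $t_{ij}\in\mathcal{B}$ for all $i,j$, $t_{ij}=0$ if $i>j$, and $t_{11},\ldots,t_{nn}\in GL(\mathcal{B})$. $GLT(\mathcal{B}^{n\times n})$ is the set of all such $A$ (it is contained in $GL(\mathcal{B}^{n\times n})$). *)

(* Defs.v *)
From HB Require Import structures.
From mathcomp Require Import all_boot all_order all_algebra.
From mathcomp Require Import all_classical all_reals all_analysis.
From mathcomp Require Import complex.

Set Implicit Arguments.
Unset Strict Implicit.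
Unset Printing Implicit Defensive.

Import Order.TTheory GRing.Theory Num.Theory.
Import numFieldNormedType.Exports.

Local Open Scope classical_set_scope.
Local Open Scope ring_scope.

Definition torsion_free (Gam : zmodType) : Prop :=
  forall (x : Gam) (n : nat), x *+ n.+1 = 0 -> x = 0.

Definition contains_Z3 (Gam : zmodType) : Prop :=
  exists f : {additive 'rV[int]_3 -> Gam}, injective f.

Definition ordered_group (Gam : zmodType) (le : rel Gam) : Prop :=
  [/\ reflexive le, antisymmetric le, transitive le, total le
    & forall x y z : Gam, le x y -> le (x + z) (y + z)].

Definition nonneg_cone (Gam : zmodType) (le : rel Gam) : set Gam :=
  [set x | le 0 x].

Definition nonpos_cone (Gam : zmodType) (le : rel Gam) : set Gam :=
  [set x | le x 0].

(* [complex R] gets its usual topology through the alias [_^o] *)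
Definition ccontinuous (R : realType) (G : topologicalType) (f : G -> R[i]) :
  Prop := continuous (f : G -> R[i]^o).

(* the group G is written additively, the library's convention *)
Definition is_character (R : realType) (G : topologicalZmodType)
    (chi : G -> R[i]) : Prop :=
  [/\ ccontinuous chi, forall g, `|chi g| = 1
    & forall g h, chi (g + h) = chi g * chi h].

(* [ev j g] is <j, g>; the map j |-> <j, .> is an isomorphism of Gam onto
   the group of all continuous characters of G *)
Definition character_group (R : realType) (G : topologicalZmodType)
    (Gam : zmodType) (ev : Gam -> G -> R[i]) : Prop :=
  [/\ forall j, is_character (ev j),
      forall i j g, ev (i + j) g = ev i g * ev j g,
      injective ev
    & forall chi, is_character chi -> exists j, ev j = chi].

Definition trig_poly (R : realType) (G : topologicalZmodType)
    (Gam : zmodType) (ev : Gam -> G -> R[i]) : set (G -> R[i]) :=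
  [set f | exists (s : seq Gam) (c : Gam -> R[i]),
     f = fun g => \sum_(j <- s) c j * ev j g].

(* copy of G pointed at 0: the library's measurable types must be pointed *)
Definition pgroup (G : topologicalZmodType) : Type := G.
HB.instance Definition _ (G : topologicalZmodType) :=
  Topological.copy (pgroup G) G.
HB.instance Definition _ (G : topologicalZmodType) :=
  isPointed.Build (pgroup G) (0 : G).

Notation borel G := (g_sigma_algebraType (@open (pgroup G))).

(* translation invariant and outer regular; G being compact, this is the
   normalized Haar measure *)
Definition is_haar (R : realType) (G : topologicalZmodType)
    (mu : probability (borel G) R) : Prop :=
  (forall (A : set (borel G)) (h : G), measurable A ->
     mu [set g : borel G | A ((g : G) + h)] = mu A) /\
  (forall A : set (borel G), measurable A ->
     mu A = ereal_inf [set mu U | U in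
       [set U : set (borel G) | open (U : set (pgroup G)) /\ A `<=` U]]).

Definition bohr_fourier (R : realType) (G : topologicalZmodType)
    (mu : probability (borel G) R) (Gam : zmodType) (ev : Gam -> G -> R[i])
    (a : G -> R[i]) (j : Gam) : R[i] :=
  Complex
    (Rintegral mu setT (fun g : borel G => complex.Re (a g * (ev j g)^*)))
    (Rintegral mu setT (fun g : borel G => complex.Im (a g * (ev j g)^*))).

Definition spectrum (R : realType) (G : topologicalZmodType)
    (mu : probability (borel G) R) (Gam : zmodType) (ev : Gam -> G -> R[i])
    (a : G -> R[i]) : set Gam :=
  [set j | bohr_fourier mu ev a j != 0].

(* A unital Banach algebra contained in C(G): the Banach space [fb_space] is
   embedded in C(G) by [fb_val], and multiplication is pointwise.  The norm of
   the unit is not required to be 1. *)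
Record funBanach (R : realType) (G : topologicalType) := FunBanach {
  fb_space : completeNormedModType R[i];
  fb_val : {linear fb_space -> (G -> R[i])};
  fb_one : fb_space;
  fb_mul : fb_space -> fb_space -> fb_space;
  fb_val_inj : injective fb_val;
  fb_val_cont : forall a, ccontinuous (fb_val a);
  fb_val1 : forall g, fb_val fb_one g = 1;
  fb_valM : forall a b g, fb_val (fb_mul a b) g = fb_val a g * fb_val b g;
  fb_normM : forall a b, `|fb_mul a b| <= `|a| * `|b|
}.

Definition fb_sort (R : realType) (G : topologicalType) (B : funBanach R G) :
  Type := fb_space B.
Coercion fb_sort : funBanach >-> Sortclass.

Section FunBanachRing.
Context (R : realType) (G : topologicalType) (B : funBanach R G).

HB.instance Definition _ := CompleteNormedModule.copy (fb_sort B) (fb_space B).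

Definition fbval (a : B) : G -> R[i] := fb_val B a.

Lemma fbval_inj (a b : B) : (forall g, fbval a g = fbval b g) -> a = b.
Proof. by move=> ab; apply: (@fb_val_inj _ _ B); apply/funext. Qed.

Lemma fbvalD (a b : B) g : fbval (a + b) g = fbval a g + fbval b g.
Proof. by rewrite /fbval linearD. Qed.

Lemma fb_mulA : associative (@fb_mul _ _ B).
Proof. by move=> a b c; apply: fbval_inj => g; rewrite /fbval !fb_valM mulrA. Qed.

Lemma fb_mulC : commutative (@fb_mul _ _ B).
Proof. by move=> a b; apply: fbval_inj => g; rewrite /fbval !fb_valM mulrC. Qed.

Lemma fb_mul1 : left_id (@fb_one _ _ B) (@fb_mul _ _ B).
Proof. by move=> a; apply: fbval_inj => g; rewrite /fbval fb_valM fb_val1 mul1r. Qed.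

Lemma fb_mulDl : left_distributive (@fb_mul _ _ B) (+%R : B -> B -> B).
Proof.
move=> a b c; apply: fbval_inj => g.
by rewrite fbvalD /fbval !fb_valM -mulrDl linearD.
Qed.

HB.instance Definition _ := GRing.Zmodule_isComPzRing.Build (fb_sort B)
  fb_mulA fb_mulC fb_mul1 fb_mulDl.

End FunBanachRing.

Definition invertible (U : pzRingType) (x : U) : Prop :=
  exists y : U, x * y = 1 /\ y * x = 1.

Definition admissible (R : realType) (G : topologicalZmodType)
    (Gam : zmodType) (ev : Gam -> G -> R[i]) (B : funBanach R G) : Prop :=
  [/\ trig_poly ev `<=` range (@fbval R G B),
      dense (@fbval R G B @^-1` trig_poly ev)
    & forall X : B,
        (exists Y : G -> R[i],
           ccontinuous Y /\ forall g, fbval X g * Y g = 1) ->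
        invertible X].

Definition mxval (R : realType) (G : topologicalType) (B : funBanach R G)
    (n : nat) (A : 'M[B]_n) (g : G) : 'M[R[i]]_n :=
  \matrix_(i, j) fbval (A i j) g.

Definition GLmx (R : realType) (G : topologicalType) (B : funBanach R G)
    (n : nat) : set 'M[B]_n :=
  [set A | invertible A].

Definition spectral_subalgebra (R : realType) (G : topologicalZmodType)
    (mu : probability (borel G) R) (Gam : zmodType) (ev : Gam -> G -> R[i])
    (S : set Gam) (B : funBanach R G) : set B :=
  [set a | spectrum mu ev (fbval a) `<=` S].

(* [M] and its inverse both have all their entries in [C] *)
Definition GL_over (R : realType) (G : topologicalType) (B : funBanach R G)
    (C : set B) (n : nat) : set 'M[B]_n :=
  [set M | exists M' : 'M[B]_n,
     [/\ M *m M' = 1%:M, M' *m M = 1%:M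
       & forall i j, C (M i j) /\ C (M' i j)]].

Definition GLT (R : realType) (G : topologicalZmodType)
    (mu : probability (borel G) R) (Gam : zmodType) (ev : Gam -> G -> R[i])
    (le : rel Gam) (B : funBanach R G) (n : nat) : set 'M[B]_n :=
  [set A | exists Am T Ap : 'M[B]_n,
     [/\ GL_over (@spectral_subalgebra R G mu Gam ev (nonpos_cone le) B) Am,
         GL_over (@spectral_subalgebra R G mu Gam ev (nonneg_cone le) B) Ap,
         forall i j : 'I_n, (j < i)%N -> T i j = 0,
         forall i : 'I_n, invertible (T i i)
       & forall g, mxval A g = mxval Am g *m mxval T g *m mxval Ap g]].

Definition closed_subgroup (R : realType) (G : topologicalType)
    (B : funBanach R G) (n : nat) (H : set 'M[B]_n) : Prop :=
  [/\ H `<=` @GLmx R G B n,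
      H 1%:M,
      forall A A', H A -> H A' -> H (A *m A'),
      forall A A', H A -> A *m A' = 1%:M -> A' *m A = 1%:M -> H A'
    & closure H `&` @GLmx R G B n `<=` H].

(* [smallest] is the intersection of all closed subgroups containing GLT *)
Definition Tgroup (R : realType) (G : topologicalZmodType)
    (mu : probability (borel G) R) (Gam : zmodType) (ev : Gam -> G -> R[i])
    (le : rel Gam) (B : funBanach R G) (n : nat) : set 'M[B]_n :=
  smallest (@closed_subgroup R G B n) (@GLT R G mu Gam ev le B n).

Definition path_joined (R : realType) (T : topologicalType) (S : set T)
    (x y : T) : Prop :=
  exists gamma : R -> T,
    [/\ {within `[0, 1], continuous gamma}, gamma 0 = x, gamma 1 = y
      & forall t, t \in `[0, 1] -> S (gamma t)].

Definition path_components (R : realType) (T : topologicalType) (S : set T) :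
    set (set T) :=
  [set P | exists2 x, S x & P = [set y | path_joined R S x y]].

(* Main.v *)
(* Extend the inclusion of Z^3 in Gam to a homomorphism Gam -> C^3; its
   coordinates give three commuting derivations D_i of the trigonometric
   polynomials, with D_i <j, .> proportional to <j, .>. For an invertible matrix
   A of continuously differentiable functions put m_i = A^-1 D_i A and let the
   degree of A be the Haar mean of tr (m_0 [m_1, m_2]). Up to exact terms, whose
   mean is 0, this form is additive in A, so the degree is a homomorphism. It
   vanishes on triangular matrices, hence near the identity, where A = L U; so it
   is locally constant for the uniform norm and extends to GL(B^(n x n)) by
   approximation. It also vanishes when A and A^-1 have spectra in the positive
   (or negative) cone: the form then has spectrum in the cone and no constant
   coefficient. The matrices of degree 0 thus form a closed subgroup that
   contains GLT, and the degree is constant on path components. Finally the loop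
   1 + (w - 1) p, where w is a third character and p an idempotent of nonzero
   Chern number over the torus of the first two, has nonzero degree, and its
   powers lie in infinitely many components. *)
Require Import Defs.
From HB Require Import structures.
From mathcomp Require Import all_boot all_order all_algebra.
From mathcomp Require Import all_classical all_reals all_analysis.
From mathcomp Require Import measurable_realfun complex ring lra.
Import numFieldNormedType.Exports.
Import Order.TTheory GRing.Theory Num.Theory.
Local Open Scope classical_set_scope.
Local Open Scope ring_scope.

Set Implicit Arguments.
Unset Strict Implicit.
Unset Printing Implicit Defensive.

(** * First-order jets *)

(** Why three directions: a copy of Z^3 in the character group maps G onto a 3-torus, and for n >= 2
    the group GL_n(C) has pi_3 = Z; tr (m_0 [m_1, m_2]) is the density of that class, which
    triangular factors cannot see. Two obstacles shape the proof. Elements of B need not have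
    derivatives, and inverses of trigonometric polynomials are not trigonometric polynomials. So a
    jet carries its derivatives as formal data, with no differentiable structure on G, and the
    calculus takes place in the uniform closure of the jets of trigonometric polynomials, where
    geometric series invert whatever is close to 1. Elements of B enter only through uniform
    approximation of their values. The second obstacle is that a function with spectrum in a cone
    has to be approximated by trigonometric polynomials with spectrum in the same cone. An arbitrary
    approximant does not have this property; smoothing with a Fejer kernel does, built on a finite
    set of characters that is almost invariant under the translations in play. *)

(* A value together with three formal first derivatives: the square-zero
   extension of K by K^3. *)
Definition jet (K : fieldType) : Type := (K * 'rV[K]_3)%type.

Section JetRing.
Variable K : fieldType.
Implicit Types x y z : jet K.

HB.instance Definition _ := GRing.Zmodule.copy (jet K) (K * 'rV[K]_3)%type.

Definition jval x : K := x.1.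
Definition jder (i : 'I_3) x : K := x.2 0 i.
Definition mkjet (a : K) (u : 'rV[K]_3) : jet K := (a, u).

Lemma jetP x y : jval x = jval y -> (forall i, jder i x = jder i y) -> x = y.
Proof.
case: x y => [a u] [b v]; rewrite /jval /jder /= => -> uv; congr (_, _).
by apply/rowP.
Qed.

Definition jet_one : jet K := (1, 0).
Definition jet_mul x y : jet K := (x.1 * y.1, x.1 *: y.2 + y.1 *: x.2).

Lemma jet_mulA : associative jet_mul.
Proof.
by move=> x y z; apply: jetP => [|i]; rewrite /jval /jder /= ?mxE ?mulrA //; ring.
Qed.

Lemma jet_mulC : commutative jet_mul.
Proof.
by move=> x y; rewrite /jet_mul mulrC addrC.
Qed.

Lemma jet_mul1 : left_id jet_one jet_mul.
Proof. by move=> x; apply: jetP => [|i]; rewrite /jval /jder /= ?mxE; ring. Qed.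

Lemma jet_mulDl : left_distributive jet_mul +%R.
Proof.
by move=> x y z; apply: jetP => [|i]; rewrite /jval /jder /= ?mxE; ring.
Qed.

Lemma jet_one_neq0 : jet_one != 0.
Proof. by apply/eqP => -[/eqP]; rewrite oner_eq0. Qed.

HB.instance Definition _ := GRing.Zmodule_isComNzRing.Build (jet K)
  jet_mulA jet_mulC jet_mul1 jet_mulDl jet_one_neq0.

Definition jet_unit : {pred jet K} := [pred x | x.1 != 0].
Definition jet_inv x : jet K :=
  if x.1 != 0 then (x.1^-1, - (x.1^-1 ^+ 2) *: x.2) else x.

Lemma jet_mulV : {in jet_unit, left_inverse 1 jet_inv *%R}.
Proof.
move=> x; rewrite inE => x0; rewrite /jet_inv x0.
apply: jetP => [|i]; rewrite /jval /jder /= ?mxE /=; first by rewrite mulVf.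
by field.
Qed.

Lemma jet_unitP x y : y * x = 1 -> jet_unit x.
Proof.
move=> /(congr1 fst) /= yx; apply/eqP => x0.
by move: yx; rewrite x0 mulr0 => /eqP; rewrite eq_sym oner_eq0.
Qed.

Lemma jet_inv_out : {in [predC jet_unit], jet_inv =1 id}.
Proof. by move=> x; rewrite !inE /jet_inv => /negbTE ->. Qed.

HB.instance Definition _ := GRing.ComNzRing_hasMulInverse.Build (jet K)
  jet_mulV jet_unitP jet_inv_out.

Lemma jvalD x y : jval (x + y) = jval x + jval y. Proof. by []. Qed.
Lemma jval0 : jval 0 = 0. Proof. by []. Qed.
Lemma jvalM x y : jval (x * y) = jval x * jval y. Proof. by []. Qed.

Fact jval_is_zmod_morphism : zmod_morphism jval. Proof. by []. Qed.
HB.instance Definition _ := GRing.isZmodMorphism.Build (jet K) K jval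
  jval_is_zmod_morphism.
Fact jval_is_monoid_morphism : monoid_morphism jval. Proof. by []. Qed.
HB.instance Definition _ := GRing.isMonoidMorphism.Build (jet K) K jval
  jval_is_monoid_morphism.

Fact jder_is_zmod_morphism i : zmod_morphism (jder i).
Proof. by move=> x y; rewrite /jder /= !mxE. Qed.
HB.instance Definition _ i := GRing.isZmodMorphism.Build (jet K) K (jder i)
  (jder_is_zmod_morphism i).

Lemma jderM i x y : jder i (x * y) = jder i x * jval y + jval x * jder i y.
Proof. by rewrite /jder /jval /= !mxE addrC [y.1 * _]mulrC. Qed.

Lemma jder1 i : jder i 1 = 0. Proof. by rewrite /jder mxE. Qed.

Lemma jet_unitE x : (x \is a GRing.unit) = (jval x != 0). Proof. by []. Qed.

Lemma jvalV x : jval x != 0 -> jval x^-1 = (jval x)^-1.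
Proof. by rewrite /jval /GRing.inv /= /jet_inv => ->. Qed.

End JetRing.
Arguments jval {K} x.
Arguments jder {K} i x.

(** * The Maurer-Cartan 3-form of a matrix of jets *)

(** Locked to keep simplification from unfolding [inord]; only [ord3_neq] opens it. *)
HB.lock Definition ord3 (k : nat) : 'I_3 := inord k.

Section Omega.
Variable K : fieldType.

Definition mval m n (M : 'M[jet K]_(m, n)) : 'M[K]_(m, n) := map_mx jval M.
Definition mder i m n (M : 'M[jet K]_(m, n)) : 'M[K]_(m, n) := map_mx (jder i) M.

Lemma mvalM m n p (M : 'M[jet K]_(m, n)) (N : 'M[jet K]_(n, p)) :
  mval (M *m N) = mval M *m mval N.
Proof. exact: map_mxM. Qed.

Lemma mderM i m n p (M : 'M[jet K]_(m, n)) (N : 'M[jet K]_(n, p)) :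
  mder i (M *m N) = mder i M *m mval N + mval M *m mder i N.
Proof.
apply/matrixP => a b; rewrite !mxE raddf_sum -big_split /=.
by apply: eq_bigr => c _; rewrite jderM !mxE.
Qed.

Lemma mval1 n : mval (1%:M : 'M[jet K]_n) = 1%:M.
Proof. exact: map_mx1. Qed.

Lemma mder1 i n : mder i (1%:M : 'M[jet K]_n) = 0.
Proof.
by apply/matrixP => a b; rewrite !mxE; case: eqP => _; rewrite ?jder1 // raddf0.
Qed.

Lemma unitmx_mval n (M : 'M[jet K]_n) : (M \in unitmx) = (mval M \in unitmx).
Proof. by rewrite !unitmxE det_map_mx jet_unitE unitfE. Qed.

Lemma mulmx1_invmx (F : comUnitRingType) n (A B : 'M[F]_n) :
  A *m B = 1%:M -> B = invmx A.
Proof.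
move=> AB; have [uA _] := mulmx1_unit AB.
by rewrite -[invmx A]mulmx1 -AB mulKmx.
Qed.

Lemma mval_inv n (M : 'M[jet K]_n) : M \in unitmx ->
  mval (invmx M) = invmx (mval M).
Proof. by move=> uM; apply: mulmx1_invmx; rewrite -mvalM mulmxV // mval1. Qed.

Lemma mder_inv i n (M : 'M[jet K]_n) : M \in unitmx ->
  mder i (invmx M) = - (invmx (mval M) *m mder i M *m invmx (mval M)).
Proof.
move=> uM; have := congr1 (@mder i n n) (mulVmx uM).
rewrite mderM mder1 mval_inv // => /eqP; rewrite addr_eq0 => /eqP e.
have uM0 : mval M \in unitmx by rewrite -unitmx_mval.
by rewrite -[LHS](mulmxK uM0) e mulNmx.
Qed.

Definition logder i n (M : 'M[jet K]_n) : 'M[K]_n :=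
  invmx (mval M) *m mder i M.

(** By cyclicity of the trace this is one third of the coefficient of the 3-form tr (m m m), where m
    = M^-1 dM. *)
Definition omega n (M : 'M[jet K]_n) : K :=
  let l k := logder (ord3 k) M in \tr (l 0%N *m (l 1%N *m l 2%N - l 2%N *m l 1%N)).

(* The coefficient of the 3-form du dv dw. *)
Definition jacobian (u v w : jet K) : K :=
  let d k := jder (ord3 k) in
  d 0%N u * (d 1%N v * d 2%N w - d 2%N v * d 1%N w) +
  d 1%N u * (d 2%N v * d 0%N w - d 0%N v * d 2%N w) +
  d 2%N u * (d 0%N v * d 1%N w - d 1%N v * d 0%N w).

(** The outer factors X and T are grouped because their product becomes the first argument of a
    Jacobian in [cross_jacobian]. *)
Lemma mxtrace4 n (X Y Z T : 'M[K]_n) :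
  \tr (X *m Y *m Z *m T) =
  \sum_a \sum_b \sum_c \sum_d X a b * T d a * (Y b c * Z c d).
Proof.
apply: eq_bigr => a _; rewrite mxE.
transitivity (\sum_d \sum_c \sum_b X a b * T d a * (Y b c * Z c d)).
  apply: eq_bigr => d _; rewrite mxE mulr_suml; apply: eq_bigr => c _.
  rewrite mxE !mulr_suml; apply: eq_bigr => b _.
  by rewrite -!mulrA [Z c d * _]mulrC ![_ * (T d a * _)]mulrCA.
rewrite exchange_big /= [in RHS]exchange_big /=; apply: eq_bigr => c _.
by rewrite exchange_big.
Qed.

(** The entrywise expansion of the exact form d tr (M^-1 dM dN N^-1): each summand is du dv dw, with
    u a product of entries of M^-1 and N^-1, v an entry of M and w an entry of N. *)
Definition cross_jacobian n (M N : 'M[jet K]_n) : K :=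
  \sum_a \sum_b \sum_c \sum_d
    jacobian (invmx M a b * invmx N d a) (M b c) (N c d).

(** The Polyakov-Wiegmann identity. Up to conjugation by N, the logarithmic derivative of M N is a +
    b with a = M^-1 dM and b = dN N^-1. The pure terms of the expanded cubic form are [omega M] and
    [omega N]; the mixed ones make up the exact form. *)
Lemma omegaM n (M N : 'M[jet K]_n) : M \in unitmx -> N \in unitmx ->
  omega (M *m N) = omega M + omega N - cross_jacobian M N.
Proof.
move=> uM uN; have uM0 : mval M \in unitmx by rewrite -unitmx_mval.
have uN0 : mval N \in unitmx by rewrite -unitmx_mval.
set V := invmx (mval M); set W := invmx (mval N).
pose a k := V *m mder (ord3 k) M; pose b k := mder (ord3 k) N *m W.
pose T (x y z : 'M[K]_n) : K := \tr (x *m y *m z).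
have cyc x y z : T x y z = T y z x by rewrite /T -mulmxA mxtrace_mulC.
have lMN k : logder (ord3 k) (M *m N) = W *m (a k + b k) *m mval N.
  rewrite /logder mvalM mderM mulmxDr mulmxDr mulmxDl.
  have -> : invmx (mval M *m mval N) = W *m V.
    symmetry; apply: mulmx1_invmx.
    by rewrite mulmxA mulmxK // mulmxV.
  rewrite /a /b -!mulmxA; congr (_ + _).
  by rewrite (mulKmx uM0) (mulVmx uN0) mulmx1.
have lN k : logder (ord3 k) N = W *m b k *m mval N.
  by rewrite /logder /b -!mulmxA mulVmx // mulmx1.
have conj3 x y z : \tr (W *m x *m mval N *m (W *m y *m mval N *m (W *m z *m mval N)))
    = T x y z.
  rewrite !mulmxA !(mulmxK uN0) mxtrace_mulC !mulmxA mulmxV // mul1mx.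
  by rewrite /T.
have eN : omega N = T (b 0%N) (b 1%N) (b 2%N) - T (b 0%N) (b 2%N) (b 1%N).
  by rewrite /omega !lN mulmxBr raddfB /= !conj3.
have eM : omega M = T (a 0%N) (a 1%N) (a 2%N) - T (a 0%N) (a 2%N) (a 1%N).
  by rewrite /omega mulmxBr raddfB /= /T !mulmxA.
have eMN : omega (M *m N) = T (a 0%N + b 0%N) (a 1%N + b 1%N) (a 2%N + b 2%N)
     - T (a 0%N + b 0%N) (a 2%N + b 2%N) (a 1%N + b 1%N).
  by rewrite /omega !lMN mulmxBr raddfB /= !conj3.
(* The Jacobian term that differentiates M^-1 N^-1, M and N in the directions k, l and m. Both signs
   come from d(M^-1) = - M^-1 dM M^-1. *)
pose U k l m := - T (a k) (a l) (b m) - T (a l) (b m) (b k).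
have eC : cross_jacobian M N =
    U 0%N 1%N 2%N - U 0%N 2%N 1%N + (U 1%N 2%N 0%N - U 1%N 0%N 2%N) +
    (U 2%N 0%N 1%N - U 2%N 1%N 0%N).
  have eU k l m : U k l m = \sum_a \sum_b \sum_c \sum_d
      jder (ord3 k) (invmx M a b * invmx N d a) *
      (jder (ord3 l) (M b c) * jder (ord3 m) (N c d)).
    transitivity (\tr (mder (ord3 k) (invmx M) *m mder (ord3 l) M *m
           mder (ord3 m) N *m mval (invmx N)) +
        \tr (mval (invmx M) *m mder (ord3 l) M *m mder (ord3 m) N *m
           mder (ord3 k) (invmx N))).
      rewrite !mder_inv // !mval_inv // -/V -/W /U /T /a /b.
      rewrite !mulNmx !mulmxN !raddfN /= !mulmxA; congr (_ - _).
    rewrite !mxtrace4 -!big_split; apply: eq_bigr => i _ /=.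
    rewrite -!big_split; apply: eq_bigr => j _ /=.
    rewrite -!big_split; apply: eq_bigr => p _ /=.
    rewrite -!big_split; apply: eq_bigr => q _ /=.
    by rewrite jderM -mulrDl !mxE.
  rewrite !eU -!sumrB -!big_split; apply: eq_bigr => i _ /=.
  rewrite -!sumrB -!big_split; apply: eq_bigr => j _ /=.
  rewrite -!sumrB -!big_split; apply: eq_bigr => p _ /=.
  rewrite -!sumrB -!big_split; apply: eq_bigr => q _ /=.
  by rewrite /jacobian -!mulrBr.
have TDl x x' y z : T (x + x') y z = T x y z + T x' y z.
  by rewrite /T !mulmxDl raddfD.
have TDm x y y' z : T x (y + y') z = T x y z + T x y' z.
  by rewrite /T mulmxDr mulmxDl raddfD.
have TDr x y z z' : T x y (z + z') = T x y z + T x y z'.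
  by rewrite /T mulmxDr raddfD.
rewrite eMN eM eN eC /U !(TDl, TDm, TDr).
(* [ring] sees the traces as atoms, so every cyclic class is given a single representative. *)
rewrite -(cyc (b 0%N) (a 1%N) (b 2%N)) -(cyc (b 0%N) (a 2%N) (b 1%N)).
rewrite -(cyc (b 0%N) (a 1%N) (a 2%N)) (cyc (a 2%N) (b 0%N) (b 1%N)).
rewrite (cyc (a 1%N) (a 0%N) (b 2%N)) (cyc (a 2%N) (a 0%N) (b 1%N)).
rewrite -(cyc (b 0%N) (a 2%N) (a 1%N)) (cyc (a 1%N) (b 0%N) (b 2%N)).
ring.
Qed.

End Omega.

(** * Uniform closure of the trigonometric jets *)

Section Modulus.
Variable R : realType.
Implicit Types x y : R[i].

(** The norm of [R[i]] takes its values in [R[i]]; this real version lets estimates be made in the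
    ordered field R. *)
Definition modc x : R := complex.Re `|x|.

Lemma modcE x : `|x| = (modc x)%:C%C.
Proof. by rewrite /modc normc_def. Qed.

Lemma modc_ge0 x : 0 <= modc x.
Proof. by rewrite -ler0c -modcE. Qed.

Lemma modcD x y : modc (x + y) <= modc x + modc y.
Proof. by rewrite -lecR rmorphD /= -!modcE ler_normD. Qed.

Lemma modcM x y : modc (x * y) = modc x * modc y.
Proof. by apply: complexI; rewrite rmorphM /= -!modcE normrM. Qed.

Lemma modcN x : modc (- x) = modc x.
Proof. by rewrite /modc normrN. Qed.

Lemma modcB x y : modc (x - y) <= modc x + modc y.
Proof. by rewrite -(modcN y) modcD. Qed.

Lemma modc0 : modc 0 = 0.
Proof. by rewrite /modc normr0. Qed.

Lemma modc1 : modc 1 = 1.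
Proof. by rewrite /modc normr1. Qed.

Lemma modc_eq0 x : modc x = 0 -> x = 0.
Proof. by move=> x0; apply/normr0_eq0; rewrite modcE x0. Qed.

Lemma modc_sum (I : Type) (r : seq I) (P : pred I) (F : I -> R[i]) :
  modc (\sum_(i <- r | P i) F i) <= \sum_(i <- r | P i) modc (F i).
Proof.
elim/big_rec2: _ => [|i a b _ ab]; first by rewrite modc0.
by rewrite (le_trans (modcD _ _)) // lerD2l.
Qed.

End Modulus.

Section JetNorm.
Variable R : realType.
Implicit Types x y : jet R[i].

(** A C^1 norm, submultiplicative for every weight t >= 0. Uniform closure is taken with t = 1,
    while small t is what makes inverses converge. *)
Definition jnorm (t : R) (x : jet R[i]) : R :=
  modc (jval x) + t * \sum_i modc (jder i x).

Lemma jnorm_ge0 t x : 0 <= t -> 0 <= jnorm t x.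
Proof.
by move=> t0; rewrite addr_ge0 ?modc_ge0 ?mulr_ge0 ?sumr_ge0 // => i _; exact: modc_ge0.
Qed.

Lemma modc_jval_le t x : 0 <= t -> modc (jval x) <= jnorm t x.
Proof.
by move=> t0; rewrite lerDl mulr_ge0 ?sumr_ge0 // => i _; exact: modc_ge0.
Qed.

Lemma modc_jder_le i x : modc (jder i x) <= jnorm 1 x.
Proof.
rewrite /jnorm mul1r (bigD1 i) //= addrCA lerDl addr_ge0 ?modc_ge0 ?sumr_ge0 //.
by move=> k _; exact: modc_ge0.
Qed.

Lemma jnormD t x y : 0 <= t -> jnorm t (x + y) <= jnorm t x + jnorm t y.
Proof.
move=> t0; rewrite /jnorm addrACA -mulrDr raddfD lerD ?modcD // ler_wpM2l //.
by rewrite -big_split /= ler_sum // => i _; rewrite raddfD modcD.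
Qed.

Lemma jnormN t x : jnorm t (- x) = jnorm t x.
Proof.
rewrite /jnorm raddfN modcN; congr (_ + _ * _); apply: eq_bigr => i _.
by rewrite raddfN modcN.
Qed.

Lemma jnormB t x y : 0 <= t -> jnorm t (x - y) <= jnorm t x + jnorm t y.
Proof. by move=> t0; rewrite -(jnormN t y) jnormD. Qed.

Lemma jnorm1 t : jnorm t 1 = 1.
Proof.
rewrite /jnorm [jval 1]/= modc1 big1 ?mulr0 ?addr0 // => i _.
by rewrite jder1 modc0.
Qed.

Lemma jnorm0 t : jnorm t 0 = 0.
Proof.
rewrite /jnorm raddf0 modc0 big1 ?mulr0 ?addr0 // => i _.
by rewrite raddf0 modc0.
Qed.

Lemma jnormM t x y : 0 <= t -> jnorm t (x * y) <= jnorm t x * jnorm t y.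
Proof.
move=> t0; rewrite /jnorm jvalM modcM.
set X := \sum_i modc (jder i x); set Y := \sum_i modc (jder i y).
have X0 : 0 <= X by apply: sumr_ge0 => i _; exact: modc_ge0.
have Y0 : 0 <= Y by apply: sumr_ge0 => i _; exact: modc_ge0.
have : \sum_i modc (jder i (x * y)) <= X * modc (jval y) + modc (jval x) * Y.
  rewrite mulr_suml mulr_sumr -big_split ler_sum //= => i _.
  by rewrite jderM (le_trans (modcD _ _)) // !modcM.
move/(ler_wpM2l t0) => h.
rewrite mulrDl !mulrDr -addrA lerD2l (le_trans h) //.
rewrite mulrDr addrA [t * (X * _)]mulrA [t * X * _ + _]addrC.
have -> : t * (modc (jval x) * Y) = modc (jval x) * (t * Y) by rewrite mulrCA.
by rewrite lerDl mulr_ge0 // mulr_ge0.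
Qed.

Lemma jnormX t x n : 0 <= t -> jnorm t (x ^+ n) <= jnorm t x ^+ n.
Proof.
move=> t0; elim: n => [|n IH]; first by rewrite jnorm1.
rewrite !exprS (le_trans (jnormM _ _ t0)) // ler_wpM2l // jnorm_ge0 //.
Qed.

Lemma jnorm_sum t (I : Type) (r : seq I) (P : pred I) (F : I -> jet R[i]) :
  0 <= t -> jnorm t (\sum_(i <- r | P i) F i) <= \sum_(i <- r | P i) jnorm t (F i).
Proof.
move=> t0; elim/big_rec2: _ => [|i a b _ ab]; first by rewrite jnorm0.
by rewrite (le_trans (jnormD _ _ t0)) // lerD2l.
Qed.

Lemma jnorm_rescale t x : 0 < t <= 1 -> jnorm 1 x <= t^-1 * jnorm t x.
Proof.
move=> /andP[t0 t1]; rewrite /jnorm mulrDr mulrA mulVf ?gt_eqF // lerD2r.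
by rewrite ler_peMl ?modc_ge0 // invf_ge1.
Qed.

Lemma exp_small (r e : R) : 0 <= r < 1 -> 0 < e -> exists N, r ^+ N <= e.
Proof.
move=> /andP[r0 r1] e0.
have := @cvg_geometric R 1 r; rewrite ger0_norm // => /(_ r1).
move=> /cvgrPdist_le /(_ e e0) [N _ /(_ N (leqnn N))] /=.
rewrite sub0r normrN mul1r ger0_norm ?exprn_ge0 // => h.
by exists N.
Qed.

End JetNorm.

Record characters (R : realType) (G : Type) (Gam : zmodType) := Characters {
  char_val :> Gam -> G -> R[i];
  char_valD : forall i j g, char_val (i + j) g = char_val i g * char_val j g;
  char_mod : forall j g, modc (char_val j g) = 1
}.

Section TrigJets.
Context (R : realType) (G : Type) (Gam : zmodType) (ev : characters R G Gam).
Variable delta : {additive Gam -> 'rV[R[i]]_3}.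
Implicit Types (S : set Gam) (F H : G -> jet R[i]).

Lemma char0 g : ev 0 g = 1.
Proof.
have e0 : ev 0 g != 0.
  by apply/eqP => e0; have := char_mod ev 0 g; rewrite e0 modc0 => /eqP; rewrite eq_sym oner_eq0.
by apply: (mulfI e0); rewrite -char_valD addr0 mulr1.
Qed.

Lemma charN j g : ev (- j) g = (ev j g)^-1.
Proof.
have e : ev j g * ev (- j) g = 1 by rewrite -char_valD subrr char0.
have e0 : ev j g != 0 by apply: contra_eq_neq e => ->; rewrite mul0r eq_sym oner_neq0.
by apply: (mulfI e0); rewrite e divff.
Qed.

Definition jconst (c : R[i]) : jet R[i] := mkjet c 0.
Definition jchar (j : Gam) (g : G) : jet R[i] := mkjet (ev j g) (ev j g *: delta j).

Lemma jcharD i j g : jchar (i + j) g = jchar i g * jchar j g.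
Proof.
apply: jetP => [|k]; first exact: char_valD.
by rewrite jderM /jder /jval /= !mxE raddfD char_valD mxE; ring.
Qed.

Lemma jchar0 g : jchar 0 g = 1.
Proof.
apply: jetP => [|k]; first exact: char0.
by rewrite /jder /= raddf0 scaler0.
Qed.

Lemma jconstM a b : jconst (a * b) = jconst a * jconst b.
Proof.
by apply: jetP => [//|k]; rewrite jderM /jder /= !mxE mul0r mulr0 addr0.
Qed.

Lemma jconst1 : jconst 1 = 1. Proof. by []. Qed.

Definition tpoly (s : seq (R[i] * Gam)) (g : G) : jet R[i] :=
  \sum_(p <- s) jconst p.1 * jchar p.2 g.

(** Values and formal derivatives are approximated simultaneously by trigonometric polynomials with
    frequencies in S. *)
Definition C1 S F : Prop := forall e : R, 0 < e ->
  exists s, (forall p, p \in s -> S p.2) /\ forall g, jnorm 1 (F g - tpoly s g) <= e.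

Lemma tpoly_cat s s' g : tpoly (s ++ s') g = tpoly s g + tpoly s' g.
Proof. exact: big_cat. Qed.

Lemma jnorm_jchar j g : jnorm 1 (jchar j g) = 1 + \sum_i modc (delta j 0 i).
Proof.
rewrite /jnorm [jval _]/= char_mod mul1r; congr (_ + _); apply: eq_bigr => i _.
by rewrite /jder /= mxE modcM char_mod mul1r.
Qed.

Lemma tpoly_bounded s : exists2 K : R, 0 <= K & forall g, jnorm 1 (tpoly s g) <= K.
Proof.
exists (\sum_(p <- s) jnorm 1 (jconst p.1) * (1 + \sum_i modc (delta p.2 0 i))).
  apply: sumr_ge0 => p _; rewrite mulr_ge0 ?jnorm_ge0 // addr_ge0 // sumr_ge0 // => i _.
  exact: modc_ge0.
move=> g; rewrite (le_trans (jnorm_sum _ _ _ _)) // ler_sum // => p _.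
by rewrite (le_trans (jnormM _ _ _)) // jnorm_jchar.
Qed.

Lemma C1_bounded S F : C1 S F -> exists2 K : R, 0 < K & forall g, jnorm 1 (F g) <= K.
Proof.
move=> /(_ 1 ltr01) [s [_ Fs]]; have [K K0 sK] := tpoly_bounded s.
exists (1 + K) => [|g]; first by rewrite ltr_pwDl.
by rewrite -[F g](subrK (tpoly s g)) (le_trans (jnormD _ _ _)) // lerD.
Qed.

Lemma C1_tpoly S s : (forall p, p \in s -> S p.2) -> C1 S (tpoly s).
Proof.
by move=> Ss e e0; exists s; split=> // g; rewrite subrr jnorm0 ltW.
Qed.

Lemma C1_sub S S' F : S `<=` S' -> C1 S F -> C1 S' F.
Proof.
move=> SS' CF e /CF[s [Ss Fs]]; exists s; split=> // p /Ss; exact: SS'.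
Qed.

Lemma C1_closed S F :
  (forall e : R, 0 < e -> exists2 H, C1 S H & forall g, jnorm 1 (F g - H g) <= e) ->
  C1 S F.
Proof.
move=> FH e e0; have e2 : 0 < e / 2 by rewrite divr_gt0.
have [H CH FHe] := FH _ e2; have [s [Ss Hs]] := CH _ e2.
exists s; split=> // g.
have -> : F g - tpoly s g = (F g - H g) + (H g - tpoly s g) by rewrite addrA subrK.
by rewrite (le_trans (jnormD _ _ _)) // [leRHS](splitr e) lerD.
Qed.

Lemma C1_jconst S c : S 0 -> C1 S (fun=> jconst c).
Proof.
move=> S0; have -> : (fun=> jconst c) = tpoly [:: (c, 0)].
  by apply/funext => g; rewrite /tpoly big_seq1 jchar0 mulr1.
by apply: C1_tpoly => p; rewrite inE => /eqP->.
Qed.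

Lemma C1_jchar S j : S j -> C1 S (jchar j).
Proof.
move=> Sj; have -> : jchar j = tpoly [:: (1, j)].
  by apply/funext => g; rewrite /tpoly big_seq1 jconst1 mul1r.
by apply: C1_tpoly => p; rewrite inE => /eqP->.
Qed.

Lemma C1D S F H : C1 S F -> C1 S H -> C1 S (fun g => F g + H g).
Proof.
move=> CF CH e e0; have e2 : 0 < e / 2 by rewrite divr_gt0.
have [s [Ss Fs]] := CF _ e2; have [s' [Ss' Hs']] := CH _ e2.
exists (s ++ s'); split=> [p|g].
  by rewrite mem_cat => /orP[/Ss|/Ss'].
rewrite tpoly_cat opprD addrACA (le_trans (jnormD _ _ _)) //.
by rewrite [leRHS](splitr e) lerD.
Qed.

(** The three sets are independent so that S = {0} covers multiplication by constants. *)
Lemma C1M S S' S'' F H : (forall a b, S a -> S' b -> S'' (a + b)) ->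
  C1 S F -> C1 S' H -> C1 S'' (fun g => F g * H g).
Proof.
move=> SS CF CH; have [K K0 FK] := C1_bounded CF.
have [L L0 HL] := C1_bounded CH.
apply: C1_closed => e e0.
(* The error splits into three products, at most K d, d L and d d; with d <= 1 their sum is at most
   (K + L + 1) d. *)
pose d := Num.min 1 (e / (K + L + 1)).
have KL : 0 < K + L + 1 by rewrite addr_gt0 // addr_gt0.
have d0 : 0 < d by rewrite lt_min ltr01 divr_gt0.
have [s [Ss Fs]] := CF _ d0; have [s' [Ss' Hs']] := CH _ d0.
exists (fun g => tpoly s g * tpoly s' g).
  have -> : (fun g => tpoly s g * tpoly s' g) =
      tpoly [seq (p.1 * q.1, p.2 + q.2) | p <- s, q <- s'].
    apply/funext => g; rewrite /tpoly big_allpairs_dep /= mulr_suml; apply: eq_bigr => p _.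
    rewrite mulr_sumr; apply: eq_bigr => q _ /=.
    by rewrite jconstM jcharD mulrACA.
  by apply: C1_tpoly => p /allpairsP[[a b] /= [/Ss sa /Ss' sb ->]]; exact: SS.
move=> g.
have -> : F g * H g - tpoly s g * tpoly s' g =
  F g * (H g - tpoly s' g) + (F g - tpoly s g) * H g -
    (F g - tpoly s g) * (H g - tpoly s' g) by ring.
rewrite (le_trans (jnormB _ _ _)) //.
apply: (@le_trans _ _ (K * d + d * L + d * 1)); last first.
  rewrite [d * L]mulrC [d * 1]mulrC -!mulrDl -ler_pdivlMl //.
  by rewrite mulrC ge_min lexx orbT.
rewrite lerD // ?(le_trans (jnormD _ _ _)) // ?lerD //.
- rewrite (le_trans (jnormM _ _ _)) // ler_pM ?jnorm_ge0 //.
- rewrite (le_trans (jnormM _ _ _)) // ler_pM ?jnorm_ge0 //.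
- rewrite (le_trans (jnormM _ _ _)) // ler_pM ?jnorm_ge0 //.
  by rewrite (le_trans (Hs' g)) // ge_min lexx.
Qed.

Definition submonoid S := S 0 /\ forall a b, S a -> S b -> S (a + b).

Lemma C1_mul S F H : submonoid S -> C1 S F -> C1 S H -> C1 S (fun g => F g * H g).
Proof. by move=> [_ SD]; exact: C1M. Qed.

Lemma C1N S F : S 0 -> C1 S F -> C1 S (fun g => - F g).
Proof.
move=> S0 CF; have -> : (fun g => - F g) = (fun g => jconst (-1) * F g).
  apply/funext => g; rewrite -[LHS]mulN1r; congr (_ * _).
  by apply: jetP => [//|k]; rewrite /jder /= !mxE oppr0.
by apply: C1M (C1_jconst _ (erefl 0 : [set 0] 0)) CF => a b ->; rewrite add0r.
Qed.

Lemma C1B S F H : S 0 -> C1 S F -> C1 S H -> C1 S (fun g => F g - H g).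
Proof. by move=> S0 CF CH; apply: C1D => //; exact: C1N. Qed.

Lemma C1_sum S (I : Type) (r : seq I) (A : I -> G -> jet R[i]) :
  (forall i, C1 S (A i)) -> C1 S (fun g => \sum_(i <- r) A i g).
Proof.
move=> CA; elim: r => [|i r IH].
  have -> : (fun g => \sum_(i <- [::]) A i g) = tpoly [::].
    by apply/funext => g; rewrite /tpoly !big_nil.
  exact: C1_tpoly.
have -> : (fun g => \sum_(i <- i :: r) A i g) = fun g => A i g + \sum_(i <- r) A i g.
  by apply/funext => g; rewrite big_cons.
exact: C1D.
Qed.

Lemma C1X S F n : submonoid S -> C1 S F -> C1 S (fun g => F g ^+ n).
Proof.
move=> mS CF; elim: n => [|n IH]; first by apply: C1_jconst; case: mS.
have -> : (fun g => F g ^+ n.+1) = fun g => F g * F g ^+ n.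
  by apply/funext => g; rewrite exprS.
exact: C1_mul.
Qed.

Lemma jet_inv_geometric (x : jet R[i]) (N : nat) : x \is a GRing.unit ->
  x^-1 - \sum_(k < N) (1 - x) ^+ k = (1 - x) ^+ N * x^-1.
Proof.
move=> ux; apply: (mulrI ux); rewrite mulrBr divrr // mulrCA divrr // mulr1.
by rewrite -[x in x * _](subKr 1) -[1 - (1 - x)]opprB mulNr -subrX1 opprK addrC subrK.
Qed.

(* With a weight t so small that the jet norm of 1 - F is uniformly less than
   1, the geometric series converges together with its derivatives. *)
Lemma C1_inv S F (q : R) : submonoid S -> C1 S F -> q < 1 ->
  (forall g, modc (jval (F g) - 1) <= q) ->
  (forall g, F g \is a GRing.unit) /\ C1 S (fun g => (F g)^-1).
Proof.
move=> mS CF q1 Fq.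
have uF g : F g \is a GRing.unit.
  rewrite jet_unitE; apply/eqP => F0; have := Fq g.
  by rewrite F0 sub0r modcN modc1 leNgt q1.
split=> //.
have S0 := mS.1.
pose y g := 1 - F g.
have Cy : C1 S y by apply: C1B => //; exact: C1_jconst.
have [K K0 yK] := C1_bounded Cy.
(* [q] can be negative when G is empty, hence the maximum with 0. *)
have yq g : modc (jval (y g)) <= Num.max q 0.
  by rewrite raddfB /= -modcN opprB le_max Fq.
set q' := Num.max q 0 in yq.
have q'0 : 0 <= q' by rewrite le_max lexx orbT.
have q'1 : q' < 1 by rewrite gt_max q1 ltr01.
(* Then t K <= (1 - q') / 2, so the t-norm of 1 - F is at most r, the midpoint of q' and 1. *)
pose t := Num.min 1 ((1 - q') / (2 * K)).
have t0 : 0 < t by rewrite lt_min ltr01 divr_gt0 ?subr_gt0 ?mulr_gt0.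
have t1 : t <= 1 by rewrite ge_min lexx.
pose r := (1 + q') / 2.
have r01 : 0 <= r < 1.
  apply/andP; split; rewrite /r; first by rewrite divr_ge0 // addr_ge0.
  by rewrite ltr_pdivrMr // mul1r -[2]/(1 + 1) ltrD2l.
have yr g : jnorm t (y g) <= r.
  have tK : t * K <= (1 - q') / 2.
    rewrite -ler_pdivlMr // -mulrA -invfM.
    by rewrite ge_min lexx orbT.
  have dK : \sum_i modc (jder i (y g)) <= K.
    rewrite (le_trans _ (yK g)) // /jnorm mul1r lerDr; exact: modc_ge0.
  have h := ler_wpM2l (ltW t0) dK.
  have -> : r = q' + (1 - q') / 2 by rewrite /r; lra.
  by rewrite /jnorm lerD // (le_trans h).
have /andP[r0 r1] := r01.
have invr g : jnorm t (F g)^-1 <= (1 - r)^-1.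
  rewrite -[leRHS]mul1r ler_pdivlMr ?subr_gt0 // mulrBr mulr1 lerBlDr.
  have {1}-> : (F g)^-1 = 1 + y g * (F g)^-1.
    by rewrite mulrBl mul1r divrr // addrC subrK.
  rewrite (le_trans (jnormD _ _ (ltW t0))) // jnorm1 lerD2l.
  rewrite (le_trans (jnormM _ _ (ltW t0))) // mulrC ler_wpM2l //.
  by rewrite jnorm_ge0 // ltW.
apply: C1_closed => e e0.
have e'0 : 0 < e * t * (1 - r) by rewrite !mulr_gt0 // subr_gt0.
have [N rN] := exp_small r01 e'0.
exists (fun g => \sum_(k < N) y g ^+ k).
  by apply: C1_sum => k; exact: C1X.
move=> g; rewrite jet_inv_geometric // -/(y g).
rewrite (le_trans (@jnorm_rescale _ t _ _)) ?t0 //.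
rewrite ler_pdivrMl // (le_trans (jnormM _ _ (ltW t0))) //.
apply: (@le_trans _ _ (r ^+ N * (1 - r)^-1)).
  rewrite ler_pM ?jnorm_ge0 ?(ltW t0) //.
  rewrite (le_trans (jnormX _ _ (ltW t0))) // lerXn2r ?nnegrE //.
  by rewrite jnorm_ge0 // ltW.
by rewrite ler_pdivrMr ?subr_gt0 // [t * e]mulrC.
Qed.

End TrigJets.

(** * Means on the uniform closure *)

Section Continuity.
Context (R : realType) (G : topologicalType).
Implicit Types f h : G -> R[i].

Lemma ccontD f h : ccontinuous f -> ccontinuous h -> ccontinuous (fun g => f g + h g).
Proof. by move=> cf ch x; apply: (@cvgD _ R[i]^o); [exact: cf|exact: ch]. Qed.

Lemma ccontM f h : ccontinuous f -> ccontinuous h -> ccontinuous (fun g => f g * h g).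
Proof. by move=> cf ch x; apply: (@cvgM R[i]); [exact: cf|exact: ch]. Qed.

Lemma ccont_cst (c : R[i]) : ccontinuous (fun _ : G => c).
Proof. by move=> x; exact: cvg_cst. Qed.

Lemma ccontN f : ccontinuous f -> ccontinuous (fun g => - f g).
Proof. by move=> cf x; apply: (@cvgN _ R[i]^o); exact: cf. Qed.

Lemma ccontB f h : ccontinuous f -> ccontinuous h -> ccontinuous (fun g => f g - h g).
Proof. by move=> cf ch; exact: (ccontD cf (ccontN ch)). Qed.

Lemma ccont_sum (I : Type) (r : seq I) (A : I -> G -> R[i]) :
  (forall i, ccontinuous (A i)) -> ccontinuous (fun g => \sum_(i <- r) A i g).
Proof.
move=> cA; elim: r => [|i r IH].
  rewrite (_ : (fun g => _) = fun=> 0); first exact: ccont_cst.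
  by apply/funext => g; rewrite big_nil.
rewrite (_ : (fun g => _) = fun g => A i g + \sum_(i <- r) A i g); first exact: (ccontD (cA i) IH).
by apply/funext => g; rewrite big_cons.
Qed.

Lemma ltcR_Re (e : R[i]) : 0 < e -> exists2 r : R, 0 < r & e = r%:C%C.
Proof.
rewrite ltcE /= => /andP[/eqP e0 e1]; exists (complex.Re e) => //.
by case: e e0 {e1} => a b /= ->.
Qed.

Lemma ccont_unif f :
  (forall e : R, 0 < e -> exists2 h, ccontinuous h & forall g, modc (f g - h g) <= e) ->
  ccontinuous f.
Proof.
move=> fh x; apply/(@cvgrPdist_le _ R[i]^o) => _ /ltcR_Re[e e0 ->].
have e3 : 0 < e / 3 by rewrite divr_gt0.
have [h ch fhe] := fh _ e3.
have /(@cvgrPdist_le _ R[i]^o) /(_ (e / 3)%:C%C) := ch x.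
rewrite ltcR => /(_ e3); apply: filterS => y hxy.
have hxy' : modc (h x - h y) <= e / 3 by rewrite -lecR -modcE.
rewrite [`|_|]modcE lecR.
have -> : f x - f y = (f x - h x) + (h x - h y) - (f y - h y) by ring.
have -> : e = e / 3 + e / 3 + e / 3 by field.
by rewrite (le_trans (modcB _ _)) // lerD // (le_trans (modcD _ _)) // lerD.
Qed.

End Continuity.

(** The properties of the Haar integral from which the degree is built. The factor 2 in
    [mean_weight] is the price of bounding the real and imaginary parts separately. *)
Record mean (R : realType) (G : topologicalType) (Gam : zmodType)
    (ev : characters R G Gam) := Mean {
  mean_val :> (G -> R[i]) -> R[i];
  mean_char_cont : forall j, ccontinuous (ev j);
  meanD : forall f h, ccontinuous f -> ccontinuous h ->
    mean_val (fun g => f g + h g) = mean_val f + mean_val h;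
  meanZ : forall c f, ccontinuous f -> mean_val (fun g => c * f g) = c * mean_val f;
  mean_weight : forall f k (e : R), ccontinuous f -> ccontinuous k ->
    (forall g, 0 <= k g) -> (forall g, modc (f g) <= e) ->
    modc (mean_val (fun g => f g * k g)) <= 2 * e * complex.Re (mean_val k);
  mean_char : forall j, mean_val (ev j) = (j == 0)%:R
}.

Section Mean.
Context (R : realType) (G : topologicalType) (Gam : zmodType)
  (ev : characters R G Gam) (I : mean ev).
Implicit Types (S : set Gam) (d : {additive Gam -> 'rV[R[i]]_3}).
Implicit Types (f h : G -> R[i]) (F : G -> jet R[i]).

Lemma ccont_tpoly d s i :
  ccontinuous (fun g => jval (tpoly ev d s g)) /\
  ccontinuous (fun g => jder i (tpoly ev d s g)).
Proof.
split.
  rewrite (_ : (fun g => _) = fun g => \sum_(p <- s) p.1 * ev p.2 g).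
    apply: ccont_sum => p; exact: (ccontM (@ccont_cst R G p.1) (@mean_char_cont _ _ _ _ I p.2)).
  by apply/funext => g; rewrite raddf_sum.
rewrite (_ : (fun g => _) = fun g => \sum_(p <- s) (p.1 * d p.2 0 i) * ev p.2 g).
  apply: ccont_sum => p.
  exact: (ccontM (@ccont_cst R G (p.1 * d p.2 0 i)) (@mean_char_cont _ _ _ _ I p.2)).
apply/funext => g; rewrite raddf_sum; apply: eq_bigr => p _.
rewrite /= jderM /jder /jval /= !mxE mul0r add0r; ring.
Qed.

Lemma C1_ccont_jval d S F : C1 ev d S F -> ccontinuous (fun g => jval (F g)).
Proof.
move=> CF; apply: ccont_unif => e /CF[s [_ Fs]].
exists (fun g => jval (tpoly ev d s g)); first exact: (ccont_tpoly d s 0).1.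
by move=> g; rewrite -raddfB (le_trans (modc_jval_le _ ler01)) // Fs.
Qed.

Lemma C1_ccont_jder d S F i : C1 ev d S F -> ccontinuous (fun g => jder i (F g)).
Proof.
move=> CF; apply: ccont_unif => e /CF[s [_ Fs]].
exists (fun g => jder i (tpoly ev d s g)); first exact: (ccont_tpoly d s i).2.
by move=> g; rewrite -raddfB (le_trans (modc_jder_le i _)) // Fs.
Qed.

Lemma mean_le f (e : R) : ccontinuous f -> (forall g, modc (f g) <= e) ->
  modc (I f) <= 2 * e.
Proof.
move=> cf fe.
have c1 : ccontinuous (fun _ : G => (1 : R[i])) by exact: ccont_cst.
have := mean_weight I cf c1 (fun=> ler01) fe.
have -> : (fun g => f g * 1) = f by apply/funext => g; rewrite mulr1.
have <- : ev 0 = fun=> 1 by apply/funext => g; rewrite char0.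
by rewrite mean_char eqxx mulr1.
Qed.

Lemma mean0 : I (fun=> 0) = 0.
Proof.
have c0 : ccontinuous (fun _ : G => (0 : R[i])) by exact: ccont_cst.
by have := meanZ I 0 c0; rewrite !mul0r.
Qed.

Lemma mean_sum (J : Type) (r : seq J) (A : J -> G -> R[i]) :
  (forall i, ccontinuous (A i)) ->
  I (fun g => \sum_(i <- r) A i g) = \sum_(i <- r) I (A i).
Proof.
move=> cA; elim: r => [|i r IH].
  by rewrite big_nil -[RHS]mean0; congr (I _); apply/funext => g; rewrite big_nil.
rewrite big_cons -IH -meanD //; last exact: ccont_sum.
by congr (I _); apply/funext => g; rewrite big_cons.
Qed.

Lemma meanB f h : ccontinuous f -> ccontinuous h ->
  I (fun g => f g - h g) = I f - I h.
Proof.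
move=> cf ch; rewrite -[- I h]mulN1r -meanZ // -meanD //.
  by congr (I _); apply/funext => g; rewrite mulN1r.
exact: (ccontM (@ccont_cst R G (-1)) ch).
Qed.

(** Additivity reduces the claim for trigonometric polynomials to monomials, and boundedness extends
    it to the closure. The coefficient stays inside the monomial, which takes the place of
    homogeneity of L. *)
Lemma C1_functional_eq0 d S (L : (G -> jet R[i]) -> R[i]) (K : R) :
  (forall F H, C1 ev d S F -> C1 ev d S H -> L (fun g => F g + H g) = L F + L H) ->
  (forall F e, C1 ev d S F -> (forall g, jnorm 1 (F g) <= e) -> modc (L F) <= K * e) ->
  (forall c j, S j -> L (fun g => jconst c * jchar ev d j g) = 0) ->
  forall F, C1 ev d S F -> L F = 0.
Proof.
move=> LD LK Lmono F CF.
have L0 : L (fun=> 0) = 0.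
  have C0 : C1 ev d S (fun=> 0).
    rewrite (_ : (fun=> 0) = tpoly ev d [::]); first exact: C1_tpoly.
    by apply/funext => g; rewrite /tpoly big_nil.
  have := LD _ _ C0 C0; rewrite (_ : (fun g => 0 + 0) = fun=> 0).
    by move/eqP; rewrite -subr_eq0 opprD addrA subrr sub0r oppr_eq0 => /eqP.
  by apply/funext => g; rewrite addr0.
have Ltp s : (forall p, p \in s -> S p.2) -> L (tpoly ev d s) = 0.
  elim: s => [_|p s IH Ss].
    by rewrite (_ : tpoly _ _ _ = fun=> 0) //; apply/funext => g; rewrite /tpoly big_nil.
  have -> : tpoly ev d (p :: s) = fun g => jconst p.1 * jchar ev d p.2 g + tpoly ev d s g.
    by apply/funext => g; rewrite /tpoly big_cons.
  have Ss' q : q \in s -> S q.2 by move=> qs; apply: Ss; rewrite inE qs orbT.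
  have Sp : S p.2 by apply: Ss; rewrite inE eqxx.
  rewrite LD ?Lmono ?IH ?addr0 //; last exact: C1_tpoly.
  rewrite (_ : (fun g => _) = tpoly ev d [:: p]).
    by apply: C1_tpoly => q; rewrite inE => /eqP->.
  by apply/funext => g; rewrite /tpoly big_seq1.
have small (e : R) : 0 < e -> modc (L F) <= K * e.
  move=> /CF[s [Ss Fs]].
  have Cs : C1 ev d S (fun g => - tpoly ev d s g).
    rewrite (_ : (fun g => _) = tpoly ev d [seq (- p.1, p.2) | p <- s]).
      by apply: C1_tpoly => p /mapP[q /Ss Sq ->].
    apply/funext => g; rewrite /tpoly big_map -sumrN; apply: eq_bigr => p _ /=.
    by apply: jetP => [|k]; rewrite ?raddfN /= ?jvalM ?jderM /jder /jval /= ?mulNr // !mxE; ring.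
  have -> : L F = L (fun g => F g - tpoly ev d s g).
    rewrite LD // -[LHS]addr0; congr (_ + _); apply/esym.
    have := LD _ _ (C1_tpoly ev d Ss) Cs.
    rewrite (_ : (fun g => tpoly ev d s g - tpoly ev d s g) = fun=> 0); last first.
      by apply/funext => g; rewrite subrr.
    by rewrite L0 Ltp // add0r.
  by apply: LK => //; exact: C1D.
apply: modc_eq0; apply/eqP; rewrite eq_le modc_ge0 andbT leNgt; apply/negP => LF0.
have K0 : 0 < K by have := lt_le_trans LF0 (small 1 ltr01); rewrite mulr1.
(* This choice turns the bound into |L F| <= |L F| / 2. *)
have e0 : 0 < modc (L F) / (2 * K) by rewrite divr_gt0 ?mulr_gt0.
have := small _ e0.
have -> : K * (modc (L F) / (2 * K)) = modc (L F) / 2 by field; rewrite gt_eqF.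
by lra.
Qed.

End Mean.
Arguments mean_char_cont {R G Gam ev} m j [x t] _ : rename.
Arguments C1_ccont_jder {R G Gam ev} I [d S F] i _ [x t] _.

(** * Integration by parts and the degree of differentiable matrix functions *)

Section Degree.
Context (R : realType) (G : topologicalType) (Gam : zmodType)
  (ev : characters R G Gam) (I : mean ev).
Implicit Types (S : set Gam) (d : {additive Gam -> 'rV[R[i]]_3}).
Implicit Types (f h : G -> R[i]) (u v w F : G -> jet R[i]).

(** With zero weights all formal derivatives vanish and [C1] is plain uniform approximation; values
    and derivatives of jets can then be handled as functions with a spectrum of their own. *)
Definition zero_weight : {additive Gam -> 'rV[R[i]]_3} := \0.

Lemma jnorm_jconst t (c : R[i]) : jnorm t (jconst c) = modc c.
Proof.
rewrite /jnorm big1 ?mulr0 ?addr0 // => i _.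
by rewrite /jder mxE modc0.
Qed.

Lemma jconstD (a b : R[i]) : jconst (a + b) = jconst a + jconst b.
Proof. by apply: jetP => [//|k]; rewrite /jder /= !mxE ?addr0. Qed.

Lemma jconstB (a b : R[i]) : jconst (a - b) = jconst a - jconst b.
Proof. by apply: jetP => [//|k]; rewrite /jder /= !mxE ?subr0. Qed.

Lemma jconst_sum (T : Type) (r : seq T) (a : T -> R[i]) :
  jconst (\sum_(p <- r) a p) = \sum_(p <- r) jconst (a p).
Proof.
apply: (big_morph (fun c => jconst c : jet R[i]) jconstD).
by [].
Qed.

Lemma C1_zero_jval d S F : C1 ev d S F ->
  C1 ev zero_weight S (fun g => jconst (jval (F g))).
Proof.
move=> CF e /CF[s [Ss Fs]]; exists s; split=> [|g]; first exact: Ss.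
have -> : tpoly ev zero_weight s g = jconst (jval (tpoly ev d s g)).
  rewrite /tpoly (raddf_sum jval) /= jconst_sum; apply: eq_bigr => p _.
  apply: jetP => [//|k]; rewrite jderM /jder /= !mxE; ring.
by rewrite -jconstB jnorm_jconst -(raddfB jval) (le_trans (modc_jval_le _ ler01)).
Qed.

Lemma C1_zero_jder d S F i : C1 ev d S F ->
  C1 ev zero_weight S (fun g => jconst (jder i (F g))).
Proof.
move=> CF e /CF[s [Ss Fs]]; exists [seq (p.1 * d p.2 0 i, p.2) | p <- s]; split.
  by move=> p /mapP[q /Ss ? ->].
move=> g; have -> : tpoly ev zero_weight [seq (p.1 * d p.2 0 i, p.2) | p <- s] g =
    jconst (jder i (tpoly ev d s g)).
  rewrite /tpoly (raddf_sum (jder i)) /= jconst_sum big_map; apply: eq_bigr => p _ /=.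
  apply: jetP => [|k]; rewrite ?jvalM ?jderM /jder /jval /= !mxE; ring.
by rewrite -jconstB jnorm_jconst -(raddfB (jder i)) (le_trans (modc_jder_le i _)).
Qed.

Lemma mean_jval_char d S F j : C1 ev d S F -> ~ S (- j) ->
  I (fun g => jval (F g) * ev j g) = 0.
Proof.
move=> CF Sj; pose L F' := I (fun g => jval (F' g) * ev j g).
have cj : ccontinuous (ev j) := @mean_char_cont _ _ _ _ I j.
rewrite -[LHS]/(L F); apply: (@C1_functional_eq0 _ _ _ ev d S L 2 _ _ _ F CF) =>
    [F1 F2 C1F C2F|F1 e C1F Fe|c k Sk].
- rewrite /L -meanD; first by congr (I _); apply/funext => g; rewrite raddfD mulrDl.
  + exact: (ccontM (C1_ccont_jval I C1F) cj).
  + exact: (ccontM (C1_ccont_jval I C2F) cj).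
- apply: mean_le; first exact: (ccontM (C1_ccont_jval I C1F) cj).
  by move=> g; rewrite modcM char_mod mulr1 (le_trans (modc_jval_le _ ler01)).
- rewrite /L (_ : (fun g => _) = fun g => c * ev (k + j) g); last first.
    by apply/funext => g; rewrite char_valD mulrA.
  rewrite meanZ; last exact: mean_char_cont I _.
  rewrite mean_char; case: eqP => [/eqP|]; rewrite ?mulr0 //.
  by rewrite addr_eq0 => /eqP kj; move: Sj; rewrite -kj.
Qed.

(** For the monomial c <k, .> in place of F, the mean is c (d k)_i times the coefficient of u at -k.
    Either -k lies outside S and this coefficient is 0, or d k = 0. The uses are S = {0}, where
    derivatives have mean 0, and cones. *)
Lemma mean_mul_jder d S S' u F i : C1 ev zero_weight S u -> C1 ev d S' F ->
  (forall a b, S a -> S' b -> a + b = 0 -> d b = 0) ->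
  I (fun g => jval (u g) * jder i (F g)) = 0.
Proof.
move=> Cu CF SS; pose L F' := I (fun g => jval (u g) * jder i (F' g)).
have [K K0 uK] := C1_bounded Cu.
rewrite -[LHS]/(L F); apply: (@C1_functional_eq0 _ _ _ ev d S' L (2 * K) _ _ _ F CF) =>
    [F1 F2 C1F C2F|F1 e C1F Fe|c k Sk].
- rewrite /L -meanD; first by congr (I _); apply/funext => g; rewrite raddfD mulrDr.
  + exact: (ccontM (C1_ccont_jval I Cu) (C1_ccont_jder I i C1F)).
  + exact: (ccontM (C1_ccont_jval I Cu) (C1_ccont_jder I i C2F)).
- rewrite -mulrA; apply: mean_le.
    exact: (ccontM (C1_ccont_jval I Cu) (C1_ccont_jder I i C1F)).
  move=> g; rewrite modcM ler_pM ?modc_ge0 //.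
    by rewrite (le_trans (modc_jval_le _ ler01)).
  by rewrite (le_trans (modc_jder_le i _)).
- rewrite /L (_ : (fun g => _) = fun g => (c * d k 0 i) * (jval (u g) * ev k g)); last first.
    by apply/funext => g; rewrite jderM /jder /jval /= !mxE; ring.
  rewrite meanZ; last exact: (ccontM (C1_ccont_jval I Cu) (@mean_char_cont _ _ _ _ I k)).
  have [dk|dk] := eqVneq (d k) 0; first by rewrite dk mxE mulr0 mul0r.
  rewrite (mean_jval_char Cu) ?mulr0 // => Sk'.
  by move/eqP: dk; apply; apply: (SS (- k)); rewrite // addNr.
Qed.

Lemma mean_jder d F i : C1 ev d setT F -> I (fun g => jder i (F g)) = 0.
Proof.
move=> CF; have C1 : C1 ev zero_weight [set 0] (fun=> jconst 1) by exact: C1_jconst.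
have := mean_mul_jder i C1 CF.
rewrite (_ : (fun g => _) = fun g => jder i (F g)); last first.
  by apply/funext => g; rewrite mul1r.
by apply => a b -> _; rewrite add0r => ->; rewrite raddf0.
Qed.

Lemma jacobian_jder (x y z : jet R[i]) (a b c : 'I_3 -> R[i]) :
  (forall k, jder k x = a k) -> (forall k, jder k y = b k) ->
  (forall k, jder k z = c k) ->
  jacobian x y z =
  a (ord3 0) * (b (ord3 1) * c (ord3 2) - b (ord3 2) * c (ord3 1)) +
  a (ord3 1) * (b (ord3 2) * c (ord3 0) - b (ord3 0) * c (ord3 2)) +
  a (ord3 2) * (b (ord3 0) * c (ord3 1) - b (ord3 1) * c (ord3 0)).
Proof. by move=> xa yb zc; rewrite /jacobian !xa !yb !zc. Qed.

Lemma jacobianDl (x x' y z : jet R[i]) :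
  jacobian (x + x') y z = jacobian x y z + jacobian x' y z.
Proof. by rewrite /jacobian !raddfD /=; ring. Qed.

Lemma jacobian_cycle (x y z : jet R[i]) : jacobian x y z = jacobian y z x.
Proof. by rewrite /jacobian; ring. Qed.

Lemma modc_jacobian (x y z : jet R[i]) (a b c : R) :
  jnorm 1 x <= a -> jnorm 1 y <= b -> jnorm 1 z <= c ->
  modc (jacobian x y z) <= 6 * (a * b * c).
Proof.
move=> xa yb zc.
have da k : modc (jder k x) <= a by rewrite (le_trans (modc_jder_le k _)).
have db k : modc (jder k y) <= b by rewrite (le_trans (modc_jder_le k _)).
have dc k : modc (jder k z) <= c by rewrite (le_trans (modc_jder_le k _)).
have t k l m : modc (jder k x * (jder l y * jder m z)) <= a * b * c.
  by rewrite !modcM -mulrA !ler_pM ?mulr_ge0 ?modc_ge0.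
have tt k l m l' m' : modc (jder k x * (jder l y * jder m z - jder l' y * jder m' z))
    <= 2 * (a * b * c).
  by rewrite mulrBr mulr_natl mulr2n (le_trans (modcB _ _)) // lerD.
have -> : 6 * (a * b * c) = 2 * (a * b * c) + 2 * (a * b * c) + 2 * (a * b * c) by ring.
by rewrite (le_trans (modcD _ _)) // lerD // (le_trans (modcD _ _)) // lerD.
Qed.

Lemma C1_ccont_jacobian d S u v w : C1 ev d S u -> C1 ev d S v -> C1 ev d S w ->
  ccontinuous (fun g => jacobian (u g) (v g) (w g)).
Proof.
move=> Cu Cv Cw.
have t i j k := ccontM (C1_ccont_jder I i Cu)
  (ccontB (ccontM (C1_ccont_jder I j Cv) (C1_ccont_jder I k Cw))
          (ccontM (C1_ccont_jder I k Cv) (C1_ccont_jder I j Cw))).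
exact: (ccontD (ccontD (t (ord3 0) (ord3 1) (ord3 2)) (t (ord3 1) (ord3 2) (ord3 0)))
  (t (ord3 2) (ord3 0) (ord3 1))).
Qed.

(** One argument at a time is reduced to a monomial; the cyclic symmetry of the Jacobian brings each
    argument to the first place in turn. *)
Lemma mean_jacobian_step d v w : C1 ev d setT v -> C1 ev d setT w ->
  (forall c j, I (fun g => jacobian (jconst c * jchar ev d j g) (v g) (w g)) = 0) ->
  forall u, C1 ev d setT u -> I (fun g => jacobian (u g) (v g) (w g)) = 0.
Proof.
move=> Cv Cw vw u Cu; pose L F' := I (fun g => jacobian (F' g) (v g) (w g)).
have [a a0 va] := C1_bounded Cv; have [b b0 wb] := C1_bounded Cw.
rewrite -[LHS]/(L u).
apply: (@C1_functional_eq0 _ _ _ ev d setT L (2 * (6 * (a * b))) _ _ _ u Cu)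
  => [F1 F2 C1F C2F|F1 e C1F Fe|c k _]; last exact: vw.
- rewrite /L -meanD; first by congr (I _); apply/funext => g; rewrite jacobianDl.
  + exact: (C1_ccont_jacobian C1F Cv Cw).
  + exact: (C1_ccont_jacobian C2F Cv Cw).
- rewrite -mulrA; apply: mean_le; first exact: (C1_ccont_jacobian C1F Cv Cw).
  move=> g; have := modc_jacobian (Fe g) (va g) (wb g).
  by rewrite -!mulrA [e * _]mulrC !mulrA.
Qed.

Lemma C1_mono d c j : C1 ev d setT (fun g => jconst c * jchar ev d j g).
Proof.
rewrite (_ : (fun g => _) = tpoly ev d [:: (c, j)]); first exact: C1_tpoly.
by apply/funext => g; rewrite /tpoly big_seq1.
Qed.

Lemma jder_mono d c j k g :
  jder k (jconst c * jchar ev d j g) = c * d j 0 k * ev j g.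
Proof. by rewrite jderM /jder /jval /= !mxE; ring. Qed.

(** The Jacobian of three characters is the determinant of their weights times the character of
    their sum. If the sum is 0 the weights are linearly dependent and the determinant vanishes;
    otherwise the mean of the character does. *)
Lemma mean_jacobian d u v w : C1 ev d setT u -> C1 ev d setT v -> C1 ev d setT w ->
  I (fun g => jacobian (u g) (v g) (w g)) = 0.
Proof.
move=> Cu Cv Cw; apply: mean_jacobian_step Cu => // c j.
rewrite (_ : (fun g => _) = fun g => jacobian (v g) (w g) (jconst c * jchar ev d j g));
  last by apply/funext => g; rewrite jacobian_cycle.
have Cj := C1_mono d c j.
apply: (mean_jacobian_step Cw Cj) Cv => c' j'.
rewrite (_ : (fun g => _) = fun g =>
  jacobian (w g) (jconst c * jchar ev d j g) (jconst c' * jchar ev d j' g));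
  last by apply/funext => g; rewrite jacobian_cycle.
have Cj' := C1_mono d c' j'.
apply: (mean_jacobian_step Cj Cj') Cw => c'' j''.
pose D (a b e : Gam) : R[i] :=
  d a 0 (ord3 0) * (d b 0 (ord3 1) * d e 0 (ord3 2) - d b 0 (ord3 2) * d e 0 (ord3 1)) +
  d a 0 (ord3 1) * (d b 0 (ord3 2) * d e 0 (ord3 0) - d b 0 (ord3 0) * d e 0 (ord3 2)) +
  d a 0 (ord3 2) * (d b 0 (ord3 0) * d e 0 (ord3 1) - d b 0 (ord3 1) * d e 0 (ord3 0)).
rewrite (_ : (fun g => _) = fun g => (c'' * c * c' * D j'' j j') * ev (j'' + j + j') g).
  rewrite meanZ ?mean_char; last exact: mean_char_cont I _.
  case: eqP => [e|_]; last by rewrite mulr0.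
  suff -> : D j'' j j' = 0 by rewrite mulr0 mul0r.
  have dj k : d j'' 0 k = - d j 0 k - d j' 0 k.
    have -> : j'' = - j - j' by apply/eqP; rewrite -subr_eq0 opprD !opprK addrA e.
    by rewrite raddfB raddfN !mxE.
  by rewrite /D !dj; ring.
apply/funext => g; rewrite (jacobian_jder (fun k => jder_mono d c'' j'' k g)
  (fun k => jder_mono d c j k g) (fun k => jder_mono d c' j' k g)) 2!char_valD /D.
move: (ev j'' g) (ev j g) (ev j' g) => x y z; by ring.
Qed.

Definition C1mx d S m n (A : G -> 'M[jet R[i]]_(m, n)) :=
  forall i j, C1 ev d S (fun g => A g i j).

Lemma C1mxM d S m n p (A : G -> 'M[jet R[i]]_(m, n)) (B : G -> 'M[jet R[i]]_(n, p)) :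
  submonoid S -> C1mx d S A -> C1mx d S B -> C1mx d S (fun g => A g *m B g).
Proof.
move=> mS CA CB i j.
rewrite (_ : (fun g => _) = fun g => \sum_k A g i k * B g k j).
  by apply: C1_sum => k; exact: (C1_mul mS (CA i k) (CB k j)).
by apply/funext => g; rewrite mxE.
Qed.

Section Matrices.
Variable n : nat.
Implicit Types A B : G -> 'M[jet R[i]]_n.

Definition C1GL d S A :=
  C1mx d S A /\ exists2 B, C1mx d S B & forall g, A g *m B g = 1%:M.

Lemma C1GL_inv d S A : C1GL d S A ->
  (forall g, A g \in unitmx) /\ C1mx d S (fun g => invmx (A g)).
Proof.
move=> [_ [B CB AB]]; split=> [g|].
  have h := mulmx1_unit (AB g); exact: (proj1 h).
rewrite (_ : (fun g => _) = B); first exact: CB.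
by apply/funext => g; rewrite -(mulmx1_invmx (AB g)).
Qed.

Lemma C1GLM d S A B : submonoid S -> C1GL d S A -> C1GL d S B ->
  C1GL d S (fun g => A g *m B g).
Proof.
move=> mS [CA [A' CA' AA']] [CB [B' CB' BB']]; split; first exact: C1mxM.
exists (fun g => B' g *m A' g); first exact: C1mxM.
by move=> g; rewrite mulmxA -[_ *m B g *m _]mulmxA BB' mulmx1 AA'.
Qed.

Lemma ccont_mulmx (X Y : G -> 'M[R[i]]_n) :
  (forall i j, ccontinuous (fun g => X g i j)) ->
  (forall i j, ccontinuous (fun g => Y g i j)) ->
  forall i j, ccontinuous (fun g => (X g *m Y g) i j).
Proof.
move=> cX cY i j; rewrite (_ : (fun g => _) = fun g => \sum_k X g i k * Y g k j).
  by apply: ccont_sum => k; exact: (ccontM (cX i k) (cY k j)).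
by apply/funext => g; rewrite mxE.
Qed.

Lemma ccont_omega d S A : C1GL d S A -> ccontinuous (fun g => omega (A g)).
Proof.
move=> GA; have [uA CV] := C1GL_inv GA.
have cl k i j : ccontinuous (fun g => logder k (A g) i j).
  apply: ccont_mulmx => {}i {}j.
    rewrite (_ : (fun g => _) = fun g => jval (invmx (A g) i j)).
      exact: (C1_ccont_jval I (CV i j)).
    by apply/funext => g; rewrite -mval_inv // mxE.
  rewrite (_ : (fun g => _) = fun g => jder k (A g i j)).
    exact: (C1_ccont_jder I k (GA.1 i j)).
  by apply/funext => g; rewrite mxE.
apply: ccont_sum => i; apply: ccont_mulmx => {}i j; first exact: cl.
pose l k (g : G) := logder (ord3 k) (A g).
rewrite (_ : (fun g => _) = fun g =>
  (l 1%N g *m l 2%N g) i j - (l 2%N g *m l 1%N g) i j).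
  by apply: ccontB; apply: ccont_mulmx => *; exact: cl.
by apply/funext => g; rewrite [LHS]mxE [X in _ + X]mxE.
Qed.

Definition degree A : R[i] := I (fun g => omega (A g)).

Lemma degreeM d A B : C1GL d setT A -> C1GL d setT B ->
  degree (fun g => A g *m B g) = degree A + degree B.
Proof.
move=> GA GB; have [uA CVA] := C1GL_inv GA; have [uB CVB] := C1GL_inv GB.
have mT : submonoid (@setT Gam) by [].
pose X a b c e (g : G) := jacobian (invmx (A g) a b * invmx (B g) e a) (A g b c) (B g c e).
have cX a b c e : ccontinuous (X a b c e).
  exact: (C1_ccont_jacobian (C1_mul mT (CVA a b) (CVB e a)) (GA.1 b c) (GB.1 c e)).
have IX a b c e : I (X a b c e) = 0.
  exact: (mean_jacobian (C1_mul mT (CVA a b) (CVB e a)) (GA.1 b c) (GB.1 c e)).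
have cc : ccontinuous (fun g => cross_jacobian (A g) (B g)).
  apply: ccont_sum => a; apply: ccont_sum => b; apply: ccont_sum => c.
  by apply: ccont_sum => e; exact: cX.
have Ic : I (fun g => cross_jacobian (A g) (B g)) = 0.
  rewrite mean_sum => [|a].
    apply: big1 => a _; rewrite mean_sum => [|b].
      apply: big1 => b _; rewrite mean_sum => [|c].
        apply: big1 => c _; rewrite mean_sum => [|e]; last exact: cX.
        by apply: big1 => e _; exact: IX.
      by apply: ccont_sum => e; exact: cX.
    by apply: ccont_sum => c; apply: ccont_sum => e; exact: cX.
  by apply: ccont_sum => b; apply: ccont_sum => c; apply: ccont_sum => e; exact: cX.
have cA := ccont_omega GA; have cB := ccont_omega GB.
rewrite /degree -(meanD I cA cB) -[RHS]subr0 -Ic -(meanB I (ccontD cA cB) cc).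
by congr (mean_val I _); apply/funext => g; exact: omegaM.
Qed.

End Matrices.
End Degree.

(** * Triangular jets and jets near the identity *)

Section TrigMatrices.
Variable F : fieldType.

Lemma mulmx_trig n (A B : 'M[F]_n) : is_trig_mx A -> is_trig_mx B ->
  is_trig_mx (A *m B) /\ forall i, (A *m B) i i = A i i * B i i.
Proof.
move=> /is_trig_mxP tA /is_trig_mxP tB; split=> [|i].
  apply/is_trig_mxP => i j ij; rewrite mxE big1 // => k _.
  have [ik|ki] := ltnP i k; first by rewrite tA // mul0r.
  by rewrite tB ?mulr0 // (leq_ltn_trans ki).
rewrite mxE (bigD1 i) //= big1 ?addr0 // => k.
rewrite neq_ltn => /orP[ki|ik]; first by rewrite tB // mulr0.
by rewrite tA // mul0r.
Qed.

(** Forward substitution in A A^-1 = 1, by induction on a bound for the row: above the diagonal,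
    earlier rows of the inverse already vanish and the diagonal of A has no zero. *)
Lemma invmx_trig n (A : 'M[F]_n) : A \in unitmx -> is_trig_mx A ->
  is_trig_mx (invmx A).
Proof.
move=> uA tA; have := uA; rewrite unitmxE (det_trig tA) unitfE => dA.
have Aii i : A i i != 0.
  by apply: contra dA => /eqP Aii; rewrite (bigD1 i) //= Aii mul0r.
move/is_trig_mxP: tA => tA.
suff H m (i j : 'I_n) : (i < m)%N -> (i < j)%N -> invmx A i j = 0.
  by apply/is_trig_mxP => i j; exact: (H i.+1).
elim: m i j => // m IH i j im ij.
have := congr1 (fun M : 'M[F]_n => M i j) (mulmxV uA).
rewrite !mxE -val_eqE /= (ltn_eqF ij) (bigD1 i) //= big1 ?addr0.
  by move/eqP; rewrite mulf_eq0 (negbTE (Aii i)) => /eqP.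
move=> k; rewrite neq_ltn => /orP[ki|ik]; last by rewrite tA // mul0r.
by rewrite (IH k j (leq_trans ki im) (ltn_trans ki ij)) mulr0.
Qed.

(** The diagonal of a product of triangular matrices is the product of the diagonals, so the
    commutator has zero diagonal. *)
Lemma commutator_trace_trig n (X Y Z : 'M[F]_n) :
  is_trig_mx X -> is_trig_mx Y -> is_trig_mx Z ->
  \tr (X *m (Y *m Z - Z *m Y)) = 0.
Proof.
move=> tX tY tZ; have [tYZ dYZ] := mulmx_trig tY tZ.
have [tZY dZY] := mulmx_trig tZ tY.
rewrite mulmxBr raddfB /= /mxtrace -sumrB big1 // => i _.
rewrite (mulmx_trig tX tYZ).2 (mulmx_trig tX tZY).2 dYZ dZY; ring.
Qed.

Lemma omega_trig n (M : 'M[jet F]_n) : M \in unitmx -> is_trig_mx M -> omega M = 0.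
Proof.
rewrite unitmx_mval => uM /is_trig_mxP tM.
have tV : is_trig_mx (invmx (mval M)).
  by apply: invmx_trig => //; apply/is_trig_mxP => i j ij; rewrite mxE tM // raddf0.
have tl k : is_trig_mx (logder k M).
  apply: (proj1 (mulmx_trig tV _)).
  by apply/is_trig_mxP => i j ij; rewrite mxE tM // raddf0.
exact: commutator_trace_trig.
Qed.

(** [is_trig_mx] means lower triangular, so upper triangular matrices are reached by transposition,
    under which the trace form only changes the order of its factors. *)
Lemma omega_trig_tr n (M : 'M[jet F]_n) : M \in unitmx -> is_trig_mx M^T -> omega M = 0.
Proof.
rewrite unitmx_mval => uM /is_trig_mxP tM.
have tV : is_trig_mx (invmx (mval M))^T.
  rewrite trmx_inv; apply: invmx_trig; first by rewrite unitmx_tr.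
  by apply/is_trig_mxP => i j ij; have := tM i j ij; rewrite !mxE => ->; rewrite raddf0.
have tl k : is_trig_mx (logder k M)^T.
  rewrite trmx_mul; apply: (proj1 (mulmx_trig _ tV)).
  by apply/is_trig_mxP => i j ij; have := tM i j ij; rewrite !mxE => ->; rewrite raddf0.
suff H (X Y Z : 'M[F]_n) : is_trig_mx X^T -> is_trig_mx Y^T -> is_trig_mx Z^T ->
    \tr (X *m (Y *m Z - Z *m Y)) = 0 by exact: H.
move=> tX tY tZ; rewrite -mxtrace_tr trmx_mul raddfB /= !trmx_mul mxtrace_mulC.
exact: commutator_trace_trig.
Qed.

End TrigMatrices.

(** * LU factorization near the identity *)

Section NearIdentity.
Context (R : realType) (G : topologicalType) (Gam : zmodType)
  (ev : characters R G Gam).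
Implicit Types (S : set Gam) (d : {additive Gam -> 'rV[R[i]]_3}).

Definition near_identity (e : R) n (A : G -> 'M[R[i]]_n) :=
  forall g i j, modc (A g i j - (1%:M : 'M[R[i]]_n) i j) <= e.

Lemma C1mx_block d S m1 m2 n1 n2 (A : G -> 'M[jet R[i]]_(m1, n1))
    (B : G -> 'M[jet R[i]]_(m1, n2)) (C : G -> 'M[jet R[i]]_(m2, n1))
    (D : G -> 'M[jet R[i]]_(m2, n2)) :
  C1mx ev d S A -> C1mx ev d S B -> C1mx ev d S C -> C1mx ev d S D ->
  C1mx ev d S (fun g => block_mx (A g) (B g) (C g) (D g)).
Proof.
move=> CA CB CC CD i j; case: (split_ordP i) => k ->; case: (split_ordP j) => l ->.
- rewrite (_ : (fun g => _) = fun g => A g k l); first exact: CA.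
  by apply/funext => g; rewrite block_mxEul.
- rewrite (_ : (fun g => _) = fun g => B g k l); first exact: CB.
  by apply/funext => g; rewrite block_mxEur.
- rewrite (_ : (fun g => _) = fun g => C g k l); first exact: CC.
  by apply/funext => g; rewrite block_mxEdl.
- rewrite (_ : (fun g => _) = fun g => D g k l); first exact: CD.
  by apply/funext => g; rewrite block_mxEdr.
Qed.

Lemma C1mx_scalar d S n (a : G -> jet R[i]) : S 0 -> C1 ev d S a ->
  C1mx ev d S (fun g => (a g)%:M : 'M[jet R[i]]_n).
Proof.
move=> S0 Ca i j; rewrite (_ : (fun g => _) = fun g => if i == j then a g else jconst 0).
  by case: eqP => _ //; exact: C1_jconst.
by apply/funext => g; rewrite mxE; case: eqP.
Qed.

Lemma C1mx1 d S n : S 0 -> C1mx ev d S (fun=> 1%:M : 'M[jet R[i]]_n).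
Proof. by move=> S0; exact: (@C1mx_scalar d S n _ S0 (C1_jconst ev d 1 S0)). Qed.

Lemma C1mx_cst d S m n (M : 'M[R[i]]_(m, n)) : S 0 ->
  C1mx ev d S (fun=> map_mx (fun c => jconst c) M).
Proof.
move=> S0 i j; rewrite (_ : (fun g => _) = fun g => jconst (M i j)).
  exact: C1_jconst.
by apply/funext => g; rewrite mxE.
Qed.

Lemma map_jconst0 m n : map_mx (fun c => jconst c) (0 : 'M[R[i]]_(m, n)) = 0.
Proof. by apply/matrixP => i j; rewrite !mxE. Qed.

Lemma C1mx0 d S m n : S 0 -> C1mx ev d S (fun=> 0 : 'M[jet R[i]]_(m, n)).
Proof. by move=> S0; rewrite -map_jconst0; exact: C1mx_cst. Qed.

Lemma C1mxZ d S m n (a : G -> jet R[i]) (A : G -> 'M[jet R[i]]_(m, n)) :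
  submonoid S -> C1 ev d S a -> C1mx ev d S A -> C1mx ev d S (fun g => a g *: A g).
Proof.
move=> mS Ca CA i j; rewrite (_ : (fun g => _) = fun g => a g * A g i j).
  exact: (C1_mul mS Ca (CA i j)).
by apply/funext => g; rewrite mxE.
Qed.

Lemma C1mxB d S m n (A B : G -> 'M[jet R[i]]_(m, n)) :
  S 0 -> C1mx ev d S A -> C1mx ev d S B -> C1mx ev d S (fun g => A g - B g).
Proof.
move=> S0 CA CB i j; rewrite (_ : (fun g => _) = fun g => A g i j - B g i j).
  exact: (C1B S0 (CA i j) (CB i j)).
by apply/funext => g; rewrite !mxE.
Qed.

Lemma C1mxN d S m n (A : G -> 'M[jet R[i]]_(m, n)) :
  S 0 -> C1mx ev d S A -> C1mx ev d S (fun g => - A g).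
Proof.
move=> S0 CA i j; rewrite (_ : (fun g => _) = fun g => - A g i j).
  exact: (C1N S0 (CA i j)).
by apply/funext => g; rewrite mxE.
Qed.

(** One elimination step at most doubles the distance to the identity: e <= 1/2 gives |a^-1| <= 2,
    so the correction is at most 2 e^2 <= e. *)
Lemma schur_bound (e : R) (a b c x dl : R[i]) : 0 <= e <= 2^-1 ->
  modc (a - 1) <= e -> modc b <= e -> modc c <= e -> modc (x - dl) <= e ->
  modc (x - a^-1 * (c * b) - dl) <= 2 * e.
Proof.
move=> /andP[e0 e1] ae be ce xe.
have a1 : 1 - e <= modc a.
  have -> : (1 : R) = modc (a - (a - 1)) by rewrite subKr modc1.
  by rewrite lerBlDr (le_trans (modcB _ _)) // lerD2l.
have a0 : 2^-1 <= modc a by lra.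
have a2 : modc a^-1 <= 2.
  have : modc (a^-1) * modc a = 1.
    rewrite -modcM mulVf ?modc1 //; apply/eqP => az; move: a0; rewrite az modc0; lra.
  by move=> h; have := modc_ge0 a^-1; nra.
have -> : x - a^-1 * (c * b) - dl = (x - dl) - a^-1 * (c * b) by ring.
rewrite (le_trans (modcB _ _)) // mulr_natl mulr2n lerD // !modcM.
have := modc_ge0 b; have := modc_ge0 c; have := modc_ge0 a^-1; move=> h1 h2 h3.
apply: (@le_trans _ _ (2 * (e * 2^-1))); last by lra.
by rewrite !ler_pM ?mulr_ge0 //; lra.
Qed.

(* Gaussian elimination needs no pivoting this close to the identity. *)
Lemma near_identity_LU d S n (A : G -> 'M[jet R[i]]_n) : submonoid S ->
  C1mx ev d S A -> near_identity (2 ^- n) (fun g => mval (A g)) ->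
  exists L U : G -> 'M[jet R[i]]_n,
    [/\ C1GL ev d S L, C1GL ev d S U, forall g, is_trig_mx (L g),
        forall g, is_trig_mx (U g)^T & forall g, A g = L g *m U g].
Proof.
move=> mS; have S0 := mS.1; elim: n A => [|n IH] A CA nA.
  have C1I : C1GL ev d S (fun=> 1%:M : 'M[jet R[i]]_0).
    by split=> [[]//|]; exists (fun=> 1%:M) => [[]//|g]; rewrite mul1mx.
  exists (fun=> 1%:M), (fun=> 1%:M); split=> // g; last by apply/matrixP => -[].
  by apply/is_trig_mxP => -[].
pose A' g : 'M[jet R[i]]_(1 + n) := A g.
pose a g := A g 0 0; pose b g := ursubmx (A' g); pose c g := dlsubmx (A' g).
have ul g : ulsubmx (A' g) = (a g)%:M.
  by apply/matrixP => i j; rewrite !ord1 !mxE eqxx mulr1n; congr (A g _ _); apply/val_inj.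
have Ca : C1 ev d S a by exact: CA.
have Cb : C1mx ev d S b.
  move=> i j; rewrite (_ : (fun g => _) = fun g => A' g (lshift n i) (rshift 1 j)).
    exact: CA.
  by apply/funext => g; rewrite !mxE.
have Cc : C1mx ev d S c.
  move=> i j; rewrite (_ : (fun g => _) = fun g => A' g (rshift 1 i) (lshift n j)).
    exact: CA.
  by apply/funext => g; rewrite !mxE.
have CD : C1mx ev d S (fun g => drsubmx (A' g)).
  move=> i j; rewrite (_ : (fun g => _) = fun g => A' g (rshift 1 i) (rshift 1 j)).
    exact: CA.
  by apply/funext => g; rewrite !mxE.
have e1 : 0 <= (2 ^- n.+1 : R) <= 2^-1.
  apply/andP; split; first by rewrite invr_ge0 exprn_ge0.
  by rewrite lef_pV2 ?posrE ?exprn_gt0 // exprS ler_peMr // exprn_ege1 // ler1n.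
have ea g : modc (jval (a g) - 1) <= 2 ^- n.+1.
  by have := nA g 0 0; rewrite !mxE eqxx.
have [ua CVa] : (forall g, a g \is a GRing.unit) /\ C1 ev d S (fun g => (a g)^-1).
  apply: (C1_inv mS Ca (q := 2^-1)); first by lra.
  by move=> g; rewrite (le_trans (ea g)) //; case/andP: e1.
(* The Schur complement of the corner entry. Each elimination doubles the error, which is why the
   tolerance for size n is 2^-n. *)
pose D' g := drsubmx (A' g) - (a g)^-1 *: (c g *m b g).
have CD' : C1mx ev d S D' by exact: (C1mxB S0 CD (C1mxZ mS CVa (C1mxM mS Cc Cb))).
have nD' : near_identity (2 ^- n) (fun g => mval (D' g)).
  move=> g i j.
  have -> : mval (D' g) i j = jval (A' g (rshift 1 i) (rshift 1 j)) - (jval (a g))^-1 *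
      (jval (A' g (rshift 1 i) (lshift n 0)) * jval (A' g (lshift n 0) (rshift 1 j))).
    by rewrite !mxE big_ord1 !mxE -jvalV -?jet_unitE.
  have -> : (2 ^- n : R) = 2 * (2 ^- n.+1 : R) by rewrite exprS invfM mulVKf.
  apply: schur_bound => //.
  - have := nA g (lshift n (0 : 'I_1) : 'I_(1 + n)) (rshift 1 j : 'I_(1 + n)).
    by rewrite !mxE -val_eqE /= subr0.
  - have := nA g (rshift 1 i : 'I_(1 + n)) (lshift n (0 : 'I_1) : 'I_(1 + n)).
    by rewrite !mxE -val_eqE /= subr0.
  - have := nA g (rshift 1 i : 'I_(1 + n)) (rshift 1 j : 'I_(1 + n)).
    by rewrite !mxE -!val_eqE.
have [L' [U' [GL GU tL tU eLU]]] := IH D' CD' nD'.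
pose L g : 'M[jet R[i]]_(1 + n) := block_mx 1%:M 0 ((a g)^-1 *: c g) (L' g).
pose U g : 'M[jet R[i]]_(1 + n) := block_mx (a g)%:M (b g) 0 (U' g).
have [uL CVL] := C1GL_inv GL; have [uU CVU] := C1GL_inv GU.
exists L, U; split.
- split; first exact: (C1mx_block (@C1mx1 d S 1 S0) (@C1mx0 d S _ _ S0) (C1mxZ mS CVa Cc) GL.1).
  exists (fun g => block_mx 1%:M 0 (- (invmx (L' g) *m ((a g)^-1 *: c g))) (invmx (L' g))).
    exact: (C1mx_block (@C1mx1 d S 1 S0) (@C1mx0 d S _ _ S0)
      (C1mxN S0 (C1mxM mS CVL (C1mxZ mS CVa Cc))) CVL).
  move=> g; rewrite (@mulmx_block _ 1 n 1 n 1 n) !mul1mx !mulmx1 !mul0mx !addr0 mulmx0 add0r.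
  by rewrite mulmxN mulKVmx // subrr mulmxV // -scalar_mx_block.
- split; first exact: (C1mx_block (@C1mx_scalar d S 1 _ S0 Ca) Cb (@C1mx0 d S _ _ S0) GU.1).
  exists (fun g => block_mx ((a g)^-1)%:M (- ((a g)^-1 *: (b g *m invmx (U' g)))) 0 (invmx (U' g))).
    exact: (C1mx_block (@C1mx_scalar d S 1 _ S0 CVa)
      (C1mxN S0 (C1mxZ mS CVa (C1mxM mS Cb CVU))) (@C1mx0 d S _ _ S0) CVU).
  move=> g; rewrite (@mulmx_block _ 1 n 1 n 1 n) !mulmx0 !mul0mx !addr0 !add0r.
  rewrite -scalar_mxM divrr // mulmxN mul_scalar_mx scalerA divrr // scale1r addNr.
  by rewrite mulmxV // -scalar_mx_block.
- move=> g; rewrite /L (@is_trig_block_mx _ 1 n 1 n) // eqxx tL andbT.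
  exact: mx11_is_trig.
- move=> g; rewrite /U (@tr_block_mx _ 1 n 1 n) (@is_trig_block_mx _ 1 n 1 n) //.
  rewrite trmx0 eqxx tU andbT.
  exact: mx11_is_trig.
- move=> g; rewrite -[A g]/(A' g) -[A' g in LHS](@submxK _ 1 n 1 n).
  rewrite /L /U (@mulmx_block _ 1 n 1 n 1 n) !mul1mx !mul0mx !addr0 -/(b g) -/(c g) ul.
  rewrite mul_mx_scalar scalerA divrr // scale1r -scalemxAl -eLU.
  by rewrite [_ + D' g]addrC subrK mulmx0 addr0.
Qed.

Lemma near_identity_degree (I : mean ev) d n (A : G -> 'M[jet R[i]]_n) :
  C1mx ev d setT A -> near_identity (2 ^- n) (fun g => mval (A g)) ->
  degree I A = 0.
Proof.
move=> CA nA; have mT : submonoid (@setT Gam) by [].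
have [L [U [GL GU tL tU eLU]]] := near_identity_LU mT CA nA.
rewrite (_ : A = fun g => L g *m U g); last by apply/funext.
have [uL _] := C1GL_inv GL; have [uU _] := C1GL_inv GU.
have dL : degree I L = 0.
  rewrite /degree -[RHS](mean0 I); congr (mean_val I _); apply/funext => g.
  exact: (omega_trig (uL g) (tL g)).
have dU : degree I U = 0.
  rewrite /degree -[RHS](mean0 I); congr (mean_val I _); apply/funext => g.
  exact: (omega_trig_tr (uU g) (tU g)).
by rewrite (degreeM I GL GU) dL dU addr0.
Qed.

Lemma near_identity_C1GL d S n (A : G -> 'M[jet R[i]]_n) : submonoid S ->
  C1mx ev d S A -> near_identity (2 ^- n) (fun g => mval (A g)) -> C1GL ev d S A.
Proof.
move=> mS CA nA; have [L [U [GL GU _ _ eLU]]] := near_identity_LU mS CA nA.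
rewrite (_ : A = fun g => L g *m U g); last by apply/funext.
exact: (C1GLM mS GL GU).
Qed.

End NearIdentity.

(** * The degree of a continuous matrix function *)

Lemma min_lel (R : realType) (a b : R) : Num.min a b <= a.
Proof. by rewrite ge_min lexx. Qed.

Lemma min_ler (R : realType) (a b : R) : Num.min a b <= b.
Proof. by rewrite ge_min lexx orbT. Qed.

Section LocalDegree.
Context (R : realType) (G : topologicalType) (Gam : zmodType)
  (ev : characters R G Gam) (I : mean ev) (d : {additive Gam -> 'rV[R[i]]_3}).
Variable n : nat.
Implicit Types (S : set Gam) (A B X Y : G -> 'M[R[i]]_n) (P Q : G -> 'M[jet R[i]]_n).

Definition close (e : R) X Y := forall g i j, modc (X g i j - Y g i j) <= e.

Definition mvalf P : G -> 'M[R[i]]_n := fun g => mval (P g).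

(** Only values are approximated: X itself carries no derivatives. *)
Definition approx S X := forall e : R, 0 < e ->
  exists2 P, C1mx ev d S P & close e X (mvalf P).

Definition bounded_by (K : R) X := forall g i j, modc (X g i j) <= K.

Lemma close_sym e X Y : close e X Y -> close e Y X.
Proof. by move=> XY g i j; rewrite -modcN opprB. Qed.

Lemma close_trans e e' X Y Z : close e X Y -> close e' Y Z -> close (e + e') X Z.
Proof.
move=> XY YZ g i j.
have -> : X g i j - Z g i j = (X g i j - Y g i j) + (Y g i j - Z g i j) by ring.
by rewrite (le_trans (modcD _ _)) // lerD.
Qed.

Lemma closeW e e' X Y : e <= e' -> close e X Y -> close e' X Y.
Proof. by move=> ee XY g i j; rewrite (le_trans (XY g i j)). Qed.

Lemma closeM e e' K L X X' Y Y' : 0 <= e -> 0 <= e' ->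
  bounded_by K X -> bounded_by L Y' -> close e X X' -> close e' Y Y' ->
  close (n%:R * (K * e' + e * L)) (fun g => X g *m Y g) (fun g => X' g *m Y' g).
Proof.
move=> e0 e0' KX LY XX YY g i j; rewrite !mxE -sumrB.
rewrite (le_trans (modc_sum _ _ _)) //.
apply: (@le_trans _ _ (\sum_(k < n) (K * e' + e * L))); last first.
  by rewrite sumr_const card_ord mulr_natl.
apply: ler_sum => k _.
have -> : X g i k * Y g k j - X' g i k * Y' g k j =
  X g i k * (Y g k j - Y' g k j) + (X g i k - X' g i k) * Y' g k j by ring.
by rewrite (le_trans (modcD _ _)) // lerD // modcM ler_pM ?modc_ge0.
Qed.

Lemma C1mx_bounded S P : C1mx ev d S P -> exists2 K : R, 0 < K & bounded_by K (mvalf P).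
Proof.
move=> CP.
have /choice[K KP] (ij : 'I_n * 'I_n) : exists K : R, 0 < K /\
    forall g, jnorm 1 (P g ij.1 ij.2) <= K.
  by have [K K0 KP] := C1_bounded (CP ij.1 ij.2); exists K.
exists (1 + \sum_ij K ij).
  by rewrite ltr_pwDl // sumr_ge0 // => ij _; rewrite ltW // (KP ij).1.
move=> g i j; rewrite mxE (le_trans (modc_jval_le _ ler01)) //.
rewrite (le_trans ((KP (i, j)).2 g)) // (bigD1 (i, j)) //= addrCA lerDl.
by rewrite addr_ge0 // sumr_ge0 // => ij _; rewrite ltW // (KP ij).1.
Qed.

Lemma approx_bounded S X : approx S X -> exists2 K : R, 0 < K & bounded_by K X.
Proof.
move=> /(_ 1 ltr01)[P CP XP]; have [K K0 KP] := C1mx_bounded CP.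
exists (1 + K) => [|g i j]; first by rewrite addr_gt0.
rewrite -[X g i j](subrK (mvalf P g i j)) (le_trans (modcD _ _)) // lerD //.
Qed.

Lemma small_factors (K L e : R) : 0 < K -> 0 < L -> 0 < e ->
  exists2 e', 0 < e' & forall x, x <= e' -> n%:R * (K * x + x * L) <= e.
Proof.
(* With n + 1 instead of n the denominator is positive for n = 0 as well. *)
move=> K0 L0 e0; have n0 : 0 < n%:R + 1 :> R by rewrite ltr_wpDl.
have D0 : 0 < (n%:R + 1) * (K + L) by rewrite mulr_gt0 // addr_gt0.
exists (e / ((n%:R + 1) * (K + L))) => [|x xe]; first by rewrite divr_gt0.
set e' := e / _ in xe.
have -> : e = ((n%:R + 1) * (K + L)) * e' by rewrite mulrC divfK // gt_eqF.
have -> : n%:R * (K * x + x * L) = (n%:R * (K + L)) * x by ring.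
apply: (@le_trans _ _ ((n%:R * (K + L)) * e')).
  by rewrite ler_wpM2l // mulr_ge0 // ltW // addr_gt0.
by rewrite ler_wpM2r ?divr_ge0 ?(ltW e0) ?(ltW D0) // ler_wpM2r ?lerDl // ltW // addr_gt0.
Qed.

Lemma approxM S X Y : submonoid S -> approx S X -> approx S Y ->
  approx S (fun g => X g *m Y g).
Proof.
move=> mS aX aY e e0; have [K K0 KX] := approx_bounded aX.
have [L L0 LY] := approx_bounded aY.
have L1 : 0 < 1 + L by rewrite addr_gt0.
have [e' e'0 small] := small_factors K0 L1 e0.
pose e1 := Num.min e' 1.
have e10 : 0 < e1 by rewrite lt_min e'0 ltr01.
have [P CP XP] := aX _ e10; have [Q CQ YQ] := aY _ e10.
exists (fun g => P g *m Q g); first exact: C1mxM.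
have LQ : bounded_by (1 + L) (mvalf Q).
  move=> g i j; rewrite -[_ i j](subrK (Y g i j)) (le_trans (modcD _ _)) // lerD //.
  by rewrite (le_trans (close_sym YQ g i j)) // ge_min lexx orbT.
have h := closeM (ltW e10) (ltW e10) KX LQ XP YQ.
have -> : mvalf (fun g => P g *m Q g) = fun g => mvalf P g *m mvalf Q g.
  by apply/funext => g; exact: mvalM.
by apply: closeW h; apply: small; exact: min_lel.
Qed.

(** Q P is invertible in the closure, so P has the left inverse (Q P)^-1 Q and Q the right inverse P
    (Q P)^-1; for square matrices this is enough. *)
Lemma near_inverse S P Q : submonoid S -> C1mx ev d S P -> C1mx ev d S Q ->
  near_identity (2 ^- n) (fun g => mval (Q g *m P g)) ->
  C1GL ev d S P /\ C1GL ev d S Q.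
Proof.
move=> mS CP CQ nQP.
have [uQP CV] := C1GL_inv (near_identity_C1GL mS (C1mxM mS CQ CP) nQP).
split; split=> //.
  exists (fun g => invmx (Q g *m P g) *m Q g); first exact: C1mxM.
  by move=> g; apply: mulmx1C; rewrite -mulmxA mulVmx.
exists (fun g => P g *m invmx (Q g *m P g)); first exact: C1mxM.
by move=> g; rewrite mulmxA mulmxV.
Qed.

(** The common degree of all differentiable matrices uniformly close to A. As a relation it avoids
    the choice of an approximant; uniqueness holds as soon as one exists. *)
Definition has_degree A (c : R[i]) := exists2 e : R, 0 < e &
  forall P, C1mx ev d setT P -> close e A (mvalf P) ->
    C1GL ev d setT P /\ degree I P = c.

Lemma has_degree_uniq A c c' : approx setT A -> has_degree A c -> has_degree A c' ->
  c = c'.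
Proof.
move=> aA [e e0 He] [e' e'0 He'].
have m0 : 0 < Num.min e e' by rewrite lt_min e0.
have [P CP AP] := aA _ m0.
have [_ <-] := He P CP (closeW (min_lel e e') AP).
by have [_ <-] := He' P CP (closeW (min_ler e e') AP).
Qed.

Lemma has_degree_open A c : has_degree A c ->
  exists2 e : R, 0 < e & forall B, close e A B -> has_degree B c.
Proof.
move=> [e e0 He]; have e2 : 0 < e / 2 by rewrite divr_gt0.
exists (e / 2) => // B AB; exists (e / 2) => // P CP BP; apply: He => //.
by rewrite (splitr e); exact: close_trans AB BP.
Qed.

(* Q approximates A', so Q P is near the identity for every P near A. *)
Lemma approx_inverse S A A' : submonoid S -> approx S A -> approx S A' ->
  (forall g, A g *m A' g = 1%:M) ->
  exists2 Q, C1mx ev d S Q & exists2 e : R, 0 < e &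
    forall S' P, S `<=` S' -> submonoid S' -> C1mx ev d S' P -> close e A (mvalf P) ->
    [/\ C1GL ev d S' P, C1GL ev d S' Q &
        near_identity (2 ^- n) (fun g => mval (Q g *m P g))].
Proof.
move=> mS aA aA' AA'.
have [K K0 KA] := approx_bounded aA; have [L L0 LA] := approx_bounded aA'.
have t0 : 0 < 2 ^- n :> R by rewrite invr_gt0 exprn_gt0.
have L1 : 0 < 1 + L by rewrite addr_gt0.
have [e' e'0 small] := small_factors L1 K0 t0.
pose e1 := Num.min e' 1.
have e10 : 0 < e1 by rewrite lt_min e'0 ltr01.
have [Q CQ A'Q] := aA' _ e10.
have LQ : bounded_by (1 + L) (mvalf Q).
  move=> g i j; rewrite -[_ i j](subrK (A' g i j)) (le_trans (modcD _ _)) // lerD //.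
  by rewrite (le_trans (close_sym A'Q g i j)) // ge_min lexx orbT.
exists Q => //; exists e1 => // S' P SS mS' CP AP.
have CQ' : C1mx ev d S' Q by move=> i j; exact: (C1_sub SS (CQ i j)).
suff nQP : near_identity (2 ^- n) (fun g => mval (Q g *m P g)).
  by have [GP GQ] := near_inverse mS' CP CQ' nQP.
have h := closeM (ltW e10) (ltW e10) LQ KA (close_sym A'Q) (close_sym AP).
move=> g i j; have := h g i j.
rewrite (mulmx1C (AA' g)) -mvalM -modcN opprB => {}h; apply: le_trans h _.
by apply: small; exact: min_lel.
Qed.

(** One Q serves every P near A: deg Q + deg P = deg (Q P) = 0, so all these P share the degree -
    deg Q. *)
Lemma has_degree_ex A A' : approx setT A -> approx setT A' ->
  (forall g, A g *m A' g = 1%:M) -> exists c, has_degree A c.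
Proof.
move=> aA aA' AA'; have mT : submonoid (@setT Gam) by [].
have [Q CQ [e e0 He]] := approx_inverse mT aA aA' AA'.
exists (- degree I Q), e => // P CP AP.
have [GP GQ nQP] := He setT P (fun _ => id) mT CP AP.
split=> //; have := near_identity_degree I (C1mxM mT CQ CP) nQP.
by rewrite (degreeM I GQ GP) addrC => /eqP; rewrite addr_eq0 => /eqP.
Qed.

Lemma has_degreeM A A' B B' a b : approx setT A -> approx setT A' ->
  approx setT B -> approx setT B' ->
  (forall g, A g *m A' g = 1%:M) -> (forall g, B g *m B' g = 1%:M) ->
  has_degree A a -> has_degree B b -> has_degree (fun g => A g *m B g) (a + b).
Proof.
move=> aA aA' aB aB' AA' BB' [ea ea0 Ha] [eb eb0 Hb].
have mT : submonoid (@setT Gam) by [].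
have [c hc] : exists c, has_degree (fun g => A g *m B g) c.
  apply: (@has_degree_ex _ (fun g => B' g *m A' g)); [exact: approxM|exact: approxM|].
  by move=> g; rewrite mulmxA -[_ *m B g *m _]mulmxA BB' mulmx1 AA'.
suff -> : a + b = c by [].
have [e e0 He] := hc.
have [K K0 KA] := approx_bounded aA; have [L L0 LB] := approx_bounded aB.
have L1 : 0 < 1 + L by rewrite addr_gt0.
have [e' e'0 small] := small_factors K0 L1 e0.
pose e1 := Num.min (Num.min e' 1) (Num.min ea eb).
have e10 : 0 < e1 by rewrite !lt_min e'0 ltr01 ea0.
have le1 : [/\ e1 <= e', e1 <= 1, e1 <= ea & e1 <= eb].
  by rewrite /e1; split; rewrite !ge_min lexx ?orbT.
case: le1 => l1 l2 l3 l4.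
have [P CP AP] := aA _ e10; have [Q CQ BQ] := aB _ e10.
have [GP <-] := Ha P CP (closeW l3 AP); have [GQ <-] := Hb Q CQ (closeW l4 BQ).
have LQ : bounded_by (1 + L) (mvalf Q).
  move=> g i j; rewrite -[_ i j](subrK (B g i j)) (le_trans (modcD _ _)) // lerD //.
  by rewrite (le_trans (close_sym BQ g i j)).
rewrite -(degreeM I GP GQ); apply: (proj2 (He _ (C1mxM mT CP CQ) _)).
have -> : mvalf (fun g => P g *m Q g) = fun g => mvalf P g *m mvalf Q g.
  by apply/funext => g; exact: mvalM.
by apply: closeW (closeM (ltW e10) (ltW e10) KA LQ AP BQ); exact: small.
Qed.

Lemma has_degree1 : has_degree (fun=> 1%:M) 0.
Proof.
have mT : submonoid (@setT Gam) by [].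
exists (2 ^- n) => [|P CP P1]; first by rewrite invr_gt0 exprn_gt0.
have nP : near_identity (2 ^- n) (mvalf P) by exact: close_sym P1.
split; [exact: (near_identity_C1GL mT CP nP)|exact: (near_identity_degree I CP nP)].
Qed.

Lemma has_degreeV A A' a : approx setT A -> approx setT A' ->
  (forall g, A g *m A' g = 1%:M) -> has_degree A a -> has_degree A' (- a).
Proof.
move=> aA aA' AA' ha; have A'A g : A' g *m A g = 1%:M by exact: mulmx1C.
have [a' ha'] := has_degree_ex aA' aA A'A.
suff -> : - a = a' by [].
have := has_degreeM aA aA' aA' aA AA' A'A ha ha'.
rewrite (_ : (fun g => A g *m A' g) = fun=> 1%:M); last by apply/funext.
move=> h; have a1 : approx setT (fun=> 1%:M : 'M[R[i]]_n).
  move=> e e0; exists (fun=> 1%:M); first exact: C1mx1.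
  by move=> g i j; rewrite /mvalf mval1 subrr modc0 ltW.
have := has_degree_uniq a1 h has_degree1.
by rewrite addrC => /eqP; rewrite addr_eq0 => /eqP ->.
Qed.

(* Upper triangular matrices have approximants of the same shape. *)
Lemma has_degree_triangular A A' : approx setT A -> approx setT A' ->
  (forall g, A g *m A' g = 1%:M) -> (forall g (i j : 'I_n), (j < i)%N -> A g i j = 0) ->
  has_degree A 0.
Proof.
move=> aA aA' AA' tA; have [c hc] := has_degree_ex aA aA' AA'.
suff -> : 0 = c by [].
have [e e0 He] := hc; have [P CP AP] := aA _ e0.
pose Q g : 'M[jet R[i]]_n := \matrix_(i, j) if (j < i)%N then 0 else P g i j.
have CQ : C1mx ev d setT Q.
  move=> i j; have [ij|ij] := boolP (j < i)%N.
    have -> : (fun g => Q g i j) = fun=> jconst 0 by apply: funext => g; rewrite mxE ij.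
    exact: C1_jconst.
  have -> : (fun g => Q g i j) = fun g => P g i j.
    by apply: funext => g; rewrite mxE (negbTE ij).
  exact: CP.
have AQ : close e A (mvalf Q).
  move=> g i j; rewrite !mxE; case: ifP => ij; last by have := AP g i j; rewrite mxE.
  by rewrite tA // jval0 subr0 modc0 ltW.
have [GQ <-] := He Q CQ AQ; have [uQ _] := C1GL_inv GQ.
rewrite /degree -[LHS](mean0 I); congr (mean_val I _); apply/funext => g.
apply/esym/omega_trig_tr => //.
by apply/is_trig_mxP => i j ij; rewrite !mxE ij.
Qed.

(** S meets -S at most in 0, as the two cones of an ordered group do by antisymmetry. *)
Definition pointed S := forall a b, S a -> S b -> a + b = 0 -> b = 0.

Lemma map_jconstM (X Y : 'M[R[i]]_n) :
  map_mx (fun c => jconst c) (X *m Y) =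
  map_mx (fun c => jconst c) X *m map_mx (fun c => jconst c) Y.
Proof.
apply/matrixP => i j; rewrite !mxE jconst_sum; apply: eq_bigr => k _.
by rewrite !mxE jconstM.
Qed.

Lemma map_jconstB (X Y : 'M[R[i]]_n) :
  map_mx (fun c => jconst c) (X - Y) =
  map_mx (fun c => jconst c) X - map_mx (fun c => jconst c) Y.
Proof. by apply/matrixP => i j; rewrite !mxE jconstB. Qed.

(* The form is linear in the derivatives and its other factors have spectrum in
   S, so its mean only sees the vanishing derivative of the constant term. *)
Lemma degree_pointed S P : submonoid S -> pointed S -> C1GL ev d S P -> degree I P = 0.
Proof.
move=> mS pS GP; have S0 := mS.1; have [uP CV] := C1GL_inv GP.
pose jc (X : 'M[R[i]]_n) := map_mx (fun c => jconst c) X.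
pose V g := mval (invmx (P g)).
have CjV : C1mx ev (zero_weight R Gam) S (fun g => jc (V g)).
  move=> i j; rewrite (_ : (fun g => _) = fun g => jconst (jval (invmx (P g) i j))).
    exact: (C1_zero_jval (CV i j)).
  by apply/funext => g; rewrite !mxE.
have CjD k : C1mx ev (zero_weight R Gam) S (fun g => jc (mder k (P g))).
  move=> i j; rewrite (_ : (fun g => _) = fun g => jconst (jder k (P g i j))).
    exact: (C1_zero_jder k (GP.1 i j)).
  by apply/funext => g; rewrite !mxE.
pose l k g := V g *m mder (ord3 k) (P g).
have Cl k : C1mx ev (zero_weight R Gam) S (fun g => jc (l k g)).
  rewrite (_ : (fun g => _) = fun g => jc (V g) *m jc (mder (ord3 k) (P g))).
    exact: (C1mxM mS CjV (CjD (ord3 k))).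
  by apply/funext => g; exact: map_jconstM.
(* Cyclicity moves the factor D_0 P to the end: the form becomes the trace of W times D_0 P, and the
   entries of W have spectrum in S. *)
pose W g := (l 1%N g *m l 2%N g - l 2%N g *m l 1%N g) *m V g.
have CW : C1mx ev (zero_weight R Gam) S (fun g => jc (W g)).
  rewrite (_ : (fun g => _) = fun g =>
    (jc (l 1%N g) *m jc (l 2%N g) - jc (l 2%N g) *m jc (l 1%N g)) *m jc (V g)).
    exact: (C1mxM mS (C1mxB S0 (C1mxM mS (Cl 1%N) (Cl 2%N)) (C1mxM mS (Cl 2%N) (Cl 1%N))) CjV).
  apply/funext => g; rewrite /jc.
  have e1 := map_jconstM (l 1%N g) (l 2%N g).
  have e2 := map_jconstM (l 2%N g) (l 1%N g).
  have e3 := map_jconstB (l 1%N g *m l 2%N g) (l 2%N g *m l 1%N g).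
  by rewrite -e1 -e2 -e3; exact: map_jconstM.
have omegaE g : omega (P g) = \sum_i \sum_j W g i j * jder (ord3 0) (P g j i).
  have lE k : logder (ord3 k) (P g) = l k g by rewrite /logder -mval_inv.
  rewrite /omega !lE mxtrace_mulC -[l 0%N g]/(V g *m mder (ord3 0) (P g)) mulmxA -/(W g).
  apply: eq_bigr => i _; rewrite mxE; apply: eq_bigr => j _.
  by congr (_ * _); rewrite mxE.
have cW i j : ccontinuous (fun g => W g i j * jder (ord3 0) (P g j i)).
  have := ccontM (C1_ccont_jval I (CW i j)) (C1_ccont_jder I (ord3 0) (GP.1 j i)).
  by under eq_fun do rewrite mxE.
rewrite /degree (_ : (fun g => _) = fun g => \sum_i \sum_j W g i j * jder (ord3 0) (P g j i));
  last by apply/funext.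
rewrite mean_sum => [|i]; last by apply: ccont_sum => j; exact: cW.
apply: big1 => i _; rewrite mean_sum => [|j]; last exact: cW.
apply: big1 => j _.
have SS a b : S a -> S b -> a + b = 0 -> d b = 0.
  by move=> Sa Sb ab; rewrite (pS a b Sa Sb ab) raddf0.
have := mean_mul_jder I (ord3 0) (CW i j) (GP.1 j i) SS.
by under eq_fun do rewrite mxE.
Qed.

(** Approximating A and its inverse inside S produces a P near A whose inverse also has entries with
    spectrum in S. *)
Lemma has_degree_pointed S A A' : submonoid S -> pointed S -> approx S A ->
  approx S A' -> (forall g, A g *m A' g = 1%:M) -> has_degree A 0.
Proof.
move=> mS pS aA aA' AA'.
have aT X : approx S X -> approx setT X.
  move=> aX e /aX[P CP XP]; exists P => // i j; exact: (C1_sub _ (CP i j)).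
have [c hc] := has_degree_ex (aT _ aA) (aT _ aA') AA'.
suff -> : 0 = c by [].
have [e e0 He] := hc; have [Q CQ [e' e'0 He']] := approx_inverse mS aA aA' AA'.
have m0 : 0 < Num.min e e' by rewrite lt_min e0.
have [P CP AP] := aA _ m0.
have CPT : C1mx ev d setT P by move=> i j; exact: (C1_sub _ (CP i j)).
have [_ <-] := He P CPT (closeW (min_lel e e') AP).
have [GP _ _] := He' S P (fun _ => id) mS CP (closeW (min_ler e e') AP).
by rewrite (degree_pointed mS pS GP).
Qed.

End LocalDegree.

(** * Folner sets and Fejer-type summation *)

Section Folner.
Context (R : realType).

(** r^N is the least of the N + 1 terms of a geometric sum bounded by 1 / (1 - r). *)
Lemma expn_mul_bounded (r : R) N : 0 <= r < 1 -> (N.+1)%:R * r ^+ N <= (1 - r)^-1.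
Proof.
move=> /andP[r0 r1]; rewrite -[leRHS]mul1r ler_pdivlMr ?subr_gt0 //.
apply: (@le_trans _ _ ((\sum_(k < N.+1) r ^+ k) * (1 - r))).
  rewrite ler_wpM2r ?subr_ge0 ?(ltW r1) // -[N.+1 in leLHS]card_ord mulr_natl -sumr_const.
  by apply: ler_sum => k _; rewrite ler_wiXn2l // ?(ltW r1) // -ltnS.
have -> : (\sum_(k < N.+1) r ^+ k) * (1 - r) = 1 - r ^+ N.+1.
  by rewrite -[RHS]opprB subrX1; ring.
by rewrite gerBl exprn_ge0.
Qed.

Lemma bernoulli (x : R) k : 0 <= x <= 1 -> 1 - k%:R * x <= (1 - x) ^+ k.
Proof.
move=> /andP[x0 x1]; elim: k => [|k IH]; first by rewrite mul0r subr0.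
have [h|h] := leP 0 (1 - k%:R * x); last first.
  apply: le_trans (exprn_ge0 _ _); last by rewrite subr_ge0.
  by rewrite -natr1 mulrDl mul1r; lra.
rewrite exprS; apply: le_trans (ler_wpM2l _ IH); last by rewrite subr_ge0.
rewrite -natr1; have : 0 <= k%:R * x * x by rewrite !mulr_ge0.
lra.
Qed.

(** If u N < r u (N + 1) for all N, then u N >= r^-N, which outgrows every polynomial. *)
Lemma polynomial_growth (u : nat -> R) m (r : R) : 0 < r < 1 -> 1 <= u 0%N ->
  (forall N, u N <= (N.+1)%:R ^+ m) -> exists N, r * u N.+1 <= u N.
Proof.
move=> /andP[r0 r1] u0 um; apply: contrapT => no.
have small N : u N < r * u N.+1 by rewrite ltNge; apply/negP => h; apply: no; exists N.
have geo N : 1 <= r ^+ N * u N.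
  elim: N => [|N IH]; first by rewrite mul1r.
  by rewrite (le_trans IH) // exprSr -mulrA ler_wpM2l ?exprn_ge0 ?ltW.
(* By Bernoulli r <= rho^(m+1). One factor rho^N is kept and the other m absorb the polynomial: r^N
   (N+1)^m <= rho^N ((N+1) rho^N)^m <= C^m rho^N. *)
pose rho := 1 - (1 - r) / m.+1%:R.
have m0 : 0 < m.+1%:R :> R by rewrite ltr0n.
have x01 : 0 <= (1 - r) / m.+1%:R <= 1.
  rewrite divr_ge0 ?subr_ge0 ?(ltW r1) // ler_pdivrMr // mul1r.
  rewrite (@le_trans _ _ 1) //; first by rewrite lerBlDr lerDl ltW.
  by rewrite ler1n.
have rho01 : 0 <= rho < 1.
  case/andP: x01 => xa xb; rewrite /rho subr_ge0 xb /= ltrBlDr ltrDl.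
  by rewrite divr_gt0 ?subr_gt0.
have rrho : r <= rho ^+ m.+1.
  have := bernoulli m.+1 x01; rewrite mulrC divfK ?gt_eqF // subKr => h; exact: h.
have /andP[rho0 _] := rho01.
pose C := (1 - rho)^-1.
have C0 : 0 < C by rewrite invr_gt0 subr_gt0; case/andP: rho01.
have D0 : 0 < (C ^+ m)^-1 / 2 by rewrite divr_gt0 // invr_gt0 exprn_gt0.
have [N rN] := exp_small rho01 D0.
have := geo N; rewrite leNgt => /negP; apply.
apply: (@le_lt_trans _ _ (C ^+ m * rho ^+ N)).
  apply: (@le_trans _ _ ((rho ^+ m.+1) ^+ N * (N.+1)%:R ^+ m)).
    apply: ler_pM; rewrite ?exprn_ge0 ?(ltW r0) //.
      by rewrite -(pmulr_rge0 _ (exprn_gt0 N r0)) (le_trans ler01).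
    by rewrite lerXn2r ?nnegrE ?exprn_ge0 ?(ltW r0).
  rewrite -exprM mulSn exprD mulnC exprM -mulrA -exprMn [leRHS]mulrC.
  rewrite ler_wpM2l ?exprn_ge0 // lerXn2r ?nnegrE ?(ltW C0) //.
    by rewrite mulr_ge0 ?exprn_ge0.
  by rewrite mulrC expn_mul_bounded.
apply: (@le_lt_trans _ _ (C ^+ m * ((C ^+ m)^-1 / 2))).
  by rewrite ler_wpM2l // exprn_ge0 // ltW.
by rewrite mulrA divff ?gt_eqF ?exprn_gt0 // mul1r invf_lt1 // ltr1n.
Qed.

Variable Gam : zmodType.
Implicit Types (s F : seq Gam) (j x : Gam).

Definition box s N : seq Gam :=
  undup [seq \sum_(i < size s) s`_i *+ f i | f : {ffun 'I_(size s) -> 'I_N.+1}].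

Lemma boxP s N x :
  reflect (exists f : {ffun 'I_(size s) -> 'I_N.+1}, x = \sum_(i < size s) s`_i *+ f i)
    (x \in box s N).
Proof.
rewrite mem_undup; apply: (iffP mapP) => [[f _ ->]|[f ->]]; exists f => //.
by rewrite mem_enum.
Qed.

Lemma size_box s N : (size (box s N) <= N.+1 ^ size s)%N.
Proof.
rewrite (leq_trans (size_undup _)) // size_map -cardE.
by rewrite card_ffun !card_ord.
Qed.

Lemma box0 s N : 0 \in box s N.
Proof.
by apply/boxP; exists [ffun=> ord0]; rewrite big1 // => i _; rewrite ffunE.
Qed.

Lemma box_shift s N j x : j \in s -> x \in box s N ->
  (x \in box s N.+1) && (x + j \in box s N.+1).
Proof.
move=> js /boxP[f ->]; apply/andP; split; apply/boxP.
  exists [ffun i => widen_ord (leqnSn N.+1) (f i)].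
  by apply: eq_bigr => i _; rewrite ffunE.
have ks : (index j s < size s)%N by rewrite index_mem.
pose k := Ordinal ks.
exists [ffun i => inord (f i + (i == k))%N].
have fk : (f k + 1 < N.+2)%N by rewrite addn1 ltnS ltn_ord.
rewrite (bigD1 k) //= [in RHS](bigD1 k) //= ffunE eqxx (inordK fk) addn1.
rewrite mulrSr nth_index // addrAC; congr (_ + _).
apply: eq_bigr => i /negbTE ik; rewrite ffunE ik addn0 inordK //.
by rewrite ltnS ltnW.
Qed.

(** Translating a box by a generator lands in the next box, and box sizes grow polynomially; so for
    some N the boxes of index N and N + 1 have almost the same size, and the larger one is F. *)
Lemma folner s (eta : R) : 0 < eta -> exists F, [/\ uniq F, F != [::] &
  forall j, j \in s -> (1 - eta) * (size F)%:R <= (count (fun x => x - j \in F) F)%:R].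
Proof.
(* The maximum with 1/2 keeps r positive when eta >= 1. *)
move=> eta0; pose r := Num.max (1 - eta) 2^-1.
have r01 : 0 < r < 1.
  apply/andP; split; first by rewrite lt_max invr_gt0 ltr0n orbT.
  by rewrite gt_max invf_lt1 // ltr1n andbT ltrBlDr ltrDl.
have [|N|N rN] := @polynomial_growth (fun N => (size (box s N))%:R) (size s) r r01.
- rewrite ler1n lt0n size_eq0; apply/eqP => b0.
  by have := box0 s 0; rewrite b0.
- by rewrite -natrX ler_nat size_box.
exists (box s N.+1); split=> [||j js].
- exact: undup_uniq.
- by apply/eqP => b0; have := box0 s N.+1; rewrite b0.
apply: (@le_trans _ _ (size (box s N))%:R).
  by apply: le_trans rN; rewrite ler_wpM2r // le_max lexx.
rewrite ler_nat -size_filter -(size_map (fun x => x + j)).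
apply: uniq_leq_size => [|y /mapP[x /(box_shift js)/andP[xb xjb] ->]].
  by rewrite map_inj_uniq ?undup_uniq //; exact: addIr.
by rewrite mem_filter addrK xb.
Qed.

End Folner.

(** * Fejer kernels of finite sets of characters *)

Section Kernel.
Context (R : realType) (G : topologicalType) (Gam : zmodType)
  (ev : characters R G Gam) (I : mean ev).
Implicit Types (S : set Gam) (a b : G -> R[i]) (g h : G).

Definition trig (s : seq (R[i] * Gam)) g : R[i] := \sum_(p <- s) p.1 * ev p.2 g.

Lemma conj_char j g : (ev j g)^* = ev (- j) g.
Proof.
rewrite charN; have e1 : `|ev j g| = 1 by rewrite modcE char_mod.
have e0 : ev j g != 0 by rewrite -normr_eq0 e1 oner_eq0.
by apply: (mulfI e0); rewrite divff // -normCK e1 expr1n.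
Qed.

Lemma ccont_trig s : ccontinuous (trig s).
Proof.
apply: ccont_sum => p; exact: (ccontM (@ccont_cst R G p.1) (mean_char_cont I p.2)).
Qed.

Section FolnerKernel.
Variable F : seq Gam.
Hypotheses (uF : uniq F) (F0 : F != [::]).

Let c : R[i] := (size F)%:R^-1.

(** The Fejer kernel |F|^-1 |sum over x in F of <x, g - h>|^2, expanded because G is only a
    topological space here. *)
Definition kernel g h : R[i] :=
  c * \sum_(x <- F) \sum_(y <- F) ev (x - y) g * ev (y - x) h.

Lemma kernel_ge0 g h : 0 <= kernel g h.
Proof.
rewrite /kernel mulr_ge0 ?invr_ge0 ?ler0n //.
pose z := \sum_(x <- F) ev x g * ev (- x) h.
rewrite (_ : \sum_(x <- F) _ = z * z^*); first exact: mul_conjC_ge0.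
rewrite mulr_suml; apply: eq_bigr => x _; rewrite rmorph_sum mulr_sumr.
apply: eq_bigr => y _; rewrite rmorphM /= !conj_char opprK !char_valD; ring.
Qed.

Lemma ccont_kernel g : ccontinuous (kernel g).
Proof.
apply: (ccontM (@ccont_cst R G c)); apply: ccont_sum => x; apply: ccont_sum => y.
exact: (ccontM (@ccont_cst R G (ev (x - y) g)) (mean_char_cont I (y - x))).
Qed.

Definition smoothing a g : R[i] := I (fun h => a h * kernel g h).

Lemma smoothingE a g : ccontinuous a -> smoothing a g =
  c * \sum_(x <- F) \sum_(y <- F) ev (x - y) g * I (fun h => a h * ev (y - x) h).
Proof.
move=> ca.
have cxy x y : ccontinuous (fun h => ev (x - y) g * (a h * ev (y - x) h)).
  exact: (ccontM (@ccont_cst R G (ev (x - y) g)) (ccontM ca (mean_char_cont I (y - x)))).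
have -> : smoothing a g = I (fun h => c *
    \sum_(x <- F) \sum_(y <- F) ev (x - y) g * (a h * ev (y - x) h)).
  congr (mean_val I _); apply/funext => h; rewrite /kernel mulrCA; congr (_ * _).
  rewrite mulr_sumr; apply: eq_bigr => x _; rewrite mulr_sumr; apply: eq_bigr => y _.
  by rewrite mulrCA.
rewrite meanZ; last by apply: ccont_sum => x; apply: ccont_sum => y; exact: cxy.
congr (_ * _); rewrite mean_sum => [|x]; last by apply: ccont_sum => y; exact: cxy.
apply: eq_bigr => x _; rewrite mean_sum => [|y]; last exact: cxy.
apply: eq_bigr => y _.
exact: (meanZ I (ev (x - y) g) (ccontM ca (mean_char_cont I (y - x)))).
Qed.

Definition multiplicity j : nat := count (fun x => x - j \in F) F.

(** Each character is an eigenfunction. Its eigenvalue is the proportion of F that stays in F under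
    translation, close to 1 for a Folner set. *)
Lemma smoothing_char j g : smoothing (ev j) g = (c * (multiplicity j)%:R) * ev j g.
Proof.
rewrite smoothingE; last exact: mean_char_cont.
rewrite -mulrA; congr (_ * _); rewrite /multiplicity -sum1_count natr_sum mulr_suml.
rewrite [RHS]big_mkcond /=; apply: eq_bigr => x _.
have E y : ev (x - y) g * I (fun h => ev j h * ev (y - x) h) =
    if y == x - j then ev j g else 0.
  rewrite (_ : (fun h => _) = ev (j + (y - x))); last by apply/funext => h; rewrite char_valD.
  rewrite mean_char addrCA -[_ + _ == 0]subr_eq0 subr0 -[j - x]opprB subr_eq0.
  by case: eqP => [->|_]; rewrite ?mulr0 // subKr mulr1.
under eq_bigr do rewrite E.
rewrite -big_mkcond /=; case: ifP => xF; last first.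
  rewrite big_seq_cond big1 // => y /andP[yF /eqP yx].
  by move: xF; rewrite -yx yF.
rewrite big_const_seq.
have -> : count (fun y => y == x - j) F = 1%N by rewrite count_uniq_mem // xF.
by rewrite /= addr0 mul1r.
Qed.

Lemma mean_kernel g : I (kernel g) = 1.
Proof.
have := smoothing_char 0 g; rewrite /smoothing char0.
rewrite (_ : (fun h => _) = kernel g); last by apply/funext => h; rewrite char0 mul1r.
move=> ->; rewrite /multiplicity.
have -> : count (fun x => x - 0 \in F) F = size F.
  by apply/eqP; rewrite -all_count; apply/allP => x; rewrite subr0.
by rewrite mulr1 mulVf // pnatr_eq0 size_eq0.
Qed.

Lemma smoothing_bound a (e : R) g : ccontinuous a -> (forall h, modc (a h) <= e) ->
  modc (smoothing a g) <= 2 * e.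
Proof.
move=> ca ae; have := mean_weight I ca (@ccont_kernel g) (kernel_ge0 g) ae.
by rewrite mean_kernel mulr1.
Qed.

End FolnerKernel.

Lemma modc_real (r : R) : modc r%:C%C = `|r|.
Proof. by rewrite /modc normc_def /= expr0n addr0 sqrtr_sqr. Qed.

(** Smoothing a yields a trigonometric polynomial whose coefficients are multiples of those of a, so
    its frequencies lie in S. It is close to a because smoothing is uniformly bounded and almost
    fixes some approximant s of arbitrary spectrum. *)
Lemma spectral_synthesis S a : ccontinuous a ->
  (forall e : R, 0 < e -> exists s, forall g, modc (a g - trig s g) <= e) ->
  (forall j, I (fun g => a g * ev (- j) g) != 0 -> S j) ->
  forall e : R, 0 < e -> exists s,
    (forall p, p \in s -> S p.2) /\ forall g, modc (a g - trig s g) <= e.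
Proof.
move=> ca aP aS e e0; have e4 : 0 < e / 4 by rewrite divr_gt0.
have [s sP] := aP _ e4.
pose C := \sum_(p <- s) modc p.1.
have C0 : 0 <= C by apply: sumr_ge0 => p _; exact: modc_ge0.
have C1 : 0 < C + 1 by rewrite ltr_wpDl.
(* C is the sum of the moduli of the coefficients of s, so smoothing moves [trig s] by at most C eta
   <= e / 4. With e / 4 for a - s and 2 (e / 4) for its smoothing, the total is e. *)
have eta0 : 0 < e / (4 * (C + 1)) by rewrite divr_gt0 // mulr_gt0.
have [F [uF F0 HF]] := folner (map snd s) eta0.
set eta := e / _ in eta0 HF.
have F1 : 0 < (size F)%:R :> R by rewrite ltr0n lt0n size_eq0.
pose q x y : R[i] * Gam := ((size F)%:R^-1 * I (fun h => a h * ev (y - x) h), x - y).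
(* Terms with zero coefficient are dropped: only the frequencies of the others are known to lie in
   S. *)
pose t := [seq p <- [seq q x y | x <- F, y <- F] | p.1 != 0].
exists t; split=> [p|g].
  rewrite mem_filter => /andP[p0 /allpairsP[[x y] /= [_ _ ep]]].
  apply: aS; move: p0; rewrite ep /= opprB.
  by apply: contra_neq => ->; rewrite mulr0.
have tE : trig t g = smoothing F a g.
  rewrite smoothingE // /trig big_filter big_mkcond /= big_allpairs_dep /= mulr_sumr.
  apply: eq_bigr => x _; rewrite mulr_sumr; apply: eq_bigr => y _ /=.
  case: eqP => [q0|_]; first by rewrite mulrCA q0 mulr0.
  by rewrite -mulrA [_ * ev _ _]mulrC.
have cD : ccontinuous (fun h => a h - trig s h) := ccontB ca (@ccont_trig s).
have D : smoothing F a g = smoothing F (fun h => a h - trig s h) g +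
    \sum_(p <- s) p.1 * smoothing F (ev p.2) g.
  have -> : \sum_(p <- s) p.1 * smoothing F (ev p.2) g = smoothing F (trig s) g.
    rewrite /smoothing.
    have cp p : ccontinuous (fun h => p.1 * (ev p.2 h * kernel F g h)).
      exact: (ccontM (@ccont_cst R G p.1) (ccontM (mean_char_cont I p.2) (@ccont_kernel F g))).
    transitivity (I (fun h => \sum_(p <- s) p.1 * (ev p.2 h * kernel F g h))).
      rewrite mean_sum; last exact: cp.
      apply: eq_bigr => p _; apply/esym.
      exact: (meanZ I p.1 (ccontM (mean_char_cont I p.2) (@ccont_kernel F g))).
    congr (mean_val I _); apply/funext => h; rewrite /trig mulr_suml.
    by apply: eq_bigr => p _; rewrite mulrA.
  rewrite /smoothing -meanD.
  - by congr (mean_val I _); apply/funext => h; rewrite -mulrDl subrK.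
  - exact: (ccontM cD (@ccont_kernel F g)).
  - exact: (ccontM (@ccont_trig s) (@ccont_kernel F g)).
pose m j : R := (multiplicity F j)%:R / (size F)%:R.
have mE j : smoothing F (ev j) g = (m j)%:C%C * ev j g.
  rewrite smoothing_char // [_^-1 * _]mulrC /m rmorphM fmorphV !rmorph_nat //.
have m1 j : j \in map snd s -> `|1 - m j| <= eta.
  move=> /HF h; rewrite ger0_norm; last first.
    rewrite subr_ge0 ler_pdivrMr // mul1r ler_nat; exact: count_size.
  by rewrite lerBlDr addrC -lerBlDr ler_pdivlMr.
have E2 : modc (\sum_(p <- s) p.1 * smoothing F (ev p.2) g - trig s g) <= e / 4.
  rewrite -sumrB (le_trans (modc_sum _ _ _)) //.
  apply: (@le_trans _ _ (\sum_(p <- s) modc p.1 * eta)).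
    rewrite big_seq [leRHS]big_seq; apply: ler_sum => p ps.
    have -> : p.1 * smoothing F (ev p.2) g - p.1 * ev p.2 g =
        - (p.1 * (1 - m p.2)%:C%C * ev p.2 g) by rewrite mE rmorphB /=; ring.
    rewrite modcN !modcM char_mod mulr1 modc_real ler_wpM2l ?modc_ge0 //.
    by apply: m1; apply: map_f.
  rewrite -mulr_suml -/C /eta mulrA ler_pdivrMr ?mulr_gt0 //.
  have -> : e / 4 * (4 * (C + 1)) = (C + 1) * e by field.
  by rewrite ler_wpM2r ?(ltW e0) // lerDl.
have E3 := smoothing_bound uF F0 g cD sP.
rewrite tE D.
set A := smoothing F _ g in E3 *; set B := \sum_(p <- s) _ in E2 *.
have -> : a g - (A + B) = (a g - trig s g) - A - (B - trig s g) by ring.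
have -> : e = e / 4 + 2 * (e / 4) + e / 4 by field.
rewrite (le_trans (modcB _ _)) // lerD // (le_trans (modcB _ _)) // lerD //.
Qed.

End Kernel.

(** * Haar measure *)

Section HaarMean.
Context (R : realType) (G : topologicalZmodType).
Hypothesis G_compact : compact [set: G].
Variable mu : probability (borel G) R.
Implicit Types (f k : G -> R[i]) (r : G -> R).

Lemma real_continuous_measurable r : continuous r ->
  measurable_fun [set: borel G] (r : borel G -> R).
Proof.
move=> /continuousP cr; apply: (measurability _ (RGenOpens.measurableE R)).
move=> _ [_ [a [b ->] <-]]; rewrite setTI.
by apply: sub_sigma_algebra; apply: (cr `]a, b[%classic); exact: interval_open.
Qed.

Lemma real_continuous_integrable r : continuous r ->
  mu.-integrable setT (EFin \o (r : borel G -> R)).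
Proof.
move=> cr; apply: measurable_bounded_integrable => //.
- by rewrite (le_lt_trans (probability_le1 mu measurableT)) // ltry.
- exact: real_continuous_measurable.
have := continuous_compact (continuous_subspaceT cr) G_compact.
move=> /compact_bounded[M [Mreal MP]]; exists M; split=> // x Mx g _.
by apply: MP => //; exists g.
Qed.

Lemma normc_le_Re_Im (z : R[i]) :
  modc z <= `|complex.Re z| + `|complex.Im z|.
Proof.
rewrite /modc normc_def /= -(ger0_norm (addr_ge0 (normr_ge0 (complex.Re z))
  (normr_ge0 (complex.Im z)))) -sqrtr_sqr ler_wsqrtr // sqrrD !real_normK ?num_real //.
by rewrite addrAC lerDl mulrn_wge0 // mulr_ge0.
Qed.

Lemma Re_le_modc (z : R[i]) : `|complex.Re z| <= modc z.
Proof.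
by rewrite /modc normc_def /= -sqrtr_sqr ler_wsqrtr // lerDl sqr_ge0.
Qed.

Lemma Im_le_modc (z : R[i]) : `|complex.Im z| <= modc z.
Proof.
by rewrite /modc normc_def /= -sqrtr_sqr ler_wsqrtr // lerDr sqr_ge0.
Qed.

Lemma ccont_Re f : ccontinuous f -> continuous (fun g => complex.Re (f g)).
Proof.
move=> cf x; apply/cvgrPdist_le => e e0.
have /(@cvgrPdist_le _ R[i]^o) /(_ e%:C%C) := cf x; rewrite ltcR => /(_ e0).
apply: filterS => y; rewrite [`|_|]modcE lecR; apply: le_trans.
by rewrite -raddfB Re_le_modc.
Qed.

Lemma ccont_Im f : ccontinuous f -> continuous (fun g => complex.Im (f g)).
Proof.
move=> cf x; apply/cvgrPdist_le => e e0.
have /(@cvgrPdist_le _ R[i]^o) /(_ e%:C%C) := cf x; rewrite ltcR => /(_ e0).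
apply: filterS => y; rewrite [`|_|]modcE lecR; apply: le_trans.
by rewrite -raddfB Im_le_modc.
Qed.

Definition rint r : R := Rintegral mu setT (r : borel G -> R).

Definition cint f : R[i] :=
  Complex (rint (fun g => complex.Re (f g))) (rint (fun g => complex.Im (f g))).

Lemma rintD r s : continuous r -> continuous s ->
  rint (fun g => r g + s g) = rint r + rint s.
Proof. by move=> cr cs; apply: RintegralD => //; exact: real_continuous_integrable. Qed.

Lemma rintZ a r : continuous r -> rint (fun g => a * r g) = a * rint r.
Proof. by move=> cr; apply: RintegralZl => //; exact: real_continuous_integrable. Qed.

Lemma rint_le r s : continuous r -> continuous s -> (forall g, r g <= s g) ->
  rint r <= rint s.
Proof.
by move=> cr cs rs; apply: le_Rintegral => //; exact: real_continuous_integrable.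
Qed.

Lemma rint_cst a : rint (fun=> a) = a.
Proof.
rewrite /rint Rintegral_cst; last exact: measurableT.
rewrite [X in fine X](_ : _ = 1%E); last exact: probability_setT.
by rewrite mulr1.
Qed.

(** Change of variables along the translation, whose pushforward of mu agrees with mu on measurable
    sets by invariance. *)
Lemma rint_translation r h : is_haar mu -> continuous r ->
  rint (fun g => r (g + h)) = rint r.
Proof.
move=> [inv _] cr; pose tau (g : borel G) : borel G := (g : G) + h.
have ctau : continuous (fun g : G => g + h).
  move=> g; apply: (@continuous2_cvg _ G G G _ _ id (fun=> h) +%R g h).
  - exact: (@tvs.add_continuous G (g, h)).
  - exact: cvg_id.
  - exact: cvg_cst.
have mtau : measurable_fun [set: borel G] tau.
  apply: (@measurability _ _ _ _ setT tau (@open (pgroup G)) erefl) => _ [A oA <-].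
  rewrite setTI.
  by apply: sub_sigma_algebra; move/continuousP: ctau; exact.
have crt : continuous (fun g => r (g + h)).
  by move=> g; exact: (continuous_comp (ctau g) (cr _)).
rewrite /rint /Rintegral; congr fine.
have mr : measurable_fun [set: borel G] (EFin \o (r : borel G -> R)).
  by apply/measurable_EFinP; exact: real_continuous_measurable.
have it : mu.-integrable (tau @^-1` setT) ((EFin \o (r : borel G -> R)) \o tau).
  exact: (real_continuous_integrable crt).
have := integral_pushforward mtau mr it measurableT; rewrite preimage_setT => <-.
apply: eq_measure_integral => A mA _; rewrite /pushforward.
exact: inv.
Qed.

Lemma cintD f k : ccontinuous f -> ccontinuous k ->
  cint (fun g => f g + k g) = cint f + cint k.
Proof.
move=> cf ck; apply/eqP; rewrite eq_complex /= -!rintD;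
  [|exact: ccont_Im|exact: ccont_Im|exact: ccont_Re|exact: ccont_Re].
by apply/andP; split; apply/eqP; congr rint; apply/funext => g; rewrite raddfD.
Qed.

Lemma cintZ c f : ccontinuous f -> cint (fun g => c * f g) = c * cint f.
Proof.
move=> cf; have cr := ccont_Re cf; have ci := ccont_Im cf.
have cZ a r : continuous r -> continuous (fun g => a * r g).
  by move=> cr' x; apply: cvgM; [exact: cvg_cst|exact: cr'].
case: c => a b; apply/eqP; rewrite eq_complex /=; apply/andP; split; apply/eqP.
  transitivity (rint (fun g => a * complex.Re (f g) + (- b) * complex.Im (f g))).
    by congr rint; apply/funext => g; case: (f g) => x y /=; rewrite mulNr.
  by rewrite rintD ?rintZ ?mulNr //; exact: cZ.
transitivity (rint (fun g => a * complex.Im (f g) + b * complex.Re (f g))).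
  by congr rint; apply/funext => g; case: (f g).
by rewrite rintD ?rintZ //; exact: cZ.
Qed.

Lemma cint_weight f k (e : R) : ccontinuous f -> ccontinuous k ->
  (forall g, 0 <= k g) -> (forall g, modc (f g) <= e) ->
  modc (cint (fun g => f g * k g)) <= 2 * e * complex.Re (cint k).
Proof.
move=> cf ck k0 fe; have cfk := ccontM cf ck.
have crk : continuous (fun g => e * complex.Re (k g)).
  by move=> x; apply: cvgM; [exact: cvg_cst|exact: (ccont_Re ck)].
have kE g : modc (f g * k g) <= e * complex.Re (k g).
  rewrite modcM; have := k0 g; rewrite lecE /= => /andP[/eqP ik rk].
  have -> : modc (k g) = complex.Re (k g).
    by rewrite /modc normc_def /= ik expr0n addr0 sqrtr_sqr ger0_norm.
  by rewrite ler_wpM2r.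
have bound r : continuous r -> (forall g, `|r g| <= modc (f g * k g)) ->
    `|rint r| <= e * rint (fun g => complex.Re (k g)).
  move=> cr rle; rewrite -rintZ; last exact: ccont_Re.
  have cN : continuous (fun g => - (e * complex.Re (k g))).
    by move=> x; apply: cvgN; exact: crk.
  rewrite ler_norml; apply/andP; split.
    have -> : - rint (fun g => e * complex.Re (k g)) =
        rint (fun g => - (e * complex.Re (k g))).
      by rewrite -mulN1r -rintZ //; congr rint; apply/funext => g; rewrite mulN1r.
    apply: rint_le => // g; have := le_trans (rle g) (kE g).
    by rewrite ler_norml => /andP[].
  apply: rint_le => // g; have := le_trans (rle g) (kE g).
  by rewrite ler_norml => /andP[].
rewrite (le_trans (normc_le_Re_Im _)) //= -mulrA mulr_natl mulr2n lerD //.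
  by apply: bound => [|g]; [exact: ccont_Re|exact: Re_le_modc].
by apply: bound => [|g]; [exact: ccont_Im|exact: Im_le_modc].
Qed.

Lemma cint_translation f h : is_haar mu -> ccontinuous f ->
  cint (fun g => f (g + h)) = cint f.
Proof.
move=> hmu cf; congr Complex.
  exact: (rint_translation h hmu (ccont_Re cf)).
exact: (rint_translation h hmu (ccont_Im cf)).
Qed.

Section Dual.
Context (Gam : zmodType) (ev : Gam -> G -> R[i]) (ev_dual : character_group ev).
Hypothesis mu_haar : is_haar mu.

Lemma dual_mod j g : modc (ev j g) = 1.
Proof. by case: ev_dual => chi _ _ _; have [_ e1 _] := chi j; rewrite /modc e1. Qed.

Definition dual_characters : characters R G Gam :=
  Characters (let: And4 _ evD _ _ := ev_dual in evD) dual_mod.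

Lemma dual_cont j : ccontinuous (ev j).
Proof. by case: ev_dual => chi _ _ _; case: (chi j). Qed.

(** A nontrivial character takes a value <j, h> other than 1, and translation by h multiplies its
    mean by that value. *)
Lemma cint_char j : cint (ev j) = (j == 0)%:R.
Proof.
case: ev_dual => chi evD evI _; have ev0 := char0 dual_characters.
have [->|j0] := eqVneq j 0.
  have -> : ev 0 = fun=> 1 by apply/funext => g; exact: ev0.
  by rewrite /cint /= !rint_cst.
have [h hj] : exists h, ev j h != 1.
  apply: contrapT => no; move/eqP: j0; apply; apply: evI; apply/funext => g.
  by rewrite [RHS]ev0; apply/eqP; apply: contrapT => ng; apply: no; exists g; apply/negP.
have [_ _ jM] := chi j.
have := cint_translation h mu_haar (dual_cont (j := j)).
rewrite (_ : (fun g => _) = fun g => ev j h * ev j g); last first.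
  by apply/funext => g; rewrite jM mulrC.
rewrite cintZ; last exact: dual_cont.
move/eqP; rewrite -subr_eq0 -{2}[cint _]mul1r -mulrBl mulf_eq0 subr_eq0 (negbTE hj).
by move/eqP.
Qed.

Definition haar_mean : mean dual_characters :=
  @Mean R G Gam dual_characters cint dual_cont cintD cintZ cint_weight cint_char.

End Dual.
End HaarMean.

(** * Banach algebras of continuous functions *)

Section BanachAlgebra.
Context (R : realType) (G : topologicalType) (B : funBanach R G).
Implicit Types (a b x y : B).

Lemma fbvalM x y g : fbval (x * y) g = fbval x g * fbval y g.
Proof. exact: fb_valM. Qed.

Lemma fbval1 g : fbval (1 : B) g = 1.
Proof. exact: fb_val1. Qed.

Lemma fbval0 g : fbval (0 : B) g = 0.
Proof. by rewrite /fbval linear0. Qed.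

Lemma fbvalB x y g : fbval (x - y) g = fbval x g - fbval y g.
Proof. by rewrite /fbval linearB. Qed.

Lemma fbvalN x g : fbval (- x) g = - fbval x g.
Proof. by rewrite /fbval linearN. Qed.

Lemma fbvalZ (c : R[i]) x g : fbval (c *: x) g = c * fbval x g.
Proof. by rewrite /fbval linearZ. Qed.

Lemma fbval_sum (T : Type) (r : seq T) (P : pred T) (F : T -> B) g :
  fbval (\sum_(t <- r | P t) F t) g = \sum_(t <- r | P t) fbval (F t) g.
Proof.
by apply: (big_morph (fun x : B => fbval x g)) => [x y|]; [exact: fbvalD|exact: fbval0].
Qed.

Lemma fbval_prod (T : Type) (r : seq T) (P : pred T) (F : T -> B) g :
  fbval (\prod_(t <- r | P t) F t) g = \prod_(t <- r | P t) fbval (F t) g.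
Proof.
by apply: (big_morph (fun x : B => fbval x g)) => [x y|]; [exact: fbvalM|exact: fbval1].
Qed.

Definition bnorm x : R := complex.Re `|x|.

Lemma bnormE x : `|x| = (bnorm x)%:C%C.
Proof.
rewrite /bnorm; have := normr_ge0 x; case: `|x| => u v.
by rewrite lecE /= => /andP[/eqP -> _].
Qed.

Lemma bnorm_ge0 x : 0 <= bnorm x.
Proof. by rewrite -ler0c -bnormE. Qed.

Lemma bnormD x y : bnorm (x + y) <= bnorm x + bnorm y.
Proof. by rewrite -lecR rmorphD /= -!bnormE ler_normD. Qed.

Lemma bnormN x : bnorm (- x) = bnorm x.
Proof. by rewrite /bnorm normrN. Qed.

Lemma bnormM x y : bnorm (x * y) <= bnorm x * bnorm y.
Proof. by rewrite -lecR rmorphM /= -!bnormE; exact: fb_normM. Qed.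

Lemma bnormZ (c : R[i]) x : bnorm (c *: x) = modc c * bnorm x.
Proof. by apply: complexI; rewrite rmorphM /= -!bnormE -modcE normrZ. Qed.

Lemma bnorm_eq0 x : bnorm x = 0 -> x = 0.
Proof. by move=> x0; apply/normr0_eq0; rewrite bnormE x0. Qed.

(** b is the quasi-inverse of a, formally (1 - a)^-1 - 1. Iterating x -> a + a x involves no norm of
    the unit, which may differ from 1. *)
Lemma neumann_fixpoint a : bnorm a < 1 -> exists b, b = a + a * b.
Proof.
move=> a1; set r := bnorm a in a1; have r0 : 0 <= r := bnorm_ge0 a.
pose f x := a + a * x; pose u n := iter n f 0.
(* The solution of C = r + r C, hence a bound for all iterates. *)
pose C := r / (1 - r).
have C0 : 0 <= C by rewrite divr_ge0 // subr_ge0 ltW.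
have CE : r + r * C = C by rewrite /C; field; rewrite subr_eq0 gt_eqF.
have fB x y : bnorm (f x - f y) <= r * bnorm (x - y).
  by rewrite /f opprD addrACA subrr add0r -mulrBr bnormM.
have uC k : bnorm (u k) <= C.
  elim: k => [|k IH]; first by rewrite /u /= /bnorm normr0.
  rewrite -CE (le_trans (bnormD _ _)) // lerD // (le_trans (bnormM _ _)) //.
  by rewrite ler_wpM2l.
have udist N k : bnorm (u (N + k)%N - u N) <= r ^+ N * C.
  elim: N => [|N IH]; first by rewrite add0n mul1r subr0.
  by rewrite addSn exprS -mulrA (le_trans (fB _ _)) // ler_wpM2l.
have small (e : R) : 0 < e -> exists N, forall k, bnorm (u (N + k)%N - u N) < e.
  move=> e0; have e1 : 0 < e / (C + 1) / 2 by rewrite !divr_gt0 // ltr_wpDl.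
  have r01 : 0 <= r < 1 by rewrite r0.
  have [N rN] := exp_small r01 e1; exists N => k.
  apply: le_lt_trans (udist N k) _; apply: (@le_lt_trans _ _ (e / (C + 1) / 2 * C)).
    by rewrite ler_wpM2r.
  have C1 : 0 < C + 1 by rewrite ltr_wpDl.
  have -> : e / (C + 1) / 2 * C = e * (C / (C + 1) / 2) by field; rewrite gt_eqF.
  rewrite gtr_pMr // ltr_pdivrMr // mul1r ltr_pdivrMr //; lra.
have cu : cvgn u.
  apply/cauchy_cvgP/cauchy_exP => _ /ltcR_Re[e e0 ->].
  have [N uN] := small e e0; exists (u N); exists N => // n /= Nn.
  rewrite -ball_normE /= -[n](subnKC Nn) -normrN opprB bnormE ltcR; exact: uN.
pose b := limn u; exists b.
have lim (e : R) : 0 < e -> exists n, bnorm (b - u n) <= e /\ bnorm (b - u n.+1) <= e.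
  move=> e0; have /cvgrPdist_le /(_ e%:C%C) := cu; rewrite ltcR => /(_ e0)[N _ uN].
  exists N; split; rewrite -lecR -bnormE; apply: uN => //=.
apply/eqP; rewrite -subr_eq0; apply/eqP/bnorm_eq0/eqP; rewrite eq_le bnorm_ge0 andbT leNgt.
apply/negP => d0; have d4 : 0 < bnorm (b - (a + a * b)) / 4 by rewrite divr_gt0.
have [n [un un1]] := lim _ d4.
have : bnorm (b - f b) <= bnorm (b - u n.+1) + r * bnorm (b - u n).
  have -> : b - f b = (b - u n.+1) - (f b - f (u n)) by rewrite opprB addrA subrK.
  by rewrite (le_trans (bnormD _ _)) // bnormN lerD.
rewrite -/(f b) in d0 un un1 *.
have : r * bnorm (b - u n) <= 1 * bnorm (b - u n).
  by rewrite ler_wpM2r ?bnorm_ge0 // ltW.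
lra.
Qed.

(* Otherwise c^-1 a has norm less than 1 and value 1 at g, and the solution b of
   b = a + a b would satisfy b(g) = 1 + b(g). *)
Lemma modc_fbval_le a g : modc (fbval a g) <= bnorm a.
Proof.
rewrite leNgt; apply/negP => ag; pose c := fbval a g.
have c0 : 0 < modc c by rewrite (le_lt_trans (bnorm_ge0 a)).
have cn0 : c != 0 by apply: contraTneq c0 => ->; rewrite modc0 ltxx.
have cV : modc c^-1 = (modc c)^-1.
  by apply: (mulfI (x := modc c)); rewrite ?gt_eqF // divff ?gt_eqF // -modcM divff // modc1.
have a1 : bnorm (c^-1 *: a) < 1 by rewrite bnormZ cV ltr_pdivrMl // mulr1.
have [b bE] := neumann_fixpoint a1.
have := congr1 (fun x : B => fbval x g) bE.
rewrite fbvalD fbvalM fbvalZ mulVf // mul1r => /eqP.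
by rewrite -subr_eq0 opprD addrCA subrr addr0 oppr_eq0 oner_eq0.
Qed.

End BanachAlgebra.

(** * Extension of homomorphisms into vector spaces *)

Section Extension.
Context (Gam : zmodType) (K : numFieldType) (V : lmodType K).
Implicit Types (X : set (Gam * V)).

Definition sub_closed X := forall p q, X p -> X q -> X (p - q).
(** Together with [sub_closed] and 0 in X, this makes X the graph of a homomorphism from a subgroup
    of Gam to V. *)
Definition functional X := forall v, X (0, v) -> v = 0.

Lemma sub_closedMz X p k : sub_closed X -> X p -> X (p *~ k).
Proof.
move=> sX Xp; have X0 : X 0 by rewrite -(subrr p); exact: sX.
have XN q : X q -> X (- q) by move=> Xq; rewrite -sub0r; exact: sX.
have Xn n : X (p *+ n).
  elim: n => [//|n IH]; rewrite mulrS -[p *+ n]opprK; apply: (sX) => //; exact: XN.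
by case: k => n; [exact: Xn|exact: XN].
Qed.

Lemma pair_mulrz (x : Gam) (v : V) k : (x, v) *~ k = (x *~ k, v *~ k).
Proof.
have Mn n : (x, v) *+ n = (x *+ n, v *+ n) by elim: n => // n IH; rewrite !mulrS IH.
by case: k => n; rewrite ?NegzE ?mulrNz -!pmulrn Mn.
Qed.

(** V is divisible, so a partial homomorphism extends to any further element; Zorn's lemma on graphs
    does the rest. *)
Lemma additive_extension X : X 0 -> sub_closed X -> functional X ->
  exists d : {additive Gam -> V}, forall p, X p -> d p.1 = p.2.
Proof.
move=> X0 sX fX.
(* X is required only inside nonempty Y, because the union of the empty chain must satisfy P too. *)
pose P Y := [/\ sub_closed Y, functional Y & Y !=set0 -> X `<=` Y].
have [F FP Ftot|A [[sA fA XA] Amax]] := @Zorn_bigcup _ P.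
  split.
  - move=> p q [Y FY Yp] [Z FZ Zq]; have [YZ|ZY] := Ftot Y Z FY FZ.
      by exists Z => //; have [sZ _ _] := FP Z FZ; apply: sZ => //; exact: YZ.
    by exists Y => //; have [sY _ _] := FP Y FY; apply: sY => //; exact: ZY.
  - by move=> v [Y FY Yv]; have [_ fY _] := FP Y FY; exact: fY.
  - move=> [p [Y FY Yp]] q Xq; exists Y => //; have [_ _ XY] := FP Y FY.
    by apply: XY => //; exists p.
(* A maximal A cannot be empty, since X would extend it. *)
have {}XA : X `<=` A.
  apply: XA; apply: contrapT => A0; apply: (Amax X); last by split=> // _ p.
  split=> [p Ap|XA]; first by exfalso; apply: A0; exists p.
  by apply: A0; exists 0; exact: XA.
have A0 : A 0 by exact: XA.
have total x : exists v, A (x, v).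
  (* If some positive multiple of x already has a value w, the value of x is w divided by that
     multiple, and cross-multiplication shows that it fits all other multiples. Otherwise any value
     is allowed, and 0 is taken. *)
  have [v vP] : exists v : V, forall n w, A (x *+ n.+1, w) -> w = v *+ n.+1.
    have [[n [w nw]]|no] := pselect (exists n w, A (x *+ n.+1, w)); last first.
      by exists 0 => n w Aw; exfalso; apply: no; exists n, w.
    have n0 k : k.+1%:R != 0 :> K by rewrite pnatr_eq0.
    exists (n.+1%:R^-1 *: w) => m u Au.
    have : A ((x *+ m.+1, u) *~ n.+1 - (x *+ n.+1, w) *~ m.+1).
      by apply: (sA); exact: sub_closedMz.
    have -> : (x *+ m.+1, u) *~ n.+1 - (x *+ n.+1, w) *~ m.+1 =
        (0, u *+ n.+1 - w *+ m.+1).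
      by rewrite !pair_mulrz -!pmulrn -!mulrnA mulnC -[LHS]/(_ - _, _ - _) subrr.
    move=> /fA /eqP; rewrite subr_eq0 => /eqP e.
    rewrite -[RHS]scaler_nat scalerA mulrC -scalerA scaler_nat -e -[u *+ _]scaler_nat scalerA.
    by rewrite mulVf // scale1r.
  pose A' : set (Gam * V) := [set p | exists k q, A q /\ p = q + (x, v) *~ k].
  have AA' : A `<=` A' by move=> p Ap; exists 0, p; rewrite mulr0z addr0.
  have A'x : A' (x, v) by exists 1, 0; rewrite add0r mulr1z.
  apply: contrapT => no.
  apply: (Amax A'); first by split=> // A'A; apply: no; exists v; exact: A'A.
  split.
  - move=> p q [k [p' [Ap' ->]]] [l [q' [Aq' ->]]].
    by exists (k - l), (p' - q'); split; [exact: sA|rewrite mulrzBr opprD addrACA].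
  - move=> u [k [[y w] [Ayw]]] [].
    rewrite pair_mulrz.
    rewrite /= => /eqP; rewrite eq_sym addr_eq0 => /eqP yE uE.
    rewrite uE; rewrite {}yE in Ayw; case: k {u uE} Ayw => n.
      case: n => [|n]; first by rewrite mulr0z oppr0 mulr0z addr0; exact: fA.
      move=> /(sub_closedMz (-1) sA); rewrite mulrN1z.
      have -> : - (- (x *~ n.+1), w) = (x *+ n.+1, - w) by congr (_, _); rewrite /= opprK.
      by move=> /vP e; rewrite -pmulrn -e addrN.
    by rewrite NegzE mulrNz opprK -pmulrn => /vP ->; rewrite mulrNz -pmulrn addrN.
  - move=> _ p Xp; apply: AA'; exact: XA.
have /choice[d dP] := total.
have inj x u w : A (x, u) -> A (x, w) -> u = w.
  move=> Au Aw; apply/eqP; rewrite -subr_eq0; apply/eqP/fA.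
  by have := sA _ _ Au Aw; rewrite -[(x, u) - _]/(x - x, u - w) subrr.
have dB : zmod_morphism d.
  by move=> x y; apply: (inj (x - y)) => //; exact: (sA _ _ (dP x) (dP y)).
pose dm : {additive Gam -> V} := HB.pack d (GRing.isZmodMorphism.Build Gam V d dB).
exists dm => p Xp; apply: (inj p.1); first exact: dP.
by case: p Xp => x v; exact: XA.
Qed.

End Extension.

(** Injectivity of f makes the pairs (f z, z) a graph. The elements [gam k] are the images of the
    standard basis, and d is dual to them. *)
Lemma weights_Z3 (R : realType) (Gam : zmodType) : contains_Z3 Gam ->
  exists (d : {additive Gam -> 'rV[R[i]]_3}) (gam : 'I_3 -> Gam),
    forall k, d (gam k) = delta_mx 0 k.
Proof.
move=> [f finj]; pose X : set (Gam * 'rV[R[i]]_3) :=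
  [set p | exists z, p = (f z, map_mx intr z)].
have [|p q [z ->] [w ->]|v [z [e ->]]|d dX] := @additive_extension Gam _ _ X.
- by exists 0; rewrite raddf0; congr (_, _); apply/matrixP => i j; rewrite !mxE.
- exists (z - w); rewrite raddfB; congr (_, _).
  by apply/matrixP => i j; rewrite !mxE rmorphB.
- have -> : z = 0 by apply: finj; rewrite -e raddf0.
  by apply/matrixP => i j; rewrite !mxE.
exists d, (fun k => f (delta_mx 0 k)) => k.
have -> : d (f (delta_mx 0 k)) = map_mx intr (delta_mx 0 k).
  by apply: (dX (f (delta_mx 0 k), map_mx intr (delta_mx 0 k))); exists (delta_mx 0 k).
by apply/matrixP => i j; rewrite !mxE; case: (_ && _).
Qed.

(** * A matrix function of nonzero degree *)

Section SquareRootIteration.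
Variable R : realType.
Implicit Types a e : R.

(* The classical monotone iteration for |a|, together with q_n = a p_n'(a). *)
Definition abs_step a (pq : R * R) : R * R :=
  (pq.1 + (a ^+ 2 - pq.1 ^+ 2) / 2, (1 - pq.1) * pq.2 + a ^+ 2).

Definition abs_iter a n := iter n (abs_step a) (0, 0).

Lemma abs_iter_bounds a n : 0 <= a <= 1 ->
  [/\ 0 <= (abs_iter a n).1, (abs_iter a n).1 <= a, 0 <= (abs_iter a n).2 &
      (abs_iter a n).2 <= 2 * (abs_iter a n).1].
Proof.
move=> /andP[a0 a1]; elim: n => [|n [p0 pa q0 qp]]; first by split=> //=; lra.
rewrite /abs_iter iterS -/(abs_iter a n) /abs_step.
set p := (abs_iter a n).1 in p0 pa qp *; set q := (abs_iter a n).2 in q0 qp *.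
by split=> /=; rewrite ?expr2; nra.
Qed.

(** One step multiplies the error a - p by 1 - (a + p) / 2 <= 1 - a / 2. *)
Lemma abs_iter_dist a n : 0 <= a <= 1 ->
  a - (abs_iter a n).1 <= (1 - a / 2) ^+ n.
Proof.
move=> a01; have /andP[a0 a1] := a01.
elim: n => [|n IH]; first by rewrite /= subr0.
have [p0 pa _ _] := abs_iter_bounds n a01.
rewrite /abs_iter iterS -/(abs_iter a n) /abs_step [leRHS]exprS /=.
set p := (abs_iter a n).1 in p0 pa IH *.
have -> : a - (p + (a ^+ 2 - p ^+ 2) / 2) = (1 - (a + p) / 2) * (a - p) by field.
apply: (@le_trans _ _ ((1 - a / 2) * (a - p))).
  by rewrite ler_wpM2r ?subr_ge0 //; lra.
by rewrite ler_wpM2l //; lra.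
Qed.

(** For a <= e the bounds 0 <= p <= a and 0 <= q <= 2 p are enough. For a > e the error of p
    contracts by 1 - e / 2, and so does that of q, up to a small perturbation, once p is close to
    a. *)
Lemma abs_iter_uniform e : 0 < e -> exists n, forall a, 0 <= a <= 1 ->
  `|a - (abs_iter a n).1| <= e /\ `|a - (abs_iter a n).2| <= e.
Proof.
wlog e1 : e / e <= 1.
  move=> W e0; have m0 : 0 < Num.min e 1 by rewrite lt_min e0 ltr01.
  have [n Hn] := W _ (min_ler e 1) m0.
  exists n => a /Hn[h1 h2]; have := min_lel e 1.
  by move=> h; split; [exact: le_trans h1 h|exact: le_trans h2 h].
(* The perturbations of q, each at most eta, add up to eta / (1 - r) = e / 4. *)
move=> e0; pose r := 1 - e / 2; pose eta := e ^+ 2 / 8.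
have r01 : 0 <= r < 1 by rewrite /r; apply/andP; split; lra.
have eta0 : 0 < eta by rewrite divr_gt0 // exprn_gt0.
have [n1 Hn1] := exp_small r01 eta0.
have e2 : 0 < e / 2 by lra.
have [m Hm] := exp_small r01 e2.
exists (n1 + m)%N => a a01; have /andP[a0 a1] := a01.
have [p0 pa q0 qp] := abs_iter_bounds (n1 + m) a01.
have [ae|ea] := leP a e.
  by split; rewrite ler_norml; apply/andP; split; lra.
have /andP[r0 r1] := r01.
have y n : (n1 <= n)%N -> a - (abs_iter a n).1 <= eta.
  move=> n1n; apply: le_trans (abs_iter_dist n a01) _; apply: le_trans Hn1.
  apply: (@le_trans _ _ (r ^+ n)); last by rewrite ler_wiXn2l // ltW.
  by rewrite lerXn2r ?nnegrE // /r; lra.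
have etae : eta <= e / 8 by rewrite /eta expr2; nra.
have q_dist k : `|a - (abs_iter a (n1 + k)).2| <= r ^+ k + e / 4.
  elim: k => [|k IH].
    have [p0' pa' q0' qp'] := abs_iter_bounds (n1 + 0) a01.
    by rewrite ler_norml expr0; apply/andP; split; lra.
  have [p0' pa' q0' qp'] := abs_iter_bounds (n1 + k) a01.
  have yk := y (n1 + k)%N (leq_addr _ _).
  rewrite addnS /abs_iter iterS -/(abs_iter a _) /abs_step /= [r ^+ k.+1]exprS.
  set p := (abs_iter a _).1 in p0' pa' qp' yk *; set q := (abs_iter a _).2 in IH q0' qp' *.
  have -> : a - ((1 - p) * q + a ^+ 2) = (1 - p) * (a - q) - a * (a - p) by ring.
  have p1 : 0 <= 1 - p by lra.
  have pr : 1 - p <= r by rewrite /r; lra.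
  rewrite (le_trans (ler_normB _ _)) // !normrM (ger0_norm p1) (ger0_norm a0).
  rewrite (ger0_norm (_ : 0 <= a - p)) ?subr_ge0 //.
  apply: (@le_trans _ _ (r * (r ^+ k + e / 4) + 1 * eta)).
    rewrite lerD //; first by rewrite ler_pM.
    by rewrite ler_pM // subr_ge0.
  rewrite mulrDr mul1r -addrA lerD2l /eta /r expr2; nra.
split.
  rewrite ger0_norm ?subr_ge0 // (le_trans (y _ (leq_addr _ _))) //; lra.
by rewrite (le_trans (q_dist m)) //; lra.
Qed.

End SquareRootIteration.

Section SignedSquare.
Context (R : realType) (G : Type) (Gam : zmodType) (ev : characters R G Gam).
Context (d : {additive Gam -> 'rV[R[i]]_3}) (S : set Gam).
Hypothesis mS : submonoid S.
Context (F : G -> jet R[i]) (v : G -> R).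
Hypotheses (CF : C1 ev d S F) (vF : forall g, jval (F g) = (v g)%:C%C)
  (v1 : forall g, `|v g| <= 1).

(** The jet of v |v|, whose derivative is 2 |v| dv. *)
Definition signed_square g : jet R[i] :=
  mkjet ((v g * `|v g|)%:C%C) ((2 * `|v g|)%:C%C *: (F g).2).

Let P n (g : G) : jet R[i] :=
  iter n (fun x => x + jconst (2^-1) * (F g ^+ 2 - x ^+ 2)) 0.

(** F P_n is a polynomial in F with value v p_n(|v|) and derivative (p_n + q_n) dv; both p_n and q_n
    tend uniformly to |v|. *)
Lemma C1_signed_square : C1 ev d S signed_square.
Proof.
have S0 := mS.1.
have CP n : C1 ev d S (P n).
  elim: n => [|n IH].
    rewrite (_ : P 0 = fun=> jconst 0); first exact: C1_jconst.
    by apply: funext.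
  exact: (C1D IH (C1_mul mS (C1_jconst ev d 2^-1 S0) (C1B S0 (C1X 2 mS CF) (C1X 2 mS IH)))).
have half : (2^-1 : R[i]) = (2^-1)%:C%C by rewrite fmorphV rmorph_nat.
(* The chain rule, multiplied by v: q_n is |v| times the derivative of p_n at |v|, and this product
   stays regular at v = 0. *)
have vP n g : jval (P n g) = ((abs_iter `|v g| n).1)%:C%C /\
    forall k, jval (F g) * jder k (P n g) = ((abs_iter `|v g| n).2)%:C%C * jder k (F g).
  elim: n => [|n [IH1 IH2]].
    by split=> // k; rewrite raddf0 mulr0 mul0r.
  have v2 : `|v g| ^+ 2 = v g ^+ 2 by rewrite real_normK ?num_real.
  have e1 : (abs_iter `|v g| n.+1).1 =
      (abs_iter `|v g| n).1 + 2^-1 * (v g ^+ 2 - (abs_iter `|v g| n).1 ^+ 2).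
    by rewrite /abs_iter iterS /= v2 [2^-1 * _]mulrC.
  have e2 : (abs_iter `|v g| n.+1).2 =
      (1 - (abs_iter `|v g| n).1) * (abs_iter `|v g| n).2 + v g ^+ 2.
    by rewrite /abs_iter iterS /= v2.
  rewrite e1 e2 [P n.+1 g]/= -/(P n g); split=> [|k].
    rewrite [LHS]/(jval (P n g) + 2^-1 * (jval (F g) ^+ 2 - jval (P n g) ^+ 2)).
    by rewrite IH1 vF half !(rmorphB, rmorphD, rmorphM, rmorphXn).
  have -> : jder k (P n g + jconst 2^-1 * (F g ^+ 2 - P n g ^+ 2)) =
      jder k (P n g) + jval (F g) * jder k (F g) - jval (P n g) * jder k (P n g).
    transitivity (jder k (P n g) + (jder k (jconst (2^-1 : R[i])) *
        jval (F g ^+ 2 - P n g ^+ 2) + jval (jconst (2^-1 : R[i])) *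
        (jder k (F g * F g) - jder k (P n g * P n g)))).
      by rewrite -(raddfB (jder k)) -jderM -(raddfD (jder k)).
    have -> : jder k (jconst (2^-1 : R[i])) = 0 by rewrite /jder mxE.
    by rewrite !jderM [jval (jconst _)]/=; field.
  have -> : jval (F g) * (jder k (P n g) + jval (F g) * jder k (F g)
      - jval (P n g) * jder k (P n g)) =
    (1 - jval (P n g)) * (jval (F g) * jder k (P n g)) + jval (F g) ^+ 2 * jder k (F g).
    by ring.
  rewrite IH2 IH1 vF !(rmorphB, rmorphD, rmorphM, rmorphXn, rmorph1); ring.
have [K K0 FK] := C1_bounded CF.
apply: C1_closed => e e0.
(* The value costs e' and the derivatives 2 e' K in total. *)
have e'0 : 0 < e / (3 * K + 1) by rewrite divr_gt0 // ltr_wpDl // mulr_ge0 // ltW.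
have [n Hn] := abs_iter_uniform e'0.
exists (fun g => F g * P n g); first exact: (C1_mul mS CF (CP n)).
move=> g; have a01 : 0 <= `|v g| <= 1 by rewrite normr_ge0 v1.
have [h1 h2] := Hn _ a01; have [vPg dPg] := vP n g.
set e' := e / _ in e'0 h1 h2 *; set p := (abs_iter _ n).1 in h1 vPg *.
set q := (abs_iter _ n).2 in h2 dPg *; set a := `|v g| in h1 h2 a01 *.
have V : modc (jval (signed_square g - F g * P n g)) <= e'.
  have -> : jval (signed_square g - F g * P n g) = (v g * (a - p))%:C%C.
    rewrite [LHS]/((v g * a)%:C%C - jval (F g) * jval (P n g)) vF vPg.
    by rewrite mulrBr rmorphB !rmorphM.
  rewrite modc_real normrM.
  by rewrite -[leRHS]mul1r ler_pM // v1.
have D k : modc (jder k (signed_square g - F g * P n g)) <= 2 * e' * modc (jder k (F g)).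
  have -> : jder k (signed_square g - F g * P n g) =
      ((a - p) + (a - q))%:C%C * jder k (F g).
    have -> : jder k (signed_square g - F g * P n g) =
        jder k (signed_square g) - (jder k (F g) * jval (P n g) + jval (F g) * jder k (P n g)).
      by rewrite -jderM -raddfB.
    have -> : jder k (signed_square g) = (2 * a)%:C%C * jder k (F g) by rewrite /jder mxE.
    by rewrite dPg vPg !(rmorphB, rmorphD, rmorphM, rmorph_nat); ring.
  rewrite modcM modc_real ler_wpM2r ?modc_ge0 // (le_trans (ler_normD _ _)) //.
  by rewrite mulr_natl mulr2n lerD.
have sumK : \sum_k modc (jder k (F g)) <= K.
  by apply: le_trans (FK g); rewrite /jnorm mul1r lerDr modc_ge0.
apply: (@le_trans _ _ (e' + 2 * e' * K)).
  rewrite /jnorm mul1r lerD // (le_trans (ler_sum _ (fun k _ => D k))) // -mulr_sumr.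
  by rewrite ler_wpM2l // mulr_ge0 // ltW.
have -> : e = e' * (3 * K + 1) by rewrite divfK // gt_eqF // ltr_wpDl // mulr_ge0 // ltW.
have := mulr_ge0 (ltW e'0) (ltW K0); lra.
Qed.

End SignedSquare.

Section TwoByTwo.
Variable T : pzRingType.

Definition mx22 (a b c d : T) : 'M[T]_2 :=
  \matrix_(i, j) if i == 0 then (if j == 0 then a else b) else (if j == 0 then c else d).

Lemma mx22M a b c d a' b' c' d' :
  mx22 a b c d *m mx22 a' b' c' d' =
  mx22 (a * a' + b * c') (a * b' + b * d') (c * a' + d * c') (c * b' + d * d').
Proof.
apply/matrixP => i j; rewrite !mxE !big_ord_recl big_ord0 addr0 !mxE /=.
by case: (i == 0); case: (j == 0).
Qed.

Lemma mx22B a b c d a' b' c' d' :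
  mx22 a b c d - mx22 a' b' c' d' = mx22 (a - a') (b - b') (c - c') (d - d').
Proof. by apply/matrixP => i j; rewrite !mxE; case: (i == 0); case: (j == 0). Qed.

Lemma mxtrace22 a b c d : \tr (mx22 a b c d) = a + d.
Proof. by rewrite /mxtrace !big_ord_recl big_ord0 addr0 !mxE. Qed.

End TwoByTwo.

Lemma map_mx22 (T T' : pzRingType) (f : T -> T') a b c d :
  map_mx f (mx22 a b c d) = mx22 (f a) (f b) (f c) (f d).
Proof. by apply/matrixP => i j; rewrite !mxE; case: (i == 0); case: (j == 0). Qed.

(** * Loops attached to idempotents and their Chern forms *)

Section OmegaIdempotent.
Variable K : fieldType.

Lemma mderZ k m n (a : jet K) (p : 'M[jet K]_(m, n)) :
  mder k (a *: p) = jder k a *: mval p + jval a *: mder k p.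
Proof. by apply/matrixP => i j; rewrite !mxE jderM. Qed.

Lemma mvalZ m n (a : jet K) (p : 'M[jet K]_(m, n)) : mval (a *: p) = jval a *: mval p.
Proof. by apply/matrixP => i j; rewrite !mxE. Qed.

Lemma idempotent_loop_inv n (p : 'M[jet K]_n) (W W' : jet K) :
  p *m p = p -> W * W' = 1 ->
  (1%:M + (W - 1) *: p) *m (1%:M + (W' - 1) *: p) = 1%:M.
Proof.
move=> pp WW; rewrite mulmxDl mul1mx mulmxDr mulmx1 -scalemxAl -scalemxAr pp scalerA.
rewrite -addrA -!scalerDl.
have -> : W' - 1 + (W - 1 + (W - 1) * (W' - 1)) = W * W' - 1 by ring.
by rewrite WW subrr scale0r addr0.
Qed.

(* The loop w p + (1 - p) attached to an idempotent p has the Chern form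
   tr (p [d p, d p]) of p as its Maurer-Cartan form. *)
Lemma omega_idempotent n (p : 'M[jet K]_n) (W W' : jet K) :
  p *m p = p -> W * W' = 1 ->
  jder (ord3 0) W = 0 -> jder (ord3 1) W = 0 -> jder (ord3 2) W = jval W ->
  mder (ord3 2) p = 0 ->
  omega (1%:M + (W - 1) *: p) = (jval W - 2 + jval W') *
    \tr (mval p *m (mder (ord3 0) p *m mder (ord3 1) p - mder (ord3 1) p *m mder (ord3 0) p)).
Proof.
move=> pp WW W0 W1 W2 p2.
set q := mval p; set w := jval W; set w' := jval W'.
have ww : w * w' = 1 by rewrite -jvalM WW.
have qq : q *m q = q by rewrite -mvalM pp.
pose Y := 1%:M + (w' - 1) *: q.
have vX : mval (1%:M + (W - 1) *: p) = 1%:M + (w - 1) *: q.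
  by rewrite /mval map_mxD map_mx1 -/(mval _) mvalZ.
have YV : invmx (mval (1%:M + (W - 1) *: p)) = Y.
  apply/esym/mulmx1_invmx; rewrite vX.
  have := congr1 (@mval K n n) (idempotent_loop_inv pp WW).
  by rewrite mvalM mval1 vX /mval map_mxD map_mx1 -/(mval _) mvalZ.
have dX k : mder k (1%:M + (W - 1) *: p) = jder k W *: q + (w - 1) *: mder k p.
  have -> : mder k (1%:M + (W - 1) *: p) = mder k 1%:M + mder k ((W - 1) *: p).
    by rewrite /mder map_mxD.
  have e : jder k (W - 1) = jder k W - jder k 1 := raddfB (jder k) W 1.
  by rewrite mder1 add0r mderZ e jder1 subr0.
have Yq : Y *m q = w' *: q.
  by rewrite mulmxDl mul1mx -scalemxAl qq -[X in X + _]scale1r -scalerDl addrC subrK.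
have qY : q *m Y = w' *: q.
  by rewrite mulmxDr mulmx1 -scalemxAr qq -[X in X + _]scale1r -scalerDl addrC subrK.
(* Differentiating p p = p and compressing by p on both sides leaves p (dp) p = 0. *)
have qDq k : q *m mder k p *m q = 0.
  have D := congr1 (@mder K k n n) pp; rewrite mderM -/q in D.
  have := congr1 (fun Z => q *m Z *m q) D.
  rewrite /= mulmxDr mulmxDl !mulmxA qq -[_ *m q *m q in LHS]mulmxA qq.
  by move/eqP; rewrite -subr_eq0 addrK => /eqP.
have l2 : logder (ord3 2) (1%:M + (W - 1) *: p) = q.
  rewrite /logder YV dX W2 p2 scaler0 addr0 -scalemxAr Yq scalerA -/w ww.
  by rewrite scale1r.
have l0 : logder (ord3 0) (1%:M + (W - 1) *: p) = (w - 1) *: (Y *m mder (ord3 0) p).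
  by rewrite /logder YV dX W0 scale0r add0r -scalemxAr.
have l1 : logder (ord3 1) (1%:M + (W - 1) *: p) = (w - 1) *: (Y *m mder (ord3 1) p).
  by rewrite /logder YV dX W1 scale0r add0r -scalemxAr.
(* q Y = w' q absorbs the first Y and q (dp) q = 0 removes the second; since w w' = 1, the scalar (w
   - 1)^2 w' is w - 2 + w'. *)
have core k l : \tr (q *m ((w - 1) *: (Y *m mder k p)) *m ((w - 1) *: (Y *m mder l p))) =
    (w - 2 + w') * \tr (q *m (mder k p *m mder l p)).
  have -> : q *m ((w - 1) *: (Y *m mder k p)) *m ((w - 1) *: (Y *m mder l p)) =
      ((w - 1) * (w - 1) * w') *: (q *m mder k p *m Y *m mder l p).
    by rewrite -!scalemxAr -!scalemxAl scalerA !mulmxA qY -!scalemxAl scalerA.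
  have -> : q *m mder k p *m Y = q *m mder k p.
    by rewrite mulmxDr mulmx1 -scalemxAr qDq scaler0 addr0.
  rewrite mxtraceZ mulmxA; congr (_ * _).
  have -> : (w - 1) * (w - 1) * w' = w * (w * w') - 2 * (w * w') + w' by ring.
  by rewrite ww !mulr1.
rewrite /omega l0 l1 l2 mulmxBr raddfB /= mulmxBr raddfB /= mulrBr -!core.
congr (_ - _); first by rewrite mulmxA mxtrace_mulC !mulmxA.
by rewrite mulmxA -mulmxA mxtrace_mulC.
Qed.

Lemma chern_embed m n (E : 'M[K]_(m, n)) (p D D' : 'M[K]_m) : E *m E^T = 1%:M ->
  \tr ((E^T *m p *m E) *m ((E^T *m D *m E) *m (E^T *m D' *m E) -
     (E^T *m D' *m E) *m (E^T *m D *m E))) = \tr (p *m (D *m D' - D' *m D)).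
Proof.
move=> EE; have M (X Y : 'M[K]_m) :
    (E^T *m X *m E) *m (E^T *m Y *m E) = E^T *m (X *m Y) *m E.
  by rewrite !mulmxA -[_ *m E *m E^T]mulmxA EE mulmx1.
by rewrite !M -mulmxBl -mulmxBr M mxtrace_mulC !mulmxA EE mul1mx.
Qed.

Lemma chern22 (f x y a b f' x' y' : K) :
  \tr (mx22 f x y (1 - f) *m
    (mx22 0 a b 0 *m mx22 f' x' y' (- f') - mx22 f' x' y' (- f') *m mx22 0 a b 0)) =
  (2 * f - 1) * (a * y' - b * x') + 2 * f' * (x * b - y * a).
Proof. by rewrite !mx22M mx22B mx22M mxtrace22; ring. Qed.

End OmegaIdempotent.

Section ExpJets.
Context (R : realType) (G : topologicalType) (Gam : zmodType)
  (ev : characters R G Gam).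
Context (d : {additive Gam -> 'rV[R[i]]_3}) (gam : 'I_3 -> Gam).
Hypothesis d_gam : forall k, d (gam k) = delta_mx 0 k.
Local Notation C := R[i].
Local Notation jch := (jchar ev d).

Definition exp_gam k (g : G) : jet C := jch (gam k) g.
Definition exp_gamV k (g : G) : jet C := jch (- gam k) g.

Lemma exp_gamK k g : exp_gam k g * exp_gamV k g = 1.
Proof. by rewrite -jcharD subrr jchar0. Qed.

Lemma jder_exp k l g : jder l (exp_gam k g) = ev (gam k) g * (l == k)%:R.
Proof. by rewrite /jder /= mxE d_gam mxE eqxx. Qed.

Lemma jder_expV k l g : jder l (exp_gamV k g) = - (ev (- gam k) g * (l == k)%:R).
Proof. by rewrite /jder /= mxE raddfN d_gam !mxE eqxx mulrN. Qed.

Lemma ord3_neq (a b : nat) : (a < 3)%N -> (b < 3)%N -> a != b -> (ord3 a == ord3 b) = false.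
Proof.
move=> a3 b3 ab; apply/negP => /eqP /(congr1 (@nat_of_ord 3)).
by rewrite ord3.unlock /= !inordK // => /eqP; rewrite (negbTE ab).
Qed.

Definition sinr g : R := complex.Im (ev (gam (ord3 1)) g).

End ExpJets.

(** Cosine and, below, sine of the phase of [gam (ord3 1)]. They are locked so that polynomial
    identities treat them as atoms. *)
HB.lock Definition cos_jet (R : realType) (G : topologicalType) (Gam : zmodType)
    (ev : characters R G Gam) (d : {additive Gam -> 'rV[R[i]]_3}) (gam : 'I_3 -> Gam)
    (g : G) : jet R[i] :=
  jconst 2^-1 * (exp_gam ev d gam (ord3 1) g + exp_gamV ev d gam (ord3 1) g).

HB.lock Definition sin_jet (R : realType) (G : topologicalType) (Gam : zmodType)
    (ev : characters R G Gam) (d : {additive Gam -> 'rV[R[i]]_3}) (gam : 'I_3 -> Gam)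
    (g : G) : jet R[i] :=
  jconst (2 * 'i%C)^-1 * (exp_gam ev d gam (ord3 1) g - exp_gamV ev d gam (ord3 1) g).

HB.lock Definition signed_sin_jet (R : realType) (G : topologicalType) (Gam : zmodType)
    (ev : characters R G Gam) (d : {additive Gam -> 'rV[R[i]]_3}) (gam : 'I_3 -> Gam)
    (g : G) : jet R[i] :=
  signed_square (sin_jet ev d gam) (sinr ev gam) g.

Section Example.
Context (R : realType) (G : topologicalType) (Gam : zmodType)
  (ev : characters R G Gam) (d : {additive Gam -> 'rV[R[i]]_3}) (gam : 'I_3 -> Gam).
Local Notation C := R[i].
Local Notation exp_gam := (exp_gam ev d gam).
Local Notation exp_gamV := (exp_gamV ev d gam).
Local Notation cosj := (cos_jet ev d gam).
Local Notation sinj := (sin_jet ev d gam).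
Local Notation sigj := (signed_sin_jet ev d gam).
Local Notation sinr := (sinr ev gam).

Lemma jconstX (a : C) n : jconst (a ^+ n) = jconst a ^+ n.
Proof. by elim: n => [//|n IH]; rewrite !exprS jconstM IH. Qed.

Lemma jconst_nat n : jconst (n%:R : C) = n%:R.
Proof. by elim: n => [//|n IH]; rewrite -[in LHS]natr1 -[in RHS]natr1 jconstD IH. Qed.

Lemma iE : 'i%C * 'i%C = -1 :> C.
Proof. by rewrite -expr2 sqr_i. Qed.

Lemma i_neq0 : 'i%C != 0 :> C.
Proof.
apply/eqP => i0; have := iE; rewrite i0 mul0r => /eqP.
by rewrite eq_sym oppr_eq0 oner_eq0.
Qed.

Lemma jval_sinj g : jval (sinj g) = (sinr g)%:C%C.
Proof.
rewrite sin_jet.unlock jvalM /sinr.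
have -> : jval (exp_gam (ord3 1) g - exp_gamV (ord3 1) g) =
    ev (gam (ord3 1)) g - (ev (gam (ord3 1)) g)^*%C.
  have -> : (ev (gam (ord3 1)) g)^*%C = ev (- gam (ord3 1)) g by rewrite -conj_char.
  by [].
have -> : ev (gam (ord3 1)) g - (ev (gam (ord3 1)) g)^*%C =
    2 * 'i%C * (complex.Im (ev (gam (ord3 1)) g))%:C%C.
  by case: (ev _ g) => a b; apply/eqP; rewrite eq_complex /=; apply/andP; split; apply/eqP; ring.
by rewrite mulrA mulVf ?mul1r // mulf_neq0 ?i_neq0 // pnatr_eq0.
Qed.

Lemma sinr_le1 g : `|sinr g| <= 1.
Proof. by rewrite -(char_mod ev (gam (ord3 1)) g) Im_le_modc. Qed.

Lemma sin2Dcos2 g : sinj g ^+ 2 + cosj g ^+ 2 = 1.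
Proof.
rewrite sin_jet.unlock cos_jet.unlock 2!exprMn -2!jconstX.
have -> : (2 * 'i%C)^-1 ^+ 2 = - (4^-1) :> C.
  by rewrite exprVn exprMn sqr_i mulrN1 invrN -natrX.
have -> : (2^-1 : C) ^+ 2 = 4^-1 by rewrite exprVn -natrX.
have -> : jconst (- 4^-1) = - jconst (4^-1 : C).
  by apply: jetP => [//|k]; rewrite /jder /= !mxE oppr0.
have E := exp_gamK ev d gam (ord3 1) g.
set V := exp_gam _ g in E *; set V' := exp_gamV _ g in E *.
have -> : - jconst (4^-1 : C) * (V - V') ^+ 2 + jconst 4^-1 * (V + V') ^+ 2 =
    jconst (4^-1 : C) * 4 * (V * V') by ring.
rewrite E mulr1 -(jconst_nat 4).
by rewrite -jconstM mulVf ?jconst1 // pnatr_eq0.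
Qed.

Lemma jval_sigj g : jval (sigj g) = (sinr g * `|sinr g|)%:C%C.
Proof. by rewrite signed_sin_jet.unlock. Qed.

Lemma jder_sigj k g : jder k (sigj g) = (2 * `|sinr g|)%:C%C * jder k (sinj g).
Proof. by rewrite signed_sin_jet.unlock /jder mxE. Qed.

Lemma sigj_sqr g : sigj g ^+ 2 = sinj g ^+ 4.
Proof.
have v2 : (`|sinr g| ^+ 2 = sinr g ^+ 2) by rewrite real_normK ?num_real.
have E : (sinr g * `|sinr g|) * (2 * `|sinr g|) = 2 * sinr g ^+ 3.
  by rewrite mulrACA -expr2 v2; ring.
have D k : jder k (sigj g) = (2 * `|sinr g|)%:C%C * jder k (sinj g) := jder_sigj k g.
have T0 : jval (sigj g) = (sinr g * `|sinr g|)%:C%C := jval_sigj g.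
move: (sigj g) (sinj g) T0 (jval_sinj g) D => T s T0 s0 D.
have -> : s ^+ 4 = (s * s) * (s * s) by ring.
rewrite expr2; apply: jetP => [|k].
  rewrite !jvalM s0 T0 -!rmorphM; congr (_%:C%C).
  by rewrite mulrACA -expr2 -expr2 v2 expr2.
rewrite !jderM D !jvalM s0 T0.
have -> : (2 * `|sinr g|)%:C%C * jder k s * (sinr g * `|sinr g|)%:C%C +
    (sinr g * `|sinr g|)%:C%C * ((2 * `|sinr g|)%:C%C * jder k s) =
    2 * ((sinr g * `|sinr g|)%:C%C * (2 * `|sinr g|)%:C%C) * jder k s by ring.
by rewrite -rmorphM E !(rmorphM, rmorphXn, rmorph_nat); ring.
Qed.

(* The idempotent [[f, x], [y, 1 - f]] sweeps a sphere along the phases of gam 0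
   and gam 1. With s the sine and t = s |s| its signed square, P = s^2 + t and
   M = s^2 - t are supported on opposite half-circles, so P M = 0 and
   x y = A (P^2 + M^2) = 4 A s^4, which is f - f^2 by the choice of f and A.
   Using t instead of cutoff functions keeps all entries in the uniform closure
   of the trigonometric jets. *)
Definition fj g : jet C := jconst 4^-1 * (2 + cosj g * (2 + sinj g ^+ 2)).
Definition Pj g : jet C := sinj g ^+ 2 + sigj g.
Definition Mj g : jet C := sinj g ^+ 2 - sigj g.
Definition Aj g : jet C := jconst 4^-1 ^+ 3 * (3 + sinj g ^+ 2).
Definition hj g : jet C := Aj g * Mj g ^+ 2.
Definition xj g : jet C := Aj g * (Pj g + Mj g * exp_gam (ord3 0) g).
Definition yj g : jet C := Pj g + Mj g * exp_gamV (ord3 0) g.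

Lemma quarter4 : jconst (4^-1 : C) * 4 = 1.
Proof. by rewrite -(jconst_nat 4) -jconstM mulVf // pnatr_eq0. Qed.

Lemma PjMj g : Pj g * Mj g = 0.
Proof.
have -> : Pj g * Mj g = sinj g ^+ 4 - sigj g ^+ 2 by rewrite /Pj /Mj; ring.
by rewrite sigj_sqr subrr.
Qed.

(** In f, c (2 + s^2) = 3 c - c^3 is up to scale the primitive of sin^3, normalised so that f runs
    between 1 and 0. Then 16 (f - f^2) = 4 - (1 - s^2) (2 + s^2)^2 = s^4 (3 + s^2). *)
Lemma fj_sqr g : fj g - fj g ^+ 2 = jconst 4^-1 ^+ 2 * (3 + sinj g ^+ 2) * sinj g ^+ 4.
Proof.
have c2 : cosj g ^+ 2 = 1 - sinj g ^+ 2 by rewrite -(sin2Dcos2 g); ring.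
rewrite /fj; have a4 := quarter4.
move: (jconst _) (cosj g) (sinj g) a4 c2 => a c s a4 c2.
have -> : a * (2 + c * (2 + s ^+ 2)) - (a * (2 + c * (2 + s ^+ 2))) ^+ 2 =
   a * (2 + c * (2 + s ^+ 2)) * (a * 4 - a * (2 + c * (2 + s ^+ 2))).
  by rewrite a4; ring.
transitivity (a ^+ 2 * (4 - c ^+ 2 * (2 + s ^+ 2) ^+ 2)); first by ring.
by rewrite c2; ring.
Qed.

Lemma xjyj g : xj g * yj g = fj g - fj g ^+ 2.
Proof.
have E1 := exp_gamK ev d gam (ord3 0) g; have E2 := PjMj g; have a4 := quarter4.
have E3 : Pj g ^+ 2 + Mj g ^+ 2 = 4 * sinj g ^+ 4.
  rewrite /Pj /Mj; move: (sigj g) (sinj g) (sigj_sqr g) => t s ts.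
  by transitivity (2 * (s ^+ 4 + t ^+ 2)); [ring|rewrite ts; ring].
rewrite fj_sqr /xj /yj /Aj.
move: (jconst _) (Pj g) (Mj g) (sinj g) (exp_gam _ g) (exp_gamV _ g) a4 E1 E2 E3.
move=> a p m s u u' a4 E1 E2 E3.
transitivity (a ^+ 3 * (3 + s ^+ 2) * ((p ^+ 2 + m ^+ 2) + m ^+ 2 * (u * u' - 1)
  + p * m * (u + u'))); first by ring.
rewrite E1 E2 E3; transitivity (a ^+ 2 * (a * 4) * (3 + s ^+ 2) * s ^+ 4); first by ring.
by rewrite a4; ring.
Qed.

Definition flat k (x : jet C) := jder k x = 0.

Lemma flatD k x y : flat k x -> flat k y -> flat k (x + y).
Proof. by rewrite /flat => fx fy; rewrite raddfD -[LHS]/(jder k x + jder k y) fx fy addr0. Qed.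

Lemma flatB k x y : flat k x -> flat k y -> flat k (x - y).
Proof. by rewrite /flat => fx fy; rewrite raddfB -[LHS]/(jder k x - jder k y) fx fy subr0. Qed.

Lemma flatM k x y : flat k x -> flat k y -> flat k (x * y).
Proof. by rewrite /flat => fx fy; rewrite jderM fx fy mul0r mulr0 addr0. Qed.

Lemma flat_jconst k a : flat k (jconst a).
Proof. by rewrite /flat /jder mxE. Qed.

Lemma flat_nat k n : flat k n%:R.
Proof. by rewrite -jconst_nat; exact: flat_jconst. Qed.

Lemma flatX k x n : flat k x -> flat k (x ^+ n).
Proof.
by move=> fx; elim: n => [|n IH]; [exact: flat_nat k 1%N|rewrite exprS; exact: flatM].
Qed.

Hypothesis d_gam : forall k, d (gam k) = delta_mx 0 k.

Section Flat.
Variables (k : 'I_3) (g : G).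
Hypothesis k1 : (k == ord3 1) = false.

Lemma flat_exp : flat k (exp_gam (ord3 1) g).
Proof. by rewrite /flat (jder_exp ev d_gam) k1 mulr0. Qed.

Lemma flat_expV : flat k (exp_gamV (ord3 1) g).
Proof. by rewrite /flat (jder_expV ev d_gam) k1 mulr0 oppr0. Qed.

Lemma flat_sinj : flat k (sinj g).
Proof. rewrite sin_jet.unlock; exact: (flatM (flat_jconst k _) (flatB flat_exp flat_expV)). Qed.

Lemma flat_cosj : flat k (cosj g).
Proof. rewrite cos_jet.unlock; exact: (flatM (flat_jconst k _) (flatD flat_exp flat_expV)). Qed.

Lemma flat_sigj : flat k (sigj g).
Proof. by rewrite /flat jder_sigj flat_sinj mulr0. Qed.

Let s2 := flatX 2 flat_sinj.

Lemma flat_fj : flat k (fj g).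
Proof.
exact: (flatM (flat_jconst k _) (flatD (flat_nat k 2)
  (flatM flat_cosj (flatD (flat_nat k 2) s2)))).
Qed.

Lemma flat_Pj : flat k (Pj g). Proof. exact: (flatD s2 flat_sigj). Qed.
Lemma flat_Mj : flat k (Mj g). Proof. exact: (flatB s2 flat_sigj). Qed.
Lemma flat_Aj : flat k (Aj g).
Proof. exact: (flatM (flatX 3 (flat_jconst k _)) (flatD (flat_nat k 3) s2)). Qed.

End Flat.
End Example.

Lemma jderD (K : fieldType) k (x y : jet K) : jder k (x + y) = jder k x + jder k y.
Proof. exact: raddfD. Qed.

Lemma jderB (K : fieldType) k (x y : jet K) : jder k (x - y) = jder k x - jder k y.
Proof. exact: raddfB. Qed.

Lemma jder_nat (R : realType) k n : jder k (n%:R : jet R[i]) = 0.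
Proof. exact: flat_nat. Qed.

Lemma jder_quartic (R : realType) k (a : R[i]) (s c : jet R[i]) :
  jder k (jconst a * (2 + c * (2 + s ^+ 2))) =
  a * (jder k c * (2 + jval s ^+ 2) + jval c * (2 * jval s * jder k s)).
Proof.
rewrite jderM (flat_jconst k a : jder _ _ = 0) mul0r add0r; congr (_ * _).
have -> : 2 + c * (2 + s ^+ 2) = 2%:R + (2%:R * c + c * s * s) by ring.
by rewrite !(jderD, jderM, jder_nat, jvalM) (rmorph_nat (@jval _)); ring.
Qed.

(** Put h = A M^2. All terms with P M or M D_1 P vanish, and (2 f - 1) D_1 h - 4 h D_1 f remains;
    the product rule turns it into a derivative minus 6 h D_1 f. *)
Lemma chern_jets (R : realType) (k0 k1 : 'I_3) (f A P M U U' : jet R[i]) :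
  flat k0 f -> flat k0 A -> flat k0 P -> flat k0 M ->
  jder k0 U = jval U -> jder k0 U' = - jval U' -> flat k1 U -> flat k1 U' ->
  U * U' = 1 -> P * M = 0 -> jval M * jder k1 P = 0 ->
  (let p := mx22 f (A * (P + M * U)) (P + M * U') (1 - f) in
  \tr (mval p *m (mder k0 p *m mder k1 p - mder k1 p *m mder k0 p))) =
  jder k1 ((2%:R * f - 1) * (A * (M * M))) - 6 * (jder k1 f * jval (A * (M * M))).
Proof.
rewrite /flat => f0 A0 P0 M0 U0 U'0 U1 U'1 UU PM MP.
set p := mx22 f _ _ _.
have uu : jval U * jval U' = 1 by rewrite -jvalM UU.
have pm : jval P * jval M = 0 by rewrite -jvalM PM.
have x0 : jder k0 (A * (P + M * U)) = jval A * (jval M * jval U).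
  by rewrite !(jderM, jderD) A0 P0 M0 U0 !mul0r !add0r.
have y0 : jder k0 (P + M * U') = - (jval M * jval U').
  by rewrite !(jderM, jderD) P0 M0 U'0 mul0r !add0r mulrN.
have x1 : jder k1 (A * (P + M * U)) = jder k1 A * (jval P + jval M * jval U) +
    jval A * (jder k1 P + jder k1 M * jval U).
  by rewrite !(jderM, jderD) U1 mulr0 addr0 jvalD jvalM.
have y1 : jder k1 (P + M * U') = jder k1 P + jder k1 M * jval U'.
  by rewrite !(jderM, jderD) U'1 mulr0 addr0.
have d1 k : jder k (1 - f) = - jder k f by rewrite jderB jder1 sub0r.
have -> : mder k0 p = mx22 0 (jval A * (jval M * jval U)) (- (jval M * jval U')) 0.
  by rewrite /mder map_mx22 x0 y0 d1 f0 oppr0.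
have -> : mder k1 p = mx22 (jder k1 f) (jder k1 A * (jval P + jval M * jval U) +
    jval A * (jder k1 P + jder k1 M * jval U)) (jder k1 P + jder k1 M * jval U')
    (- jder k1 f).
  by rewrite /mder map_mx22 x1 y1 d1.
have -> : mval p = mx22 (jval f) (jval A * (jval P + jval M * jval U))
    (jval P + jval M * jval U') (1 - jval f) by rewrite /mval map_mx22.
rewrite chern22 !(jderM, jderB, jvalM, jder_nat, jder1).
have -> : jval (2%:R * f - 1) = 2 * jval f - 1.
  by rewrite -[jval _]/(jval (2%:R * f) - 1) jvalM (rmorph_nat (@jval _)).
rewrite (rmorph_nat (@jval _)).
move: uu pm MP; clear.
move: (jval f) (jval A) (jval P) (jval M) (jval U) (jval U') (jder k1 f) (jder k1 A)
  (jder k1 P) (jder k1 M) => {}f a p m u u' f' a' p' m' uu pm mp.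
transitivity ((2 * f - 1) * (a * (u + u') * (m * p') +
    (2 * a * m * m' + a' * m ^+ 2) * (u * u') + a' * u' * (p * m)) -
  2 * f' * (a * (u + u') * (p * m) + 2 * a * m ^+ 2 * (u * u'))); first by ring.
by rewrite uu pm mp; ring.
Qed.

Section ExampleDegree.
Context (R : realType) (G : topologicalType) (Gam : zmodType)
  (ev : characters R G Gam).
Context (d : {additive Gam -> 'rV[R[i]]_3}) (gam : 'I_3 -> Gam).
Hypothesis d_gam : forall k, d (gam k) = delta_mx 0 k.
Local Notation C := R[i].
Local Notation V g := (exp_gam ev d gam (ord3 1) g).
Local Notation V' g := (exp_gamV ev d gam (ord3 1) g).
Local Notation U g := (exp_gam ev d gam (ord3 0) g).
Local Notation U' g := (exp_gamV ev d gam (ord3 0) g).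
Local Notation W g := (exp_gam ev d gam (ord3 2) g).
Local Notation W' g := (exp_gamV ev d gam (ord3 2) g).
Local Notation s := (sin_jet ev d gam).
Local Notation c := (cos_jet ev d gam).
Local Notation t := (signed_sin_jet ev d gam).
Local Notation f := (fj ev d gam).
Local Notation P := (Pj ev d gam).
Local Notation M := (Mj ev d gam).
Local Notation A := (Aj ev d gam).
Local Notation h := (hj ev d gam).
Local Notation x := (xj ev d gam).
Local Notation y := (yj ev d gam).
Local Notation sr := (sinr ev gam).

Lemma jval_cosE g : jval (c g) = 2^-1 * (ev (gam (ord3 1)) g + ev (- gam (ord3 1)) g).
Proof. by rewrite cos_jet.unlock. Qed.

Lemma jval_sinE g :
  jval (s g) = (2 * 'i%C)^-1 * (ev (gam (ord3 1)) g - ev (- gam (ord3 1)) g).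
Proof. by rewrite sin_jet.unlock. Qed.

(** D_1 fixes the character of [gam (ord3 1)], so it is -'i times the angular derivative. *)
Lemma jder1_sinj g : jder (ord3 1) (s g) = - 'i%C * jval (c g).
Proof.
have i0 := i_neq0 R; have i2 := iE R.
have D : jder (ord3 1) (V g - V' g) = ev (gam (ord3 1)) g + ev (- gam (ord3 1)) g.
  by rewrite jderB (jder_exp ev d_gam) (jder_expV ev d_gam) eqxx !mulr1 opprK.
rewrite sin_jet.unlock jderM D (flat_jconst _ _ : jder _ _ = 0) mul0r add0r.
rewrite jval_cosE -[jval (jconst _)]/((2 * 'i%C)^-1) mulrA; congr (_ * _).
have n2 : (2 : C) != 0 by rewrite pnatr_eq0.
apply: (mulfI (mulf_neq0 n2 i0)); rewrite mulfV ?mulf_neq0 //.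
transitivity (2 * 2^-1 * - ('i%C * 'i%C) : C); last by ring.
by rewrite i2 opprK mulr1 mulfV.
Qed.

Lemma jder1_cosj g : jder (ord3 1) (c g) = 'i%C * jval (s g).
Proof.
have i0 := i_neq0 R; have i2 := iE R.
have D : jder (ord3 1) (V g + V' g) = ev (gam (ord3 1)) g - ev (- gam (ord3 1)) g.
  by rewrite jderD (jder_exp ev d_gam) (jder_expV ev d_gam) eqxx !mulr1.
rewrite cos_jet.unlock jderM D (flat_jconst _ _ : jder _ _ = 0) mul0r add0r.
rewrite jval_sinE -[jval (jconst _)]/(2^-1) mulrA; congr (_ * _).
by rewrite invfM mulrCA mulfV // mulr1.
Qed.

Lemma jder1_fj g : jder (ord3 1) (f g) = 3 * 'i%C / 4 * jval (s g) ^+ 3.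
Proof.
have sc : jval (s g) ^+ 2 + jval (c g) ^+ 2 = 1 := congr1 jval (sin2Dcos2 ev d gam g).
rewrite [LHS](jder_quartic (ord3 1) 4^-1 (s g) (c g)) jder1_sinj jder1_cosj.
move: (jval (s g)) (jval (c g)) sc => a b sc.
have b2 : b ^+ 2 = 1 - a ^+ 2 by rewrite -sc; ring.
transitivity (4^-1 * ('i%C * a * (2 + a ^+ 2) - 2 * 'i%C * a * b ^+ 2)); first by ring.
by rewrite b2; field.
Qed.

End ExampleDegree.

Lemma embed_idempotent (T : comPzRingType) m n (E : 'M[T]_(m, n)) (q : 'M[T]_m) :
  E *m E^T = 1%:M -> q *m q = q ->
  (E^T *m q *m E) *m (E^T *m q *m E) = E^T *m q *m E.
Proof.
move=> EE qq.
by rewrite !mulmxA -[_ *m E *m E^T]mulmxA EE mulmx1 -[_ *m q *m q]mulmxA qq.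
Qed.

Lemma mder_flat22 (R : realType) k (a b c d : jet R[i]) :
  flat k a -> flat k b -> flat k c -> flat k d -> mder k (mx22 a b c d) = 0.
Proof.
rewrite /flat => fa fb fc fd; rewrite /mder map_mx22 fa fb fc fd.
by apply/matrixP => i j; rewrite !mxE; case: (i == 0); case: (j == 0).
Qed.

Section ExampleMatrix.
Context (R : realType) (G : topologicalType) (Gam : zmodType)
  (ev : characters R G Gam) (I : mean ev).
Context (d : {additive Gam -> 'rV[R[i]]_3}) (gam : 'I_3 -> Gam).
Hypothesis d_gam : forall k, d (gam k) = delta_mx 0 k.
Variable n : nat.
Hypothesis n2 : (2 <= n)%N.
Local Notation C := R[i].
Local Notation U := (exp_gam ev d gam (ord3 0)).
Local Notation U' := (exp_gamV ev d gam (ord3 0)).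
Local Notation W := (exp_gam ev d gam (ord3 2)).
Local Notation W' := (exp_gamV ev d gam (ord3 2)).
Local Notation s := (sin_jet ev d gam).
Local Notation c := (cos_jet ev d gam).
Local Notation t := (signed_sin_jet ev d gam).
Local Notation f := (fj ev d gam).
Local Notation P := (Pj ev d gam).
Local Notation M := (Mj ev d gam).
Local Notation A := (Aj ev d gam).
Local Notation h := (hj ev d gam).
Local Notation x := (xj ev d gam).
Local Notation y := (yj ev d gam).
Local Notation sr := (sinr ev gam).

Definition p22 g : 'M[jet C]_2 := mx22 (f g) (x g) (y g) (1 - f g).

Lemma p22_idem g : p22 g *m p22 g = p22 g.
Proof.
have xy := xjyj ev d gam g; rewrite /p22 mx22M.
move: (f g) (x g) (y g) xy => a b e be.
have eb : e * b = a - a ^+ 2 by rewrite mulrC.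
by congr mx22; rewrite ?be ?eb; ring.
Qed.

(** Conjugation by E places a 2 by 2 matrix in the upper left corner; [n2] makes E E^T = 1. *)
Let E : 'M[C]_(2, n) := pid_mx 2.
Let jE : 'M[jet C]_(2, n) := map_mx (fun a => jconst a) E.

Lemma pid_unitary : E *m E^T = 1%:M.
Proof. by rewrite tr_pid_mx pid_mx_id // pid_mx_1. Qed.

Lemma jE_unitary : jE *m jE^T = 1%:M.
Proof.
apply/matrixP => i j.
have := congr1 (fun Z : 'M[C]_2 => jconst (Z i j) : jet C) pid_unitary.
rewrite !mxE jconst_sum => e; transitivity (\sum_k jconst (E i k * E^T k j)).
  by apply: eq_bigr => k _; rewrite !mxE jconstM.
by rewrite e; case: (i == j).
Qed.

Lemma mval_jE : mval jE = E.
Proof. by apply/matrixP => i j; rewrite !mxE. Qed.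

Lemma mder_jE k : mder k jE = 0.
Proof. by apply/matrixP => i j; rewrite !mxE; exact: flat_jconst. Qed.

Lemma mval_jET : mval jE^T = E^T.
Proof. by apply/matrixP => i j; rewrite !mxE. Qed.

Lemma mder_jET k : mder k jE^T = 0.
Proof. by apply/matrixP => i j; rewrite !mxE; exact: flat_jconst. Qed.

Definition pn g : 'M[jet C]_n := jE^T *m p22 g *m jE.

Lemma pn_idem g : pn g *m pn g = pn g.
Proof.
exact: (embed_idempotent jE_unitary (p22_idem g)).
Qed.

Lemma mval_pn g : mval (pn g) = E^T *m mval (p22 g) *m E.
Proof. by rewrite /pn !mvalM mval_jE mval_jET. Qed.

Lemma mder_pn k g : mder k (pn g) = E^T *m mder k (p22 g) *m E.
Proof.
by rewrite /pn !mderM mder_jE mulmx0 addr0 mder_jET mval_jET mul0mx add0r mval_jE.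
Qed.

Definition loop g : 'M[jet C]_n := 1%:M + (W g - 1) *: pn g.

Definition chern_form g : C :=
  jder (ord3 1) ((2%:R * f g - 1) * (A g * (M g * M g))) -
  6 * (jder (ord3 1) (f g) * jval (A g * (M g * M g))).

(** D_1 P = 2 (s + |s|) D_1 s and M = s (s - |s|), and (s + |s|) (s - |s|) = 0. *)
Lemma Mj_dPj g : jval (M g) * jder (ord3 1) (P g) = 0.
Proof.
have v2 : `|sr g| * `|sr g| = sr g * sr g by rewrite -expr2 real_normK ?num_real.
have s0 := jval_sinj ev d gam g; have t0 := jval_sigj ev d gam g.
have dt := jder_sigj ev d gam (ord3 1) g.
rewrite /Mj /Pj; move: (s g) (t g) s0 t0 dt => a b a0 b0 db.
rewrite jderD expr2 jderM db -[jval (_ - _)]/(jval a * jval a - jval b) a0 b0.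
rewrite !rmorphM rmorph_nat.
have v2' : (`|sr g|)%:C%C * (`|sr g|)%:C%C = (sr g)%:C%C * (sr g)%:C%C :> C.
  by rewrite -!rmorphM v2.
transitivity (2 * (sr g)%:C%C * jder (ord3 1) a * ((sr g)%:C%C * (sr g)%:C%C -
  (`|sr g|)%:C%C * (`|sr g|)%:C%C)); first by ring.
by rewrite v2' subrr mulr0.
Qed.

Lemma omega_loop g : omega (loop g) =
  (ev (gam (ord3 2)) g - 2 + ev (- gam (ord3 2)) g) * chern_form g.
Proof.
have o01 : (ord3 0 == ord3 1) = false by exact: ord3_neq.
have o10 : (ord3 1 == ord3 0) = false by exact: ord3_neq.
have o02 : (ord3 0 == ord3 2) = false by exact: ord3_neq.
have o12 : (ord3 1 == ord3 2) = false by exact: ord3_neq.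
have o20 : (ord3 2 == ord3 0) = false by exact: ord3_neq.
have o21 : (ord3 2 == ord3 1) = false by exact: ord3_neq.
have fU k : (k == ord3 0) = false -> flat k (U g).
  by move=> k0; rewrite /flat (jder_exp ev d_gam) k0 mulr0.
have fU' k : (k == ord3 0) = false -> flat k (U' g).
  by move=> k0; rewrite /flat (jder_expV ev d_gam) k0 mulr0 oppr0.
rewrite /loop (@omega_idempotent _ _ (pn g) (W g) (W' g)).
- rewrite mval_pn !mder_pn (chern_embed _ _ _ pid_unitary); congr (_ * _).
  apply: chern_jets.
  + exact: flat_fj.
  + exact: flat_Aj.
  + exact: flat_Pj.
  + exact: flat_Mj.
  + by rewrite (jder_exp ev d_gam) eqxx mulr1.
  + by rewrite (jder_expV ev d_gam) eqxx mulr1.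
  + exact: fU.
  + exact: fU'.
  + exact: exp_gamK.
  + exact: PjMj.
  + exact: Mj_dPj.
- exact: pn_idem.
- exact: exp_gamK.
- by rewrite (jder_exp ev d_gam) o02 mulr0.
- by rewrite (jder_exp ev d_gam) o12 mulr0.
- by rewrite (jder_exp ev d_gam) eqxx mulr1.
rewrite mder_pn.
have -> : mder (ord3 2) (p22 g) = 0; last by rewrite mulmx0 mul0mx.
have fA := flat_Aj ev d_gam g o21; have fP := flat_Pj ev d_gam g o21.
have fM := flat_Mj ev d_gam g o21; have ff := flat_fj ev d_gam g o21.
have fx : flat (ord3 2) (x g) by exact: (flatM fA (flatD fP (flatM fM (fU _ o20)))).
have fy : flat (ord3 2) (y g) by exact: (flatD fP (flatM fM (fU' _ o20))).
have fd : flat (ord3 2) (1 - f g) by rewrite /flat jderB jder1 (ff : jder _ _ = 0) subrr.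
exact: (mder_flat22 ff fx fy fd).
Qed.

End ExampleMatrix.

Lemma jder_primitive (R : realType) k (p : jet R[i]) :
  jder k (jconst 2^-1 * (p * p) - jconst 3^-1 * (p * (p * p))) =
  jder k p * (jval p - jval p * jval p).
Proof.
rewrite jderB !jderM !(flat_jconst k _ : jder _ _ = 0) !jvalM.
rewrite -[jval (jconst 2^-1)]/(2^-1) -[jval (jconst 3^-1)]/(3^-1).
by field.
Qed.

(** * Nonvanishing of the degree of the loop *)

Section LoopDegree.
Context (R : realType) (G : topologicalType) (Gam : zmodType)
  (ev : characters R G Gam) (I : mean ev).
Context (d : {additive Gam -> 'rV[R[i]]_3}) (gam : 'I_3 -> Gam).
Hypothesis d_gam : forall k, d (gam k) = delta_mx 0 k.
Local Notation C := R[i].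
Local Notation g1 := (gam (ord3 1)).
Local Notation s := (sin_jet ev d gam).
Local Notation c := (cos_jet ev d gam).
Local Notation t := (signed_sin_jet ev d gam).
Local Notation f := (fj ev d gam).
Local Notation P := (Pj ev d gam).
Local Notation M := (Mj ev d gam).
Local Notation A := (Aj ev d gam).
Local Notation sr := (sinr ev gam).
Local Notation F := (chern_form ev d gam).

(** The frequencies of the Chern form, which depends on the phase of [gam (ord3 1)] alone. *)
Definition line : set Gam := [set j | exists z : int, j = g1 *~ z].

Lemma line_submonoid : submonoid line.
Proof.
split; first by exists 0; rewrite mulr0z.
by move=> _ _ [z ->] [w ->]; exists (z + w); rewrite mulrzDr.
Qed.

Let mS := line_submonoid.
Let S0 : line 0 := mS.1.

Lemma C1_nat S n : S 0 -> C1 ev d S (fun=> n%:R).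
Proof. by move=> S0'; rewrite -(jconst_nat R n); exact: C1_jconst. Qed.

Lemma C1_expV : C1 ev d line (exp_gam ev d gam (ord3 1)) /\
  C1 ev d line (exp_gamV ev d gam (ord3 1)).
Proof.
split; first by apply: C1_jchar; exists 1; rewrite mulr1z.
by apply: C1_jchar; exists (-1); rewrite mulrN1z.
Qed.

Lemma C1_sin : C1 ev d line s.
Proof.
have [CV CV'] := C1_expV.
have -> : s = fun g => jconst (2 * 'i%C)^-1 *
    (exp_gam ev d gam (ord3 1) g - exp_gamV ev d gam (ord3 1) g).
  by apply/funext => g; rewrite sin_jet.unlock.
exact: (C1_mul mS (C1_jconst ev d _ S0) (C1B S0 CV CV')).
Qed.

Lemma C1_cos : C1 ev d line c.
Proof.
have [CV CV'] := C1_expV.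
have -> : c = fun g => jconst 2^-1 *
    (exp_gam ev d gam (ord3 1) g + exp_gamV ev d gam (ord3 1) g).
  by apply/funext => g; rewrite cos_jet.unlock.
exact: (C1_mul mS (C1_jconst ev d _ S0) (C1D CV CV')).
Qed.

Lemma C1_signed_sin : C1 ev d line t.
Proof.
have -> : t = signed_square s sr by apply/funext => g; rewrite signed_sin_jet.unlock.
exact: (C1_signed_square mS C1_sin (jval_sinj ev d gam) (sinr_le1 ev gam)).
Qed.

Let Cs2 := C1X 2 mS C1_sin.

Lemma C1_f : C1 ev d line f.
Proof.
exact: (C1_mul mS (C1_jconst ev d _ S0) (C1D (C1_nat 2 S0)
  (C1_mul mS C1_cos (C1D (C1_nat 2 S0) Cs2)))).
Qed.

Lemma C1_P : C1 ev d line P. Proof. exact: (C1D Cs2 C1_signed_sin). Qed.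
Lemma C1_M : C1 ev d line M. Proof. exact: (C1B S0 Cs2 C1_signed_sin). Qed.

Lemma C1_A : C1 ev d line A.
Proof.
exact: (C1_mul mS (C1X 3 mS (C1_jconst ev d _ S0)) (C1D (C1_nat 3 S0) Cs2)).
Qed.

Let CM2 := C1_mul mS C1_M C1_M.
Let Ch := C1_mul mS C1_A CM2.
Let Cfh := C1_mul mS (C1B S0 (C1_mul mS (C1_nat 2 S0) C1_f) (C1_nat 1 S0)) Ch.

Lemma C1_chern_form : C1 ev (zero_weight R Gam) line (fun g => jconst (F g)).
Proof.
have -> : (fun g => jconst (F g)) = fun g =>
    jconst (jder (ord3 1) ((2%:R * f g - 1%:R) * (A g * (M g * M g)))) -
    jconst 6 * (jconst (jder (ord3 1) (f g)) * jconst (jval (A g * (M g * M g)))).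
  by apply/funext => g; rewrite /chern_form jconstB 2!jconstM.
exact: (C1B S0 (C1_zero_jder (ord3 1) Cfh) (C1_mul mS (C1_jconst ev _ _ S0)
  (C1_mul mS (C1_zero_jder (ord3 1) C1_f) (C1_zero_jval Ch)))).
Qed.

(** Its value (3 + s^2) s^6 |s| is nonnegative; up to a constant it is what remains of the Chern
    form modulo derivatives. *)
Let Zj g : jet C := (3%:R + s g ^+ 2) * (s g ^+ 5 * t g).

Let CZ : C1 ev d line Zj :=
  C1_mul mS (C1D (C1_nat 3 S0) Cs2) (C1_mul mS (C1X 5 mS C1_sin) C1_signed_sin).

Lemma jvalX (x : jet C) n : jval (x ^+ n) = jval x ^+ n.
Proof. by elim: n => // n IH; rewrite !exprS jvalM IH. Qed.

Lemma jval_nat n : jval (n%:R : jet C) = n%:R.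
Proof. exact: (rmorph_nat (@jval C)). Qed.

Lemma jval_Z g : jval (Zj g) = ((3 + sr g ^+ 2) * (sr g ^+ 5 * (sr g * `|sr g|)))%:C%C.
Proof.
rewrite /Zj 2!jvalM jvalD !jvalX jval_nat jval_sinj jval_sigj.
by rewrite !(rmorphD, rmorphM, rmorphXn, rmorph_nat).
Qed.

Lemma C1_setT S H : C1 ev d S H -> C1 ev d setT H.
Proof. exact: C1_sub. Qed.

Lemma mean_sin_sqr : I (fun g => jval (s g) ^+ 2) = 2^-1.
Proof.
have n0 : g1 + g1 != 0.
  apply/eqP => e; have := congr1 (fun z => d z 0 (ord3 1)) e.
  rewrite raddfD raddf0 d_gam !mxE !eqxx => /eqP.
  by rewrite -mulr2n mulrn_eq0 oner_eq0.
have n0' : - (g1 + g1) != 0 by rewrite oppr_eq0.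
have q4 : ((2 * 'i%C)^-1 ^+ 2 : C) = - 4^-1.
  by rewrite exprVn exprMn sqr_i mulrN1 invrN -natrX.
have -> : (fun g => jval (s g) ^+ 2) = fun g =>
    (- 4^-1) * ev (g1 + g1) g + (2^-1 * ev 0 g + (- 4^-1) * ev (- (g1 + g1)) g).
  apply/funext => g; rewrite jval_sinE exprMn q4 opprD !char_valD char0.
  have : ev g1 g * ev (- g1) g = 1 by rewrite -char_valD subrr char0.
  move: (ev g1 g) (ev (- g1) g) => v v' vv.
  transitivity (- 4^-1 * (v * v) + (2 / 4 * (v * v') - 4^-1 * (v' * v')) : C); first by ring.
  by rewrite vv; field.
have cc a j : ccontinuous (fun g => a * ev j g).
  exact: (ccontM (@ccont_cst R G a) (mean_char_cont I j)).
rewrite (meanD I (cc _ _) (ccontD (cc _ _) (cc _ _))) (meanD I (cc _ _) (cc _ _)).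
rewrite (meanZ I _ (mean_char_cont I (g1 + g1))) (meanZ I _ (mean_char_cont I 0)).
rewrite (meanZ I _ (mean_char_cont I (- (g1 + g1)))) !mean_char eqxx.
by rewrite (negbTE n0) (negbTE n0') !mulr0 add0r addr0 mulr1.
Qed.

Lemma mean_ge0 (k : G -> C) : ccontinuous k -> (forall g, 0 <= k g) ->
  0 <= complex.Re (I k).
Proof.
move=> ck k0; have c0 : ccontinuous (fun _ : G => (0 : C)) by exact: ccont_cst.
have z1 (g : G) : modc (0 : C) <= 1 by rewrite modc0.
have := mean_weight I c0 ck k0 z1; rewrite mulr1 => h.
by have := le_trans (modc_ge0 _) h; rewrite pmulr_rge0.
Qed.

(** The mean is bounded below by means of characters alone: Z >= s^2 / 2 - 3 / 16 pointwise, and the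
    right side has mean 1/4 - 3/16 = 1/16. *)
Lemma mean_Z_neq0 : I (fun g => jval (Zj g)) != 0.
Proof.
have cZ := C1_ccont_jval I CZ; have cs := C1_ccont_jval I C1_sin.
have cs2 : ccontinuous (fun g => - 2^-1 * jval (s g) ^+ 2).
  exact: (ccontM (@ccont_cst R G _) (ccontM cs cs)).
have cc : ccontinuous (fun g => (3 / 16) * ev 0 g).
  exact: (ccontM (@ccont_cst R G _) (mean_char_cont I 0)).
have k0 g : 0 <= jval (Zj g) + (- 2^-1 * jval (s g) ^+ 2 + (3 / 16) * ev 0 g).
  rewrite jval_Z jval_sinj char0 mulr1.
  have -> : (- 2^-1 : C) = (- 2^-1)%:C%C by rewrite rmorphN fmorphV rmorph_nat.
  have -> : (3 / 16 : C) = (3 / 16)%:C%C by rewrite rmorphM fmorphV !rmorph_nat.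
  rewrite -rmorphXn -rmorphM -!rmorphD ler0c.
  have := sinr_le1 ev gam g; have := normr_ge0 (sr g).
  have v2 : `|sr g| ^+ 2 = sr g ^+ 2 by rewrite real_normK ?num_real.
  have -> : sr g ^+ 5 * (sr g * `|sr g|) = (sr g ^+ 2) ^+ 3 * `|sr g| by ring.
  rewrite -v2; move: `|sr g| => a a0 a1.
  have a2 : a ^+ 2 <= a by rewrite expr2; nra.
  have u0 : 0 <= a ^+ 2 by rewrite exprn_ge0.
  have h1 : (a ^+ 2) ^+ 3 * (a ^+ 2) <= (3 + a ^+ 2) * ((a ^+ 2) ^+ 3 * a).
    apply: (@le_trans _ _ (1 * ((a ^+ 2) ^+ 3 * a))).
      by rewrite mul1r ler_wpM2l // exprn_ge0.
    by rewrite ler_wpM2r ?mulr_ge0 ?exprn_ge0 //; lra.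
  (* u / 2 - 3 / 16 is the tangent of u^4 at u = 1/2, the mean of u = s^2; the double root appears
     as the square. *)
  have h2 : 0 <= (a ^+ 2 - 2^-1) ^+ 2 * ((a ^+ 2) ^+ 2 + a ^+ 2 + 3 / 4).
    by rewrite mulr_ge0 ?sqr_ge0 // !addr_ge0 ?exprn_ge0 //; lra.
  have h3 : (a ^+ 2 - 2^-1) ^+ 2 * ((a ^+ 2) ^+ 2 + a ^+ 2 + 3 / 4) =
    (a ^+ 2) ^+ 3 * (a ^+ 2) - 2^-1 * a ^+ 2 + 3 / 16 by field.
  rewrite h3 in h2; lra.
have := mean_ge0 (ccontD cZ (ccontD cs2 cc)) k0.
rewrite (meanD I cZ (ccontD cs2 cc)) (meanD I cs2 cc) (meanZ I _ (ccontM cs cs)).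
have e2 : I (fun g => jval (s g) * jval (s g)) = 2^-1 := mean_sin_sqr.
rewrite (meanZ I _ (mean_char_cont I 0)) mean_char eqxx e2.
apply: contraL => /eqP ->.
have -> : (0 + (- 2^-1 * 2^-1 + 3 / 16 * 1%:R) : C) = (- 16^-1)%:C%C.
  by rewrite rmorphN fmorphV rmorph_nat; field.
by rewrite -ltNge /= oppr_lt0 invr_gt0.
Qed.

(** As t^2 = s^4, M^2 = 2 s^4 - 2 s^2 t. The s^4 part of h is (f - f^2) / 2 and gives a derivative
    of a polynomial in f; the s^2 t part gives Z. *)
Lemma jval_fdh g : jder (ord3 1) (f g) * jval (A g * (M g * M g)) =
  2^-1 * jder (ord3 1) (jconst 2^-1 * (f g * f g) - jconst 3^-1 * (f g * (f g * f g))) +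
  (- (3 * 'i%C / 128)) * jval (Zj g).
Proof.
have fs := congr1 jval (fj_sqr ev d gam g); have tt := congr1 jval (sigj_sqr ev d gam g).
have f1 := jder1_fj ev d_gam g.
rewrite jder_primitive.
have hE : jval (A g * (M g * M g)) = 4^-1 ^+ 3 * (3 + jval (s g) ^+ 2) *
   ((jval (s g) ^+ 2 - jval (t g)) * (jval (s g) ^+ 2 - jval (t g))) by [].
have ZE : jval (Zj g) = (3 + jval (s g) ^+ 2) * (jval (s g) ^+ 5 * jval (t g)).
  by rewrite 2!jvalM jvalD !jvalX jval_nat.
have fsE : jval (f g) - jval (f g) * jval (f g) =
    4^-1 ^+ 2 * (3 + jval (s g) ^+ 2) * jval (s g) ^+ 4.
  exact: fs.
have ttE : jval (t g) ^+ 2 = jval (s g) ^+ 4 := tt.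
rewrite hE ZE f1; move: (jval (s g)) (jval (t g)) (jval (f g)) fsE ttE => a b p fsE ttE.
transitivity (3 * 'i%C / 4 * a ^+ 3 * (4^-1 ^+ 3 * (3 + a ^+ 2) *
  (a ^+ 4 - 2 * a ^+ 2 * b + b ^+ 2)) : C); first by ring.
rewrite ttE.
transitivity (2^-1 * (3 * 'i%C / 4 * a ^+ 3) * (4^-1 ^+ 2 * (3 + a ^+ 2) * a ^+ 4) -
  3 * 'i%C / 128 * ((3 + a ^+ 2) * (a ^+ 5 * b)) : C); first by field.
by rewrite -fsE; field.
Qed.

Let Q g : jet C := jconst 2^-1 * (f g * f g) - jconst 3^-1 * (f g * (f g * f g)).

Let CQ : C1 ev d line Q :=
  C1B S0 (C1_mul mS (C1_jconst ev d _ S0) (C1_mul mS C1_f C1_f))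
    (C1_mul mS (C1_jconst ev d _ S0) (C1_mul mS C1_f (C1_mul mS C1_f C1_f))).

Lemma mean_chern_form : I F = 6 * (3 * 'i%C / 128) * I (fun g => jval (Zj g)).
Proof.
have cfh := C1_ccont_jder I (ord3 1) Cfh; have cQ := C1_ccont_jder I (ord3 1) CQ.
have cZ := C1_ccont_jval I CZ.
have -> : F = fun g => jder (ord3 1) ((2%:R * f g - 1%:R) * (A g * (M g * M g))) +
    ((- 3) * jder (ord3 1) (Q g) + 6 * (3 * 'i%C / 128) * jval (Zj g)).
  apply/funext => g; rewrite /chern_form jval_fdh; congr (_ + _).
  rewrite -[jconst _ * _ - _]/(Q g).
  by move: (jder _ _) (jval _) => q z; field.
have cQ3 : ccontinuous (fun g => - 3 * jder (ord3 1) (Q g)).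
  exact: (ccontM (@ccont_cst R G _) cQ).
have cZ6 : ccontinuous (fun g => 6 * (3 * 'i%C / 128) * jval (Zj g)).
  exact: (ccontM (@ccont_cst R G _) cZ).
rewrite (meanD I cfh (ccontD cQ3 cZ6)) (meanD I cQ3 cZ6) (meanZ I _ cQ) (meanZ I _ cZ).
rewrite (mean_jder I (ord3 1) (C1_setT Cfh)) (mean_jder I (ord3 1) (C1_setT CQ)).
by rewrite mulr0 !add0r.
Qed.

Lemma line_not : ~ line (- gam (ord3 2)) /\ ~ line (- - gam (ord3 2)).
Proof.
have o21 : (ord3 2 == ord3 1) = false by exact: ord3_neq.
have D z : d (g1 *~ z) 0 (ord3 2) = 0.
  rewrite raddfMz d_gam; case: z => m; rewrite ?NegzE ?mulrNz ?mxE -pmulrn.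
    by elim: m => [|m IH]; rewrite ?mulrS !mxE // IH o21 addr0.
  apply/eqP; rewrite oppr_eq0; apply/eqP.
  by elim: m.+1 => [|{}m IH]; rewrite ?mulrS !mxE // IH o21 addr0.
by split=> -[z e]; have := D z; rewrite -e ?opprK ?raddfN d_gam !mxE !eqxx;
  move/eqP; rewrite ?oppr_eq0 oner_eq0.
Qed.

Variable n : nat.
Hypothesis n2 : (2 <= n)%N.

(** In (w - 2 + w') times the Chern form only the term with -2 has a nonzero mean, since
    [gam (ord3 2)] and its opposite lie off the line of frequencies. *)
Lemma degree_loop_neq0 : degree I (loop ev d gam n) != 0.
Proof.
have [l1 l2] := line_not.
have CF := C1_chern_form; have cF := C1_ccont_jval I CF.
have E j : ~ line (- j) -> I (fun g => F g * ev j g) = 0.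
  exact: (mean_jval_char I CF).
have -> : degree I (loop ev d gam n) = I (fun g => F g * ev (gam (ord3 2)) g +
    ((- 2) * F g + F g * ev (- gam (ord3 2)) g)).
  by congr (mean_val I _); apply/funext => g; rewrite (omega_loop ev d_gam n2); ring.
have c1 := ccontM cF (mean_char_cont I (gam (ord3 2))).
have c2 := ccontM cF (mean_char_cont I (- gam (ord3 2))).
have c3 : ccontinuous (fun g => (- 2) * F g) := ccontM (@ccont_cst R G (- 2)) cF.
rewrite (meanD I c1 (ccontD c3 c2)) (meanD I c3 c2) (meanZ I _ cF) (E _ l1) (E _ l2).
rewrite add0r addr0 mean_chern_form.
rewrite !mulf_neq0 ?oppr_eq0 ?invr_eq0 ?pnatr_eq0 ?i_neq0 //.
exact: mean_Z_neq0.
Qed.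

Lemma C1GL_loop : C1GL ev d setT (loop ev d gam n).
Proof.
have mT : submonoid (@setT Gam) by [].
have T0 : (@setT Gam) 0 by [].
have CU : C1 ev d setT (exp_gam ev d gam (ord3 0)) by exact: C1_jchar.
have CU' : C1 ev d setT (exp_gamV ev d gam (ord3 0)) by exact: C1_jchar.
have CW : C1 ev d setT (exp_gam ev d gam (ord3 2)) by exact: C1_jchar.
have CW' : C1 ev d setT (exp_gamV ev d gam (ord3 2)) by exact: C1_jchar.
have Cf := C1_setT C1_f; have CP := C1_setT C1_P.
have CM := C1_setT C1_M; have CA := C1_setT C1_A.
have Cx := C1_mul mT CA (C1D CP (C1_mul mT CM CU)).
have Cy := C1D CP (C1_mul mT CM CU').
have Cp : C1mx ev d setT (p22 ev d gam).
  move=> i j.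
  have -> : (fun g => p22 ev d gam g i j) =
    if i == 0 then (if j == 0 then f else xj ev d gam)
    else (if j == 0 then yj ev d gam else fun g => 1%:R - f g).
    by apply/funext => g; rewrite mxE; case: (i == 0); case: (j == 0).
  case: (i == 0); case: (j == 0); [exact: Cf|exact: Cx|exact: Cy|].
  exact: (C1B T0 (C1_nat 1 T0) Cf).
have CE := C1mx_cst ev d (pid_mx 2 : 'M[C]_(2, n)) T0.
have CET : C1mx ev d setT (fun=> (map_mx (fun a => jconst a) (pid_mx 2 : 'M[C]_(2, n)))^T).
  move=> i j; have -> : (fun _ : G => (map_mx (fun a => jconst a)
      (pid_mx 2 : 'M[C]_(2, n)))^T i j) = fun=> jconst ((pid_mx 2 : 'M[C]_(2, n)) j i).
    by apply/funext => g; rewrite 2!mxE.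
  exact: C1_jconst.
have Cpn : C1mx ev d setT (pn ev d gam n) := C1mxM mT (C1mxM mT CET Cp) CE.
have Cl (w : G -> jet C) : C1 ev d setT w ->
    C1mx ev d setT (fun g => 1%:M + (w g - 1) *: pn ev d gam n g).
  move=> Cw i j.
  have -> : (fun g => (1%:M + (w g - 1) *: pn ev d gam n g) i j) =
      fun g => (1%:M : 'M[jet C]_n) i j + ((w g - 1) *: pn ev d gam n g) i j.
    by apply/funext => g; rewrite [LHS]mxE.
  have Cw1 : C1 ev d setT (fun g => w g - 1) := C1B T0 Cw (C1_nat 1 T0).
  have C11 : C1 ev d setT (fun=> (1%:M : 'M[jet C]_n) i j) := C1mx1 ev d T0 i j.
  have C12 : C1 ev d setT (fun g => ((w g - 1) *: pn ev d gam n g) i j).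
    exact: (C1mxZ mT Cw1 Cpn i j).
  exact: (C1D C11 C12).
split; first exact: (Cl _ CW).
exists (fun g => 1%:M + (exp_gamV ev d gam (ord3 2) g - 1) *: pn ev d gam n g).
  exact: (Cl _ CW').
move=> g; apply: idempotent_loop_inv; first exact: pn_idem.
exact: exp_gamK.
Qed.

End LoopDegree.

(** * Matrices over an admissible algebra *)

Section AdmissibleMatrices.
Context (R : realType) (G : topologicalZmodType) (Gam : zmodType)
  (ev : Gam -> G -> R[i]) (ev_dual : character_group ev) (B : funBanach R G).
Hypothesis B_admissible : admissible ev B.
Context (d : {additive Gam -> 'rV[R[i]]_3}).
Local Notation chs := (dual_characters ev_dual).

Lemma trig_poly_trig f : trig_poly ev f -> exists s, forall g, f g = trig chs s g.
Proof.
by move=> [s [c ->]]; exists [seq (c j, j) | j <- s] => g; rewrite /trig big_map.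
Qed.

Lemma jval_tpoly s g : jval (tpoly chs d s g) = trig chs s g.
Proof.
rewrite /tpoly /trig; elim: s => [|p s IH]; first by rewrite !big_nil.
by rewrite 2!big_cons -IH.
Qed.

Lemma trig_poly_dense (b : B) (e : R) : 0 < e ->
  exists2 b' : B, bnorm (b - b') < e & trig_poly ev (fbval b').
Proof.
move=> e0; have [_ dB _] := B_admissible.
have ec0 : 0 < e%:C%C by rewrite ltcR.
have [||b' [/interior_subset bb' tb']] := dB (ball b e%:C%C)°.
- exists b; rewrite /interior; exact: nbhsx_ballx.
- exact: open_interior.
exists b' => //; move: bb'.
by rewrite -ball_normE /ball_ /= bnormE ltcR.
Qed.

Variable n : nat.
Implicit Types (X Y : 'M[B]_n).

Lemma mxvalM X Y g : mxval (X *m Y) g = mxval X g *m mxval Y g.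
Proof.
apply/matrixP => i j; rewrite !mxE fbval_sum; apply: eq_bigr => k _.
by rewrite !mxE fbvalM.
Qed.

Lemma mxval1 g : mxval (1%:M : 'M[B]_n) g = 1%:M.
Proof.
by apply/matrixP => i j; rewrite !mxE; case: (i == j); rewrite ?fbval1 ?fbval0.
Qed.

Lemma mxval_inj X Y : (forall g, mxval X g = mxval Y g) -> X = Y.
Proof.
move=> XY; apply/matrixP => i j; apply: fbval_inj => g.
by have := congr1 (fun M : 'M[R[i]]_n => M i j) (XY g); rewrite !mxE.
Qed.

Lemma mxval_inverse X Y : X *m Y = 1%:M -> forall g, mxval X g *m mxval Y g = 1%:M.
Proof. by move=> XY g; rewrite -mxvalM XY mxval1. Qed.

Lemma close_mxval (e : R) X Y : (forall i j, bnorm (X i j - Y i j) <= e) ->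
  close e (mxval X) (mxval Y).
Proof.
by move=> XY g i j; rewrite 2!mxE -fbvalB (le_trans (modc_fbval_le _ _)).
Qed.

Lemma approx_entries S X :
  (forall i j (e : R), 0 < e -> exists s, (forall p, p \in s -> S p.2) /\
     forall g, modc (fbval (X i j) g - trig chs s g) <= e) ->
  approx chs d S (mxval X).
Proof.
move=> XS e e0; have /choice[s sP] (ij : 'I_n * 'I_n) := XS ij.1 ij.2 e e0.
exists (fun g => \matrix_(i, j) tpoly chs d (s (i, j)) g) => [i j|g i j].
  rewrite (_ : (fun g => _) = tpoly chs d (s (i, j))); last first.
    by apply/funext => g; rewrite mxE.
  by apply: C1_tpoly; exact: (sP (i, j)).1.
by rewrite 3!mxE jval_tpoly; exact: (sP (i, j)).2.
Qed.

Lemma fbval_trig (b : B) (e : R) : 0 < e ->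
  exists s, forall g, modc (fbval b g - trig chs s g) <= e.
Proof.
move=> e0; have [b' bb' /trig_poly_trig[s sE]] := trig_poly_dense b e0.
by exists s => g; rewrite -sE -fbvalB (le_trans (modc_fbval_le _ _)) // ltW.
Qed.

Lemma approx_mxval X : approx chs d setT (mxval X).
Proof.
by apply: approx_entries => i j e e0; have [s ?] := fbval_trig (X i j) e0; exists s.
Qed.

(** Inverse closedness is a statement about scalars: it is applied to the determinant, and the
    adjugate supplies the inverse matrix. *)
Lemma GLmx_pointwise X : (forall g, mxval X g \in unitmx) -> @GLmx R G B n X.
Proof.
move=> uX; have [_ _ invB] := B_admissible.
have detE g : fbval (\det X) g = \det (mxval X g).
  rewrite /determinant fbval_sum; apply: eq_bigr => s _.
  rewrite fbvalM fbval_prod; congr (_ * _).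
    by case: (perm.odd_perm s); rewrite ?expr0 ?expr1 ?fbvalN fbval1.
  by apply: eq_bigr => i _; rewrite mxE.
have [|b [Db bD]] := invB (\det X).
  exists (fun g => (\det (mxval X g))^-1); split.
    move=> x; apply: (@cvgV R[i] G (nbhs x) _ (fun g => \det (mxval X g))).
      by rewrite -unitfE -unitmxE.
    have := @fb_val_cont R G B (\det X) x.
    rewrite (_ : fb_val B (\det X) = fun g => \det (mxval X g)) //.
    by apply/funext.
  by move=> g; rewrite detE divff // -unitfE -unitmxE.
have XY : X *m (\adj X *m b%:M) = 1%:M.
  by rewrite mulmxA mul_mx_adj -scalar_mxM Db.
exists (\adj X *m b%:M); split=> //; apply: mxval_inj => g.
by rewrite mxvalM mxval1; apply: mulmx1C; exact: mxval_inverse.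
Qed.

Hypothesis G_compact : compact [set: G].
Variable mu : probability (borel G) R.
Hypothesis mu_haar : is_haar mu.
Local Notation I := (haar_mean G_compact ev_dual mu_haar).
Local Notation GL := (@GLmx R G B n).
Implicit Types (c : R[i]).

Lemma approx_spectral S X :
  (forall i j, @spectral_subalgebra R G mu Gam ev S B (X i j)) -> approx chs d S (mxval X).
Proof.
move=> XS; apply: approx_entries => i j.
move=> e; apply: (@spectral_synthesis _ _ _ _ I S (fbval (X i j))) => [||k Ik].
- exact: fb_val_cont.
- exact: fbval_trig.
apply: (XS i j k); apply: contra_neq Ik => bk; rewrite -[RHS]bk.
congr (cint mu _); apply/funext => g; congr (_ * _).
by rewrite -(conj_char chs).
Qed.

Definition mx_degree X c := has_degree I d (mxval X) c.

Lemma mx_degree_ex X : GL X -> exists c, mx_degree X c.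
Proof.
move=> [Y [XY _]].
exact: (has_degree_ex I (approx_mxval X) (approx_mxval Y) (mxval_inverse XY)).
Qed.

Lemma mx_degree_uniq X c c' : mx_degree X c -> mx_degree X c' -> c = c'.
Proof. exact: (has_degree_uniq (approx_mxval X)). Qed.

Lemma mx_degree1 : mx_degree 1%:M 0.
Proof.
rewrite /mx_degree (_ : mxval _ = fun=> 1%:M); first exact: has_degree1.
by apply/funext => g; exact: mxval1.
Qed.

Lemma mx_degreeM X Y c c' : GL X -> GL Y -> mx_degree X c -> mx_degree Y c' ->
  mx_degree (X *m Y) (c + c').
Proof.
move=> [X' [XX' _]] [Y' [YY' _]] hX hY.
rewrite /mx_degree (_ : mxval _ = fun g => mxval X g *m mxval Y g); last first.
  by apply/funext => g; exact: mxvalM.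
exact: (has_degreeM (approx_mxval X) (approx_mxval X') (approx_mxval Y) (approx_mxval Y')
  (mxval_inverse XX') (mxval_inverse YY') hX hY).
Qed.

Lemma mx_degreeV X Y c : X *m Y = 1%:M -> mx_degree X c -> mx_degree Y (- c).
Proof.
move=> XY; exact: (has_degreeV (approx_mxval X) (approx_mxval Y) (mxval_inverse XY)).
Qed.

Lemma mx_degree_open c : open [set X | mx_degree X c].
Proof.
rewrite openE => X hX; have [e e0 He] := has_degree_open hX.
apply/nbhs_ballP; exists e%:C%C => /=; first by rewrite ltcR.
move=> Y [_ XY]; apply: He; apply: close_mxval => i j.
by have := XY i j; rewrite -ball_normE /ball_ /= bnormE ltcR => /ltW.
Qed.

(** On the connected image of the path, the points of degree c form a nonempty open and closed
    subset. *)
Lemma mx_degree_path X Y c : path_joined R GL X Y -> mx_degree X c -> mx_degree Y c.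
Proof.
move=> [p [cp <- <-] GLp] h0; pose D := p @` `[0, 1].
pose U := D `&` [set X | mx_degree X c].
have UD : U = D.
  apply: (connected_continuous_connected (@segment_connected R 0 1) cp).
  - exists (p 0); split=> //; exists 0 => //.
    by rewrite /= in_itv /= lexx ler01.
  - by exists [set X | mx_degree X c] => //; exact: mx_degree_open.
  (* Every point of the path is invertible and has a degree, so the complement is the union of the
     open sets of the other degrees. *)
  exists (~` \bigcup_(c' in [set c' | c' != c]) [set X | mx_degree X c']).
    by apply: open_closedC; apply: bigcup_open => c' _; exact: mx_degree_open.
  rewrite /U; apply/seteqP; split=> Z [DZ hZ]; split=> //.
    by move=> [c' /= /eqP c'c hZ']; apply: c'c; exact: mx_degree_uniq hZ' hZ.
  have [t t01 ptZ] := DZ; have [c' hZ'] := mx_degree_ex (GLp t t01).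
  rewrite ptZ in hZ'; rewrite /=; have [<-//|c'c] := eqVneq c' c.
  by case: hZ; exists c'.
have : D (p 1) by exists 1 => //; rewrite /= in_itv /= lexx ler01.
by rewrite -UD => -[].
Qed.

Lemma GLmxM X Y : GL X -> GL Y -> GL (X *m Y).
Proof.
move=> [X' [XX' X'X]] [Y' [YY' Y'Y]]; exists (Y' *m X'); split.
  by rewrite -[_ * _]/(_ *m _) mulmxA -(mulmxA X) [Y *m Y']YY' mulmx1.
by rewrite -[_ * _]/(_ *m _) mulmxA -(mulmxA Y') [X' *m X]X'X mulmx1.
Qed.

Definition degree0 : set 'M[B]_n := GL `&` [set X | mx_degree X 0].

Lemma degree0_closed_subgroup : closed_subgroup degree0.
Proof.
split.
- by move=> X [].
- split; last exact: mx_degree1.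
  by exists 1%:M; split; exact: mul1mx.
- move=> X Y [GX hX] [GY hY]; split; first exact: GLmxM.
  by rewrite /= -[0]addr0; exact: mx_degreeM.
- move=> X Y [GX hX] XY YX; split; first by exists X; split.
  by rewrite /= -oppr0; exact: mx_degreeV XY hX.
(* X has some degree c, and the open set of degree c around X meets [degree0], which forces c =
   0. *)
move=> X [clX GX]; split=> //; have [c hX] := mx_degree_ex GX.
have [Y [[_ hY] hY']] := clX _ (open_nbhs_nbhs (conj (@mx_degree_open c) hX)).
by rewrite /= (mx_degree_uniq hY hY').
Qed.

Lemma mx_degree_cone S X : submonoid S -> pointed S ->
  GL_over (@spectral_subalgebra R G mu Gam ev S B) X -> degree0 X.
Proof.
move=> mS pS [X' [XX' X'X CX]]; split; first by exists X'.
apply: (has_degree_pointed I mS pS _ _ (mxval_inverse XX')); apply: approx_spectral.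
  by move=> i j; have [] := CX i j.
by move=> i j; have [] := CX i j.
Qed.

Lemma mx_degree_triangular X : (forall i j : 'I_n, (j < i)%N -> X i j = 0) ->
  (forall i, invertible (X i i)) -> degree0 X.
Proof.
move=> tX iX; have GX : GL X.
  apply: GLmx_pointwise => g; rewrite unitmxE -det_tr det_trig.
    rewrite unitfE prodf_seq_neq0; apply/allP => i _ /=; rewrite 2!mxE.
    have [y [Xy _]] := iX i; apply: contra_eq_neq (fbval1 B g) => X0.
    by rewrite -Xy fbvalM X0 mul0r eq_sym oner_eq0.
  by apply/is_trig_mxP => i j ij; rewrite 2!mxE tX // fbval0.
split=> //; have [Y [XY _]] := GX.
apply: (has_degree_triangular I (approx_mxval X) (approx_mxval Y) (mxval_inverse XY)).
by move=> g i j ij; rewrite mxE tX // fbval0.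
Qed.

Variable le : rel Gam.
Hypothesis le_order : ordered_group le.

Lemma cones_pointed : (submonoid (nonneg_cone le) /\ pointed (nonneg_cone le)) /\
  (submonoid (nonpos_cone le) /\ pointed (nonpos_cone le)).
Proof.
have [le_refl le_anti le_trans' _ leD] := le_order.
have pos a b : le 0 a -> le 0 b -> le 0 (a + b).
  move=> a0 b0; apply: le_trans' b0 _.
  by have := leD _ _ b a0; rewrite add0r.
have neg a b : le a 0 -> le b 0 -> le (a + b) 0.
  move=> a0 b0; apply: le_trans' b0.
  by have := leD _ _ b a0; rewrite add0r.
split; split; (try by split=> //; exact: le_refl); move=> a b /= a0 b0 ab.
  apply: le_anti; rewrite {}b0 andbT; have := leD _ _ b a0.
  by rewrite ab add0r.
apply: le_anti; rewrite {}b0 /=; have := leD _ _ b a0.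
by rewrite ab add0r.
Qed.

Lemma Tgroup_degree0 : @Tgroup R G mu Gam ev le B n `<=` degree0.
Proof.
apply: smallest_sub; first exact: degree0_closed_subgroup.
have [[mp pp] [mn pn]] := cones_pointed.
have [_ _ dM _ _] := degree0_closed_subgroup.
move=> X [Am [T [Ap [GAm GAp tT iT XE]]]].
have -> : X = Am *m T *m Ap by apply: mxval_inj => g; rewrite XE !mxvalM.
apply: (dM); last exact: (mx_degree_cone mp pp GAp).
apply: (dM); first exact: (mx_degree_cone mn pn GAm).
exact: mx_degree_triangular.
Qed.

End AdmissibleMatrices.

(** * Components of nonzero degree *)

Section NonzeroDegree.
Context (R : realType) (G : topologicalZmodType) (Gam : zmodType)
  (ev : Gam -> G -> R[i]) (ev_dual : character_group ev) (B : funBanach R G).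
Hypothesis B_admissible : admissible ev B.
Context (d : {additive Gam -> 'rV[R[i]]_3}) (gam : 'I_3 -> Gam).
Hypothesis d_gam : forall k, d (gam k) = delta_mx 0 k.
Hypothesis G_compact : compact [set: G].
Variable mu : probability (borel G) R.
Hypothesis mu_haar : is_haar mu.
Variable n : nat.
Hypothesis n2 : (2 <= n)%N.
Local Notation chs := (dual_characters ev_dual).
Local Notation I := (haar_mean G_compact ev_dual mu_haar).
Local Notation GL := (@GLmx R G B n).
Local Notation mxdeg := (@mx_degree R G Gam ev ev_dual B d n G_compact mu mu_haar).

Lemma trig_range s : exists b : B, forall g, fbval b g = trig chs s g.
Proof.
have [tB _ _] := B_admissible.
elim: s => [|p s [b bE]].
  by exists 0 => g; rewrite fbval0 /trig big_nil.
have [|c _ cE] := tB (ev p.2).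
  by exists [:: p.2], (fun=> 1); apply/funext => g; rewrite big_seq1 mul1r.
exists (p.1 *: c + b) => g; rewrite fbvalD fbvalZ cE bE.
by rewrite /trig big_cons.
Qed.

(** The loop involves s |s|, only a limit of trigonometric polynomials and perhaps not in B; a close
    matrix of trigonometric polynomials is in B and has the same degree. *)
Lemma mx_degree_neq0 : exists X c, [/\ GL X, mxdeg X c & c != 0].
Proof.
pose L := loop chs d gam n; have [CL [L' CL' LL']] := C1GL_loop chs d gam n2.
have aC1 (P : G -> 'M[jet R[i]]_n) : C1mx chs d setT P -> approx chs d setT (mvalf P).
  by move=> CP e e0; exists P => // g i j; rewrite subrr modc0 ltW.
have LL'v g : mvalf L g *m mvalf L' g = 1%:M by rewrite -mvalM LL' mval1.
have [c hc] := has_degree_ex I (aC1 _ CL) (aC1 _ CL') LL'v.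
have [e e0 He] := hc; have [e' e'0 He'] := has_degree_open hc.
have m0 : 0 < Num.min e e' by rewrite lt_min e0.
have /choice[s sP] (ij : 'I_n * 'I_n) := CL ij.1 ij.2 _ m0.
have /choice[b bP] (ij : 'I_n * 'I_n) := trig_range (s ij).
pose X : 'M[B]_n := \matrix_(i, j) b (i, j).
pose P g := \matrix_(i, j) tpoly chs d (s (i, j)) g.
have CP : C1mx chs d setT P.
  move=> i j; rewrite (_ : (fun g => _) = tpoly chs d (s (i, j))).
    by apply: C1_tpoly => p _.
  by apply/funext => g; rewrite mxE.
have XP : mxval X = mvalf P.
  by apply/funext => g; apply/matrixP => i j; rewrite 4!mxE bP jval_tpoly.
have LP : close (Num.min e e') (mvalf L) (mvalf P).
  move=> g i j; rewrite [mvalf P g i j]mxE mxE [P g i j]mxE.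
  exact: (le_trans (modc_jval_le (L g i j - tpoly chs d (s (i, j)) g) ler01)
    ((sP (i, j)).2 g)).
have [GP _] := He _ CP (closeW (min_lel _ _) LP).
exists X, c; split.
- apply: (GLmx_pointwise B_admissible) => g; rewrite XP; have [_ [Q _ PQ]] := GP.
  by have [] := @mulmx1_unit _ _ (mval (P g)) (mval (Q g)); rewrite -?mvalM ?PQ ?mval1.
- by rewrite /mx_degree XP; apply: He'; exact: closeW (min_ler _ _) LP.
have clL : close e (mvalf L) (mvalf L) by move=> g i j; rewrite subrr modc0 ltW.
have [_ <-] := He _ CL clL; exact: (degree_loop_neq0 I d_gam n2).
Qed.

End NonzeroDegree.

Theorem theorem8p1 (R : realType)
    (Gam : zmodType) (Gam_tf : torsion_free Gam) (Gam_Z3 : contains_Z3 Gam)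
    (G : topologicalZmodType)
    (G_hausdorff : hausdorff_space G) (G_compact : compact [set: G])
    (G_connected : connected [set: G])
    (ev : Gam -> G -> R[i]) (ev_dual : character_group ev)
    (mu : probability (borel G) R) (mu_haar : is_haar mu)
    (le : rel Gam) (le_order : ordered_group le)
    (B : funBanach R G) (B_admissible : admissible ev B)
    (n : nat) (n_ge2 : (2 <= n)%N) :
  infinite_set [set P : set 'M[B]_n |
    path_components R (@GLmx R G B n) P /\
    P `&` @Tgroup R G mu Gam ev le B n = set0] /\
  ~ (@GLmx R G B n `<=` closure (@Tgroup R G mu Gam ev le B n)).
Proof.
have [d [gam d_gam]] := weights_Z3 R Gam_Z3.
have [X [c [GX hX c0]]] :=
  mx_degree_neq0 ev_dual B_admissible d_gam G_compact mu_haar n_ge2.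
pose deg := @mx_degree R G Gam ev ev_dual B d n G_compact mu mu_haar.
have degT Y : @Tgroup R G mu Gam ev le B n Y -> deg Y 0.
  by move=> /(Tgroup_degree0 ev_dual B_admissible d G_compact mu_haar le_order)[].
have powX k : @GLmx R G B n (X ^+ k) /\ deg (X ^+ k) (c *+ k).
  elim: k => [|k [Gk hk]].
    by split; [exists 1%:M; split; exact: mul1mx|exact: mx_degree1].
  rewrite exprS mulrS; split; first exact: GLmxM.
  exact: (mx_degreeM B_admissible GX Gk hX hk).
(* Exponents start at 1, so the degrees c (k + 1) are nonzero; being multiples of c != 0 in
   characteristic 0, they are also pairwise distinct. *)
pose comp k := [set Y | path_joined R (@GLmx R G B n) (X ^+ k.+1) Y].
have degc k Y : comp k Y -> deg Y (c *+ k.+1).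
  by move=> /(mx_degree_path B_admissible); apply; exact: (powX k.+1).2.
split.
  have comp_inj : injective comp.
    move=> k l kl; have : comp l (X ^+ k.+1).
      rewrite -kl; exists (fun=> X ^+ k.+1); split=> // [|t _].
        by apply: continuous_subspaceT => t; exact: cvg_cst.
      exact: (powX k.+1).1.
    move=> /degc hl; have /eqP := mx_degree_uniq B_admissible (powX k.+1).2 hl.
    rewrite -mulr_natr -[c *+ l.+1]mulr_natr (inj_eq (mulfI c0)) eqr_nat eqSS.
    by move=> /eqP.
  move=> /(finite_preimage (in2W comp_inj)) fin; apply: infinite_nat.
  apply: sub_finite_set fin => k _; split; first by exists (X ^+ k.+1) => //; exact: (powX k.+1).1.
  apply/seteqP; split=> // Y [/degc hk /degT h0].
  have /eqP := mx_degree_uniq B_admissible hk h0.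
  by rewrite mulrn_eq0 (negPf c0).
have nX : nbhs X [set Y | deg Y c].
  by apply: open_nbhs_nbhs; split=> //; exact: mx_degree_open.
move=> /(_ X GX _ nX)[Y [/degT h0 hY]]; move/eqP: c0; apply.
exact: (mx_degree_uniq B_admissible hY h0).
Qed.
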